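(* For every $0<\alpha<1$ there exists a constant $C(\alpha)>0$, depending only on $\alpha$, such that the following holds. Let $\Omega\subset\mathbb{C}$ be a domain and let $f:\mathbb{H}\to\Omega$ be a conformal map of the upper half plane $\mathbb{H}$ onto $\Omega$. Given $z_0=x_0+iy_0\in\mathbb{H}$, there exists a set $E=E(z_0,\alpha)\subset(x_0-y_0/2,\,x_0+y_0/2)$ such that: (a) $\mathcal{H}^{\alpha}_{\infty}(E)\geq \dfrac{y_0^{\alpha}}{C(\alpha)}$; (b) $\dfrac{1}{C(\alpha)}|f'(z_0)|\leq|f'(w)|\leq C(\alpha)|f'(z_0)|$ for every point $w\in\mathbb{H}$ in the sawtooth region $$S(E):=\{x+iy:\ x\in(x_0-y_0/2,\,x_0+y_0/2),\ d(x,E)\leq y<y_0\}.$$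
   Context: $\mathbb{H}=\{z\in\mathbb{C}:\mathrm{Im}\,z>0\}$. A conformal map is a holomorphic bijection onto its image domain. $d(x,E)$ is the Euclidean distance from the point $x\in\mathbb{R}$ to the set $E\subset\mathbb{R}$. For $A\subset\mathbb{C}$ the $\alpha$-Hausdorff content is $\mathcal{H}^{\alpha}_{\infty}(A):=\inf\{\sum_{j=1}^{\infty}\mathrm{diam}(E_j)^{\alpha}: E_j\subset\mathbb{C},\ A\subset\bigcup_{j\in\mathbb{N}}E_j\}$. *)

(* Defs.v *)
From HB Require Import structures.
From mathcomp Require Import all_boot all_order all_algebra complex.
From mathcomp Require Import all_classical all_reals all_analysis.

Set Implicit Arguments.
Unset Strict Implicit.
Unset Printing Implicit Defensive.

Import Order.TTheory GRing.Theory Num.Theory.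
Import numFieldNormedType.Exports.
(* normc is the modulus as a real number; `|z| is an element of R[i]. *)
Import Normc.

Local Open Scope classical_set_scope.
Local Open Scope ring_scope.

(* R[i] seen as a numClosedFieldType: the topology, the norm and the
   derivative that MathComp-Analysis attaches to a number field are only
   found through this structure. In particular, derivable f z 1 and
   derive1 f z are complex differentiability and the complex derivative,
   since the difference quotient is indexed by h : CC R. *)
Notation CC R := (Num.ClosedField.sort (R[i] : numClosedFieldType)).

Section Defs.
Variable R : realType.

Definition upper_half_plane : set (CC R) := [set z | 0 < complex.Im z].

Definition domain (D : set (CC R)) := [/\ D !=set0, open D & connected D].

(* Functions are total, but the values outside the open set D are
   irrelevant. *)
Definition conformal_map (D D' : set (CC R)) (f : CC R -> CC R) :=
  (forall z, D z -> derivable f z 1) /\ set_bij D D' f.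

(* The element 0 only matters for A = set0, whose diameter is then 0
   instead of ereal_sup set0 = -oo. *)
Definition diam (A : set (CC R)) : \bar R :=
  ereal_sup (0%E |` [set (normc (x - y))%:E | x in A & y in A]).

Definition hausdorff_content (alpha : R) (A : set (CC R)) : \bar R :=
  ereal_inf [set (\sum_(j <oo) (diam (E j) `^ alpha))%E |
             E in [set E : nat -> set (CC R) | A `<=` \bigcup_j E j]].

(* edist_inf E x is +oo when E is empty. *)
Definition sawtooth (x0 y0 : R) (E : set R) : set (CC R) :=
  [set w | [/\ x0 - y0 / 2 < complex.Re w < x0 + y0 / 2,
               (edist_inf E (complex.Re w) <= (complex.Im w)%:E)%E &
               complex.Im w < y0]].

End Defs.

(* Main.v *)
(* Log|f'| is a Bloch function with a universal bound: |f''| y <= K |f'|. The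
   primitive of log f' therefore extends to the real line, and the slopes of the
   real part [Gam] of its boundary values over dyadic intervals I form an exact
   martingale X with bounded increments, at bounded distance from log|f'| at the
   point above I at height |I|. For small lam, cos(lam * X), killed when
   |lam * X| reaches pi / 2, is positive and loses a factor as close to 1 as
   wanted at each step, so the dyadic measure with this density has mass at most
   2 ^ (- alpha n) on the intervals of generation n, which bounds the content of
   its support E from below. On E the martingale stays bounded, and every point
   of S(E) is at bounded hyperbolic distance from the point above a dyadic
   interval that carries mass. *)
Require Import Defs.
From mathcomp Require Import all_boot all_order all_algebra complex.
From mathcomp Require Import all_classical all_reals all_analysis.
From mathcomp Require Import zify ring lra.
Import Order.TTheory GRing.Theory Num.Theory.
Import numFieldNormedType.Exports.
Import Normc.
Local Open Scope classical_set_scope.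
Local Open Scope ring_scope.
Set Implicit Arguments.
Unset Strict Implicit.
Unset Printing Implicit Defensive.

(** The bound on f'' is a classical consequence of Koebe distortion; here it is drawn from the
    period of the exponential. A logarithm of a zero-free univalent map never takes two values 2 pi
    i apart, and an argument in the manner of Bloch's theorem turns this omission into a bound on
    its derivative. The map f - f(c) is zero-free only away from c, so the bound is obtained around
    c and carried to c by Cauchy's estimates. Integrals run along axis-parallel segments, so squares
    play the part of discs. Slopes replace the values of log|f'| above the intervals because these
    values form a martingale only up to bounded errors, which would add up over the generations,
    while the slope over an interval is the mean of the slopes over its halves. The cosine is chosen
    for cos(x + d) + cos(x - d) = 2 cos x cos d: the same factor cos d serves every x, and [lam] is
    fixed by 2 cos(lam D) >= 2 ^ alpha, which is possible because alpha < 1. *)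

Section Modulus.
Variable R : realType.
Implicit Types z w : R[i].

Lemma normc_ge0 z : 0 <= normc z.
Proof. by case: z => a b; exact: sqrtr_ge0. Qed.

Lemma normc_eq0 z : (normc z == 0) = (z == 0).
Proof.
by apply/eqP/eqP => [/eq0_normc//|->]; exact: normc0.
Qed.

Lemma normc_gt0 z : (0 < normc z) = (z != 0).
Proof. by rewrite lt_def normc_eq0 normc_ge0 andbT. Qed.

Lemma normcB z w : normc (z - w) = normc (w - z).
Proof. by rewrite -normcN opprB. Qed.

Lemma ler_normcB z w : normc (z - w) <= normc z + normc w.
Proof. by rewrite -(normcN w); exact: le_normcD. Qed.

Lemma lerB_normc z w : normc z - normc w <= normc (z + w).
Proof.
rewrite lerBlDr -(normcN w) (le_trans _ (le_normcD _ _))//.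
by rewrite addrK.
Qed.

Lemma normc_sqr z : normc z ^+ 2 = complex.Re z ^+ 2 + complex.Im z ^+ 2.
Proof. by case: z => a b /=; rewrite sqr_sqrtr// addr_ge0// sqr_ge0. Qed.

Lemma Re_le_normc z : `|complex.Re z| <= normc z.
Proof.
rewrite -(ler_pXn2r (n := 2)) ?nnegrE ?normc_ge0// normc_sqr.
by rewrite real_normK ?num_real// lerDl sqr_ge0.
Qed.

Lemma Im_le_normc z : `|complex.Im z| <= normc z.
Proof.
rewrite -(ler_pXn2r (n := 2)) ?nnegrE ?normc_ge0// normc_sqr.
by rewrite real_normK ?num_real// lerDr sqr_ge0.
Qed.

Lemma normc_real (x : R) : normc (x%:C)%C = `|x|.
Proof. by rewrite /= expr0n/= addr0 sqrtr_sqr. Qed.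

Lemma normc_i : normc ('i : R[i])%C = 1.
Proof. by rewrite /= expr0n/= add0r expr1n sqrtr1. Qed.

Lemma normc_le_ReIm z : normc z <= `|complex.Re z| + `|complex.Im z|.
Proof.
rewrite {1}(complexE z) (le_trans (le_normcD _ _))//.
by rewrite normcM normc_i mul1r !normc_real.
Qed.

Lemma normc_le2 z M : `|complex.Re z| <= M -> `|complex.Im z| <= M -> normc z <= 2 * M.
Proof. by move=> h1 h2; have := normc_le_ReIm z; lra. Qed.

End Modulus.

(** * Complex derivatives *)

Section Derivative.
Variable R : realType.
Implicit Types (f g : R[i] -> R[i]) (z w l : R[i]).

Definition ccont f z := forall e : R, 0 < e ->
  exists2 d : R, 0 < d & forall w, normc (w - z) < d -> normc (f w - f z) <= e.

(** The little-o form has no quotient, hence no case w = z to exclude, and its remainder can be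
    bounded and integrated directly. *)
Definition cder f z l := forall e : R, 0 < e ->
  exists2 d : R, 0 < d & forall w, normc (w - z) < d ->
    normc (f w - f z - (w - z) * l) <= e * normc (w - z).

Lemma cder_eq f z l l' : cder f z l -> l = l' -> cder f z l'.
Proof. by move=> + <-. Qed.

Lemma cder_lip f z l : cder f z l -> exists2 d : R, 0 < d &
  forall w, normc (w - z) < d -> normc (f w - f z) <= (normc l + 1) * normc (w - z).
Proof.
move=> /(_ 1 ltr01)[d d0 H]; exists d => // w /H; rewrite mul1r => h.
rewrite -(subrK ((w - z) * l) (f w - f z)) (le_trans (le_normcD _ _))//.
by rewrite normcM; lra.
Qed.

Lemma cder_cont f z l : cder f z l -> ccont f z.
Proof.
move=> /cder_lip[d d0 H] e e0.
have l0 : 0 < normc l + 1 by rewrite ltr_wpDl// normc_ge0.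
exists (Num.min d (e / (normc l + 1))); first by rewrite lt_min d0 divr_gt0.
move=> w; rewrite lt_min => /andP[/H h1 h2].
rewrite (le_trans h1)// mulrC -ler_pdivlMr//; exact: ltW.
Qed.

Lemma cder_cst c z : cder (fun=> c) z 0.
Proof.
move=> e e0; exists 1 => // w _.
by rewrite mulr0 subr0 subrr normc0 mulr_ge0 ?normc_ge0// ltW.
Qed.

Lemma cder_id z : cder id z 1.
Proof.
move=> e e0; exists 1 => // w _.
by rewrite mulr1 subrr normc0 mulr_ge0 ?normc_ge0// ltW.
Qed.

Lemma cderD f g z l m : cder f z l -> cder g z m -> cder (fun w => f w + g w) z (l + m).
Proof.
move=> Hf Hg e e0; have e20 : 0 < e / 2 by lra.
have [d1 d10 H1] := Hf _ e20; have [d2 d20 H2] := Hg _ e20.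
exists (Num.min d1 d2); first by rewrite lt_min d10.
move=> w; rewrite lt_min => /andP[/H1 h1 /H2 h2].
have -> : f w + g w - (f z + g z) - (w - z) * (l + m) =
  (f w - f z - (w - z) * l) + (g w - g z - (w - z) * m) by ring.
rewrite (le_trans (le_normcD _ _))//; lra.
Qed.

(** Dividing by [a + 1] instead of [a] covers the case a = 0. *)
Lemma ler_mul_small (a b e n : R) : 0 <= a -> 0 <= e -> 0 <= n ->
  b <= e / (a + 1) * n -> a * b <= e * n.
Proof.
move=> a0 e0 n0 h; rewrite (le_trans (ler_wpM2l a0 h))//.
rewrite mulrA ler_wpM2r// mulrCA ler_piMr// ler_pdivrMr; lra.
Qed.

Lemma cder_comp f g z l m : cder f z l -> cder g (f z) m ->
  cder (fun w => g (f w)) z (l * m).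
Proof.
move=> Hf Hg e e0.
have l0 : 0 < normc l + 1 by rewrite ltr_wpDl// normc_ge0.
have m0 : 0 < normc m + 1 by rewrite ltr_wpDl// normc_ge0.
have e1 : 0 < e / 2 / (normc l + 1) by rewrite !divr_gt0.
have e2 : 0 < e / 2 / (normc m + 1) by rewrite !divr_gt0.
have [d1 d10 H1] := Hf _ e2; have [d2 d20 H2] := Hg _ e1.
have [d3 d30 H3] := cder_lip Hf.
have [d4 d40 H4] := cder_cont Hf (divr_gt0 d20 (ltr0n R 2)).
exists (Num.min (Num.min d1 d3) d4); first by rewrite !lt_min d10 d30.
move=> w; rewrite !lt_min => /andP[/andP[/H1 h1 /H3 h3] /H4 h4].
have {}h4 : normc (f w - f z) < d2 by rewrite (le_lt_trans h4)//; lra.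
have {}h2 := H2 _ h4.
have -> : g (f w) - g (f z) - (w - z) * (l * m) =
  (g (f w) - g (f z) - (f w - f z) * m) + m * (f w - f z - (w - z) * l) by ring.
rewrite (le_trans (le_normcD _ _))// normcM.
have h5 : e / 2 / (normc l + 1) * normc (f w - f z) <= e / 2 * normc (w - z).
  rewrite -mulrA ler_wpM2l//; first by lra.
  by rewrite mulrC ler_pdivrMr// mulrC.
have h6 : normc m * normc (f w - f z - (w - z) * l) <= e / 2 * normc (w - z).
  by rewrite ler_mul_small ?normc_ge0//; lra.
lra.
Qed.

Lemma cderM f g z l m : cder f z l -> cder g z m ->
  cder (fun w => f w * g w) z (l * g z + f z * m).
Proof.
move=> Hf Hg e e0.
have f0 : 0 < normc (f z) + 1 by rewrite ltr_wpDl// normc_ge0.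
have g0 : 0 < normc (g z) + 1 by rewrite ltr_wpDl// normc_ge0.
have l0 : 0 < normc l + 1 by rewrite ltr_wpDl// normc_ge0.
have e1 : 0 < e / 3 / (normc (g z) + 1) by rewrite !divr_gt0.
have e2 : 0 < e / 3 / (normc (f z) + 1) by rewrite !divr_gt0.
have e3 : 0 < e / 3 / (normc l + 1) by rewrite !divr_gt0.
have [d1 d10 H1] := Hf _ e1; have [d2 d20 H2] := Hg _ e2.
have [d3 d30 H3] := cder_lip Hf.
have [d4 d40 H4] := cder_cont Hg e3.
exists (Num.min (Num.min d1 d2) (Num.min d3 d4)); first by rewrite !lt_min d10 d20 d30.
move=> w; rewrite !lt_min => /andP[/andP[/H1 h1 /H2 h2] /andP[/H3 h3 /H4 h4]].
have -> : f w * g w - f z * g z - (w - z) * (l * g z + f z * m) =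
  g z * (f w - f z - (w - z) * l) + (f z * (g w - g z - (w - z) * m)
   + (f w - f z) * (g w - g z)) by ring.
rewrite (le_trans (le_normcD _ _))// (le_trans (lerD (lexx _) (le_normcD _ _)))//.
rewrite !normcM.
have h5 : normc (g z) * normc (f w - f z - (w - z) * l) <= e / 3 * normc (w - z).
  by rewrite ler_mul_small ?normc_ge0//; lra.
have h6 : normc (f z) * normc (g w - g z - (w - z) * m) <= e / 3 * normc (w - z).
  by rewrite ler_mul_small ?normc_ge0//; lra.
have h7 : normc (f w - f z) * normc (g w - g z) <= e / 3 * normc (w - z).
  rewrite (le_trans (ler_wpM2r (normc_ge0 _) h3))// mulrAC ler_wpM2r ?normc_ge0//.
  by rewrite mulrC -ler_pdivlMr.
lra.
Qed.

Lemma cderV_id z : z != 0 -> cder (fun w => w^-1) z (- (z ^- 2)).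
Proof.
move=> z0 e e0.
have nz : 0 < normc z by rewrite normc_gt0.
have k0 : 0 < e * normc z ^+ 3 / 2 by rewrite divr_gt0// mulr_gt0// exprn_gt0.
exists (Num.min (normc z / 2) (e * normc z ^+ 3 / 2)).
  by rewrite lt_min k0 divr_gt0.
move=> w; rewrite !lt_min => /andP[h1 h2].
have h3 : normc z / 2 <= normc w.
  by have := lerB_normc z (w - z); rewrite (_ : z + (w - z) = w); [lra|ring].
have w0 : w != 0 by rewrite -normc_gt0; lra.
have -> : w^-1 - z^-1 - (w - z) * - z ^- 2 = (w - z) ^+ 2 * (w^-1 * z ^- 2).
  by field; rewrite z0 w0.
rewrite expr2 -mulrA normcM mulrC ler_wpM2r ?normc_ge0// !(normcM, normcV).
rewrite -invfM ler_pdivrMr; last by rewrite !mulr_gt0// normc_gt0.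
rewrite (le_trans (ltW h2))//.
have -> : e * normc z ^+ 3 / 2 = e * (normc z / 2 * (normc z * normc z)) by field.
by rewrite ler_pM2l// ler_pM2r// mulr_gt0.
Qed.

Lemma cderN f z l : cder f z l -> cder (fun w => - f w) z (- l).
Proof.
move=> /(cderM (cder_cst (-1) z)); rewrite mul0r add0r mulN1r => Hf.
rewrite (_ : (fun w => - f w) = fun w => (-1) * f w); first exact: Hf.
by apply/funext => w; rewrite mulN1r.
Qed.

Lemma cderB f g z l m : cder f z l -> cder g z m -> cder (fun w => f w - g w) z (l - m).
Proof. by move=> Hf /cderN Hg; exact: cderD. Qed.

Lemma cderZ c f z l : cder f z l -> cder (fun w => c * f w) z (c * l).
Proof.
by move=> Hf; apply: cder_eq (cderM (cder_cst c z) Hf) _; rewrite mul0r add0r.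
Qed.

Lemma cderV f z l : cder f z l -> f z != 0 -> cder (fun w => (f w)^-1) z (- l / f z ^+ 2).
Proof.
move=> Hf f0; apply: cder_eq (cder_comp Hf (cderV_id f0)) _.
by rewrite mulrN mulNr.
Qed.

Lemma cder_div f g z l m : cder f z l -> cder g z m -> g z != 0 ->
  cder (fun w => f w / g w) z ((l * g z - f z * m) / g z ^+ 2).
Proof.
move=> Hf Hg g0; apply: cder_eq (cderM Hf (cderV Hg g0)) _.
by field.
Qed.

Lemma cder_ext f g z l (r : R) : 0 < r -> (forall w, normc (w - z) < r -> f w = g w) ->
  cder f z l -> cder g z l.
Proof.
move=> r0 fg Hf e e0; have [d d0 H] := Hf _ e0.
exists (Num.min d r); first by rewrite lt_min d0.
move=> w; rewrite lt_min => /andP[/H + wr]; rewrite !fg// subrr normc0//.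
Qed.

Lemma cder_unique f z l m : cder f z l -> cder f z m -> l = m.
Proof.
move=> Hl Hm; apply/eqP; rewrite -subr_eq0 -normc_eq0 eq_le normc_ge0 andbT.
apply/ler_addgt0Pl => e e0; rewrite addr0.
have e20 : 0 < e / 2 by lra.
have [d1 d10 H1] := Hl _ e20; have [d2 d20 H2] := Hm _ e20.
set r := Num.min d1 d2 / 2.
have d0 : 0 < Num.min d1 d2 by rewrite lt_min d10.
have r0 : 0 < r by rewrite /r; lra.
have nr : normc (z + r%:C%C - z) = r by rewrite addrC addrA addNr add0r normc_real gtr0_norm.
have /andP[r1 r2] : (r < d1) && (r < d2) by rewrite -lt_min /r; lra.
have := H1 (z + r%:C%C); rewrite nr => /(_ r1) h1.
have := H2 (z + r%:C%C); rewrite nr => /(_ r2) h2.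
have h3 : r * normc (l - m) <= r * e.
  rewrite -{1}nr -normcM.
  set w := z + r%:C%C in h1 h2 *.
  have -> : (w - z) * (l - m) = (f w - f z - (w - z) * m) - (f w - f z - (w - z) * l).
    by ring.
  rewrite (le_trans (ler_normcB _ _))//; lra.
by rewrite ler_pM2l in h3.
Qed.

End Derivative.

(** * Integration along segments *)

Section RealIntegral.
Variable R : realType.
Implicit Types (h P : R -> R) (a b x e k m M : R).

Definition rcont h x := forall e : R, 0 < e ->
  exists2 d : R, 0 < d & forall y, `|y - x| < d -> `|h y - h x| <= e.

Lemma rcont_continuous h x : rcont h x -> {for x, continuous h}.
Proof.
move=> H; apply/cvgrPdist_le => e e0; have [d d0 {}H] := H _ e0.
near=> y; rewrite distrC; apply: H; rewrite distrC.
by near: y; apply: cvgr_dist_lt.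
Unshelve. all: by end_near. Qed.

Lemma rder_is_derive h x l :
  (forall e : R, 0 < e -> exists2 d : R, 0 < d & forall y, `|y - x| < d ->
     `|h y - h x - (y - x) * l| <= e * `|y - x|) ->
  is_derive x 1 h l.
Proof.
move=> H.
suff Hl : (fun t => t^-1 *: (h (t *: 1 + x) - h x)) @ 0^' --> l.
  by apply: DeriveDef; [apply: cvgP Hl|apply: cvg_lim Hl].
apply/cvgrPdist_le => e e0; have [d d0 {}H] := H _ e0.
near=> t.
have t0 : t != 0 by near: t; exact: nbhs_dnbhs_neq.
have td : `|t| < d.
  by near: t; apply: dnbhs0_lt.
have := H (t *: 1 + x); rewrite scaler1 addrK => /(_ td) h1.
have -> : l - t^-1 *: (h (t + x) - h x) = - t^-1 * (h (t + x) - h x - t * l).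
  by rewrite /GRing.scale/=; field.
rewrite normrM normrN normfV ler_pdivrMl ?normr_gt0// [leRHS]mulrC; exact: h1.
Unshelve. all: by end_near. Qed.

Lemma derive_is_cont h x l : is_derive x 1 h l -> {for x, continuous h}.
Proof.
by move=> H; apply/differentiable_continuous/derivable1_diffP.
Qed.

Lemma mvt_le h dh a b M : a <= b -> (forall x, a <= x <= b -> is_derive x 1 h (dh x)) ->
  (forall x, a <= x <= b -> dh x <= M) -> h b - h a <= M * (b - a).
Proof.
move=> ab H HM.
have [x xab||c /[!in_itv]/= cab ->] := @MVT_segment _ h dh a b ab.
- by move: xab; rewrite in_itv/= => /andP[x1 x2]; apply: H; rewrite !ltW.
- apply: continuous_in_subspaceT => x; rewrite inE/= in_itv/= => xab.
  exact: derive_is_cont (H _ xab).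
- by rewrite ler_wpM2r ?subr_ge0//; exact: HM.
Qed.

Lemma mvt_abs h dh a b M : a <= b -> (forall x, a <= x <= b -> is_derive x 1 h (dh x)) ->
  (forall x, a <= x <= b -> `|dh x| <= M) -> `|h b - h a| <= M * (b - a).
Proof.
move=> ab H HM; rewrite ler_norml; apply/andP; split.
  have := @mvt_le (\- h) (\- dh) a b M ab.
  have H' x : a <= x <= b -> is_derive x 1 (\- h) ((\- dh) x).
    by move=> /H Hx; exact: is_deriveN.
  move=> /(_ H'); suff : forall x, a <= x <= b -> - dh x <= M by move=> h1 /(_ h1) /=; lra.
  by move=> x /HM; rewrite ler_norml; lra.
by apply: mvt_le ab H _ => x /HM; rewrite ler_norml; lra.
Qed.

(** Composing [h] with the clamp onto [a, b], which is 1-Lipschitz, extends it continuously to the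
    whole line, so that the derivative of its integral is two-sided even at a and b. *)
Lemma prim_ex h a b : a <= b -> (forall x, a <= x <= b -> rcont h x) ->
  exists P, forall x, a <= x <= b -> is_derive x 1 P (h x).
Proof.
move=> ab hc.
pose c x := if x <= a then a else if b <= x then b else x.
have cab x : a <= c x <= b.
  by rewrite /c; case: (leP x a) => ?; last case: (leP b x) => ?; rewrite ?lexx//; lra.
have clip x y : `|c x - c y| <= `|x - y|.
  have := ler_norm (x - y); have := ler_norm (y - x); rewrite (distrC y) => h1 h2.
  rewrite ler_norml /c; case: (leP x a) => ?; case: (leP y a) => ?;
    try case: (leP b x) => ?; try case: (leP b y) => ?; lra.
have cid x : a <= x <= b -> c x = x.
  by rewrite /c; case: (leP x a) => ?; last case: (leP b x) => ?; lra.
pose ht x := h (c x).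
have htc : continuous ht.
  move=> x; apply: rcont_continuous => e e0; have [d d0 H] := hc _ (cab x) _ e0.
  exists d => // y yx; apply: H; exact: le_lt_trans (clip _ _) yx.
(* Starting at a - 1 keeps x = a in the interior of the interval of integration. *)
pose P x := (\int[lebesgue_measure]_(t in `[a - 1, x]) ht t)%R.
exists P => x xab.
have [] := @continuous_FTC1_closed _ ht (a - 1) x (b + 1).
- lra.
- apply: continuous_compact_integrable; first exact: segment_compact.
  exact: continuous_subspaceT.
- lra.
- exact: htc.
move=> dP eP; rewrite -[h x]/(h x) -(cid x xab) -[h (c x)]/(ht x) -eP derive1E cid//.
Qed.

(** The ends come in either order, so that paths and rectangles between two arbitrary points need no
    case distinction. *)
Definition btw a b x := (a <= x <= b) || (b <= x <= a).

Lemma btwC a b x : btw a b x = btw b a x.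
Proof. by rewrite /btw orbC. Qed.

Lemma btw_le a b x : a <= b -> btw a b x = (a <= x <= b).
Proof.
move=> ab; rewrite /btw; case: (boolP (a <= x <= b)) => //= h.
by apply/negP => h2; move/negP: h; apply; apply/andP; lra.
Qed.

Definition primitive h a b P := forall x, btw a b x -> is_derive x 1 P (h x).

(* [get] picks some primitive; junk when there is none. *)
Definition rint h a b : R := let P := get [set P | primitive h a b P] in P b - P a.

Lemma primitive_unique h a b P Q : primitive h a b P -> primitive h a b Q ->
  P b - P a = Q b - Q a.
Proof.
wlog ab : a b / a <= b => [H|].
  case: (leP a b) => [|/ltW] ab HP HQ; first exact: H.
  apply: oppr_inj; rewrite !opprB; apply: H => // x; rewrite btwC => ?; [exact: HP|exact: HQ].
move=> HP HQ; apply/eqP; rewrite -subr_eq0 -normr_le0.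
have := @mvt_abs (P \- Q) (fun x => h x - h x) a b 0 ab.
rewrite mul0r /= => H.
have -> : P b - P a - (Q b - Q a) = P b - Q b - (P a - Q a) by ring.
apply: H => x xab; last by rewrite subrr normr0.
by apply: is_deriveB; [apply: HP|apply: HQ]; rewrite btw_le.
Qed.

Lemma rint_prim h a b P : primitive h a b P -> rint h a b = P b - P a.
Proof.
move=> HP; rewrite /rint; apply: (@primitive_unique h) (HP).
exact: (getI (HP : [set P | primitive h a b P] P)).
Qed.

Lemma primitive_ex h a b : (forall x, btw a b x -> rcont h x) -> exists P, primitive h a b P.
Proof.
wlog ab : a b / a <= b => [H|H].
  case: (leP a b) => [|/ltW] ab hc; first exact: H.
  have [|P HP] := H b a ab; first by move=> x xab; apply: hc; rewrite btwC.
  by exists P => x; rewrite btwC; exact: HP.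
have [|P HP] := @prim_ex h a b ab; first by move=> x xab; apply: H; rewrite btw_le.
by exists P => x; rewrite btw_le//; exact: HP.
Qed.

Lemma rintC h a b : rint h b a = - rint h a b.
Proof.
rewrite /rint (_ : primitive h b a = primitive h a b) ?opprB//.
by apply/funext => P; apply/propext; split => H x xab; apply: H; rewrite btwC.
Qed.

Lemma rint_chasles lo hi h a b c : lo <= a <= hi -> lo <= b <= hi -> lo <= c <= hi ->
  (forall x, lo <= x <= hi -> rcont h x) -> rint h a b + rint h b c = rint h a c.
Proof.
move=> la lb lc hc; have [|P HP] := @prim_ex h lo hi _ hc; first lra.
by rewrite !(@rint_prim _ _ _ P) ?addrA ?subrK; [ring| | |] => x xab; apply: HP;
  move: xab; rewrite /btw; lra.
Qed.

(** Chasles' relation is proved on one interval containing the three points; as every point of their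
    hull lies between two of them, continuity on the three segments is enough. *)
Lemma btw_hull a b c : exists lo hi, [/\ lo <= a <= hi, lo <= b <= hi, lo <= c <= hi &
  forall x, lo <= x <= hi -> [|| btw a b x, btw b c x | btw a c x]].
Proof.
rewrite /btw.
case: (leP a b) => ab; case: (leP b c) => bc; case: (leP a c) => ac;
  [exists a, c|exists a, c|exists a, b|exists c, b|exists b, c|exists b, a|exists c, a|exists c, a];
  by split=> [|||x xab]; lra.
Qed.

Lemma rintD h1 h2 a b : (forall x, btw a b x -> rcont h1 x) ->
  (forall x, btw a b x -> rcont h2 x) ->
  rint (fun x => h1 x + h2 x) a b = rint h1 a b + rint h2 a b.
Proof.
move=> /primitive_ex[P HP] /primitive_ex[Q HQ].
rewrite (rint_prim HP) (rint_prim HQ) (@rint_prim _ _ _ (P \+ Q)) /=; first by ring.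
by move=> x xab; apply: is_deriveD; [exact: HP|exact: HQ].
Qed.

Lemma rintZ k h a b : (forall x, btw a b x -> rcont h x) ->
  rint (fun x => k * h x) a b = k * rint h a b.
Proof.
move=> /primitive_ex[P HP].
rewrite (rint_prim HP) (@rint_prim _ _ _ (k \*: P)) /=; first by rewrite /GRing.scale/=; ring.
by move=> x xab; apply: is_deriveZ; exact: HP.
Qed.

Lemma eq_rint h1 h2 a b : (forall x, btw a b x -> h1 x = h2 x) -> rint h1 a b = rint h2 a b.
Proof.
move=> H; rewrite /rint (_ : primitive h1 a b = primitive h2 a b)//.
by apply/funext => P; apply/propext; split => HP x xab; have := HP x xab; rewrite H.
Qed.

Lemma rint_le M h a b : (forall x, btw a b x -> rcont h x) ->
  (forall x, btw a b x -> `|h x| <= M) -> `|rint h a b| <= M * `|b - a|.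
Proof.
wlog ab : a b / a <= b => [H|].
  case: (leP a b) => [|/ltW] ab hc HM; first exact: H.
  by rewrite rintC normrN (distrC b a); apply: H => // x; rewrite btwC => ?; [exact: hc|exact: HM].
move=> /primitive_ex[P HP] HM; rewrite (rint_prim HP) [`|b - a|]ger0_norm ?subr_ge0//.
by apply: (mvt_abs ab (dh := h)) => x xab; [apply: HP|apply: HM]; rewrite btw_le.
Qed.

Lemma rint_leM M h a b : a <= b -> (forall x, a <= x <= b -> rcont h x) ->
  (forall x, a <= x <= b -> h x <= M) -> rint h a b <= M * (b - a).
Proof.
move=> ab hc HM; have [|P HP] := @primitive_ex h a b; first by move=> x; rewrite btw_le//; exact: hc.
by rewrite (rint_prim HP); apply: (@mvt_le P h) => // x xab; apply: HP; rewrite btw_le.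
Qed.

Lemma rint_ge m h a b : a <= b -> (forall x, a <= x <= b -> rcont h x) ->
  (forall x, a <= x <= b -> m <= h x) -> m * (b - a) <= rint h a b.
Proof.
move=> ab hc HM; have [|P HP] := @primitive_ex h a b; first by move=> x; rewrite btw_le//; exact: hc.
rewrite (rint_prim HP).
have H x : a <= x <= b -> is_derive x 1 (\- P) (- h x).
  by move=> xab; apply: is_deriveN; apply: HP; rewrite btw_le.
have := @mvt_le (\- P) (fun x => - h x) a b (- m) ab H.
suff: forall x, a <= x <= b -> - h x <= - m by move=> h1 /(_ h1)/=; lra.
by move=> x xab; rewrite lerN2 HM.
Qed.

Lemma rcontZ k h x : rcont h x -> rcont (fun y => k * h y) x.
Proof.
move=> H e e0; have k0 : 0 < `|k| + 1 by have := normr_ge0 k; lra.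
have [d d0 {}H] := H _ (divr_gt0 e0 k0); exists d => // y /H h1.
rewrite -mulrBr normrM -[leRHS]mulr1; apply: ler_mul_small; rewrite ?mulr1//; exact: ltW.
Qed.

End RealIntegral.

Section ComplexIntegral.
Variable R : realType.
Implicit Types (h : R -> R[i]) (f F : R[i] -> R[i]) (a b x : R) (p d k : R[i]).

Definition pcont h x := forall e : R, 0 < e ->
  exists2 d : R, 0 < d & forall y, `|y - x| < d -> normc (h y - h x) <= e.

Lemma pcont_Re h x : pcont h x -> rcont (@complex.Re R \o h) x.
Proof.
move=> H e /H[d d0 {}H]; exists d => // y /H; apply: le_trans.
by rewrite /= -[X in `|X|](raddfB (@complex.Re R : Rcomplex R -> R)); exact: Re_le_normc.
Qed.

Lemma pcont_Im h x : pcont h x -> rcont (@complex.Im R \o h) x.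
Proof.
move=> H e /H[d d0 {}H]; exists d => // y /H; apply: le_trans.
by rewrite /= -[X in `|X|](raddfB (@complex.Im R : Rcomplex R -> R)); exact: Im_le_normc.
Qed.

Lemma ccont_pcont f p d t : ccont f (p + t%:C%C * d) -> pcont (fun s => f (p + s%:C%C * d)) t.
Proof.
move=> H e /H[r r0 {}H].
have d0 : 0 < normc d + 1 by have := normc_ge0 d; lra.
exists (r / (normc d + 1)); first by rewrite divr_gt0.
move=> s st; apply: H.
have -> : p + s%:C%C * d - (p + t%:C%C * d) = (s - t)%:C%C * d by rewrite rmorphB; ring.
rewrite normcM normc_real; rewrite ltr_pdivlMr// in st.
rewrite (le_lt_trans _ st)// ler_wpM2l//; lra.
Qed.

Definition cint h a b : R[i] := (rint (@complex.Re R \o h) a b +i* rint (@complex.Im R \o h) a b)%C.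

Lemma cintC h a b : cint h b a = - cint h a b.
Proof. by rewrite /cint rintC (rintC (@complex.Im R \o h)). Qed.

Lemma cint_chasles lo hi h a b c : lo <= a <= hi -> lo <= b <= hi -> lo <= c <= hi ->
  (forall x, lo <= x <= hi -> pcont h x) -> cint h a b + cint h b c = cint h a c.
Proof.
move=> la lb lc hc; rewrite /cint.
rewrite -(rint_chasles la lb lc); last by move=> x /hc; exact: pcont_Re.
by rewrite -(rint_chasles la lb lc (h := @complex.Im R \o h)); last by move=> x /hc; exact: pcont_Im.
Qed.

Lemma cint_chasles_btw h a b c :
  (forall x, [|| btw a b x, btw b c x | btw a c x] -> pcont h x) ->
  cint h a b + cint h b c = cint h a c.
Proof.
move=> hc; have [lo [hi [h1 h2 h3 h4]]] := btw_hull a b c.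
by apply: (cint_chasles h1 h2 h3) => x /h4/hc.
Qed.

Lemma cint_refl h a : cint h a a = 0.
Proof. by rewrite /cint /rint !subrr. Qed.

Lemma cint_cst k a b : cint (fun=> k) a b = (b - a)%:C%C * k.
Proof.
have H c : rint (fun=> c) a b = (b - a) * c.
  rewrite (@rint_prim _ _ _ _ (fun x => x * c)); first by rewrite mulrBl.
  move=> x _; have -> : (fun y : R => y * c) = c \*: id.
    by apply/funext => y; rewrite /GRing.scale/= mulrC.
  by apply: is_derive_eq; rewrite /GRing.scale /= mulr1.
by rewrite /cint !H; case: k => u v; congr Complex; rewrite /=; ring.
Qed.

Lemma cintD h1 h2 a b : (forall x, btw a b x -> pcont h1 x) ->
  (forall x, btw a b x -> pcont h2 x) ->
  cint (fun x => h1 x + h2 x) a b = cint h1 a b + cint h2 a b.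
Proof.
move=> H1 H2; rewrite /cint; apply/eqP; rewrite eq_complex /=; apply/andP; split; apply/eqP.
  rewrite -rintD; [|by move=> x /H1/pcont_Re|by move=> x /H2/pcont_Re].
  by apply: eq_rint => x _ /=; case: (h1 x) (h2 x) => ? ? [].
rewrite -rintD; [|by move=> x /H1/pcont_Im|by move=> x /H2/pcont_Im].
by apply: eq_rint => x _ /=; case: (h1 x) (h2 x) => ? ? [].
Qed.

Lemma cintZ (k : R[i]) h a b : (forall x, btw a b x -> pcont h x) ->
  cint (fun x => k * h x) a b = k * cint h a b.
Proof.
move=> H; rewrite /cint; apply/eqP; rewrite eq_complex; case: k => k1 k2 /=.
apply/andP; split; apply/eqP.
  rewrite -mulNr -!rintZ; [|by move=> x /H/pcont_Im|by move=> x /H/pcont_Re].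
  rewrite -rintD; [|by move=> x /H/pcont_Re; exact: rcontZ|by move=> x /H/pcont_Im; exact: rcontZ].
  by apply: eq_rint => x _ /=; case: (h x) => ? ? /=; rewrite mulNr.
rewrite -!rintZ; [|by move=> x /H/pcont_Re|by move=> x /H/pcont_Im].
rewrite -rintD; [|by move=> x /H/pcont_Im; exact: rcontZ|by move=> x /H/pcont_Re; exact: rcontZ].
by apply: eq_rint => x _ /=; case: (h x) => ? ? /=.
Qed.

Lemma eq_cint h1 h2 a b : (forall x, btw a b x -> h1 x = h2 x) -> cint h1 a b = cint h2 a b.
Proof.
by move=> H; rewrite /cint; congr (_ +i* _)%C; apply: eq_rint => x xab; rewrite /= H.
Qed.

Lemma cint_le M h a b : (forall x, btw a b x -> pcont h x) ->
  (forall x, btw a b x -> normc (h x) <= M) -> normc (cint h a b) <= 2 * (M * `|b - a|).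
Proof.
move=> H HM; apply: normc_le2; apply: rint_le => x xab.
- exact: pcont_Re (H _ xab).
- exact: le_trans (Re_le_normc _) (HM _ xab).
- exact: pcont_Im (H _ xab).
- exact: le_trans (Im_le_normc _) (HM _ xab).
Qed.

Lemma cder_path_Re F p d t l : cder F (p + t%:C%C * d) l ->
  is_derive t 1 (fun s => complex.Re (F (p + s%:C%C * d))) (complex.Re (d * l)).
Proof.
move=> H; apply: rder_is_derive => e e0.
have d0 : 0 < normc d + 1 by have := normc_ge0 d; lra.
have [r r0 {}H] := H _ (divr_gt0 e0 d0).
exists (r / (normc d + 1)); first by rewrite divr_gt0.
move=> s st.
have E : p + s%:C%C * d - (p + t%:C%C * d) = (s - t)%:C%C * d by rewrite rmorphB; ring.
have := H (p + s%:C%C * d); rewrite E normcM normc_real.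
rewrite ltr_pdivlMr// in st.
have h1 : `|s - t| * normc d < r by rewrite (le_lt_trans _ st)// ler_wpM2l//; lra.
move=> /(_ h1) h2.
apply: (@le_trans _ _ (e / (normc d + 1) * (`|s - t| * normc d))).
  apply: le_trans h2; apply: le_trans (Re_le_normc _).
  rewrite !raddfB /= -mulrA; case: (d * l) => u v /=.
  by rewrite subrr mul0r subr0.
rewrite (_ : _ * _ = e * `|s - t| * (normc d / (normc d + 1))); last by ring.
by rewrite ler_piMr// ?mulr_ge0// ?(ltW e0)// ler_pdivrMr// mul1r lerDl.
Qed.

Lemma cder_path_Im F p d t l : cder F (p + t%:C%C * d) l ->
  is_derive t 1 (fun s => complex.Im (F (p + s%:C%C * d))) (complex.Im (d * l)).
Proof.
(* Im u = Re(- i u) reduces the claim to the real part. *)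
move=> /(cderZ (- 'i%C)) /cder_path_Re.
rewrite (_ : complex.Re _ = complex.Im (d * l)); last by case: d l => [? ?] [? ?] /=; ring.
rewrite (_ : (fun s => _) = (fun s => complex.Im (F (p + s%:C%C * d))))//.
by apply/funext => s; case: (F _) => u v /=; ring.
Qed.

Lemma cint_path F f p d a b :
  (forall t, btw a b t -> cder F (p + t%:C%C * d) (f (p + t%:C%C * d))) ->
  cint (fun t => d * f (p + t%:C%C * d)) a b = F (p + b%:C%C * d) - F (p + a%:C%C * d).
Proof.
move=> H; rewrite /cint.
rewrite (@rint_prim _ _ _ _ (fun s => complex.Re (F (p + s%:C%C * d)))); last first.
  by move=> t /H; exact: cder_path_Re.
rewrite (@rint_prim _ _ _ _ (fun s => complex.Im (F (p + s%:C%C * d)))); last first.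
  by move=> t /H; exact: cder_path_Im.
by case: (F _) (F _) => ? ? [].
Qed.

(* The factor 2 comes from bounding real and imaginary parts separately. *)
Lemma cder_segment F f z w M :
  (forall t : R, 0 <= t <= 1 -> cder F (z + t%:C%C * (w - z)) (f (z + t%:C%C * (w - z)))) ->
  (forall t : R, 0 <= t <= 1 -> normc (f (z + t%:C%C * (w - z))) <= M) ->
  normc (F w - F z) <= 2 * (M * normc (w - z)).
Proof.
move=> HF HM.
have HMn t : 0 <= t <= 1 -> normc ((w - z) * f (z + t%:C%C * (w - z))) <= M * normc (w - z).
  by move=> /HM h; rewrite normcM mulrC ler_wpM2r ?normc_ge0.
have E1 : z + 1%:C%C * (w - z) = w by rewrite mul1r addrC subrK.
have E0 : z + 0%:C%C * (w - z) = z by rewrite mul0r addr0.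
apply: normc_le2.
  have := mvt_abs ler01 (fun t t01 => cder_path_Re (HF t t01))
    (fun t t01 => le_trans (Re_le_normc _) (HMn t t01)).
  by rewrite E1 E0 subr0 mulr1 raddfB.
have := mvt_abs ler01 (fun t t01 => cder_path_Im (HF t t01))
  (fun t t01 => le_trans (Im_le_normc _) (HMn t t01)).
by rewrite E1 E0 subr0 mulr1 raddfB.
Qed.

End ComplexIntegral.

(** * Nested intervals and bisection of rectangles *)

Section Bisection.
Variable R : realType.

Lemma half_pow_small (s e : R) : 0 < e -> exists n, s / 2 ^+ n < e.
Proof.
move=> e0; have [n Hn] : exists n : nat, s / e < n%:R.
  by exists (Num.truncn (s / e)).+1; exact: truncnS_gt.
exists n; rewrite ltr_pdivrMr ?exprn_gt0// -ltr_pdivrMl// mulrC.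
by rewrite (lt_trans Hn)// -natrX ltr_nat ltn_expl.
Qed.

(** The left ends increase and the right ends decrease, so every left end is below every right end,
    and the supremum of the left ends lies in all the intervals. *)
Lemma sup_of_nested (u : nat -> R) (l : R) : 0 <= l ->
  (forall n, u n <= u n.+1 <= u n + l / 2 ^+ n.+1) ->
  exists p, forall n, u n <= p <= u n + l / 2 ^+ n.
Proof.
move=> l0 H.
have mono m n : (m <= n)%N -> u m <= u n.
  elim: n => [|n IH]; first by rewrite leqn0 => /eqP ->.
  rewrite leq_eqVlt ltnS => /orP[/eqP->//|/IH h]; have /andP[+ _] := H n.
  exact: le_trans.
have anti m n : (m <= n)%N -> u n + l / 2 ^+ n <= u m + l / 2 ^+ m.
  elim: n => [|n IH]; first by rewrite leqn0 => /eqP ->.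
  rewrite leq_eqVlt ltnS => /orP[/eqP->//|/IH]; apply: le_trans.
  have /andP[_ h] := H n; rewrite (splitr (l / 2 ^+ n)).
  have -> : l / 2 ^+ n / 2 = l / 2 ^+ n.+1 by rewrite exprSr invfM mulrA.
  lra.
have pos n : 0 <= l / 2 ^+ n by rewrite divr_ge0// exprn_ge0.
have bnd m n : u m <= u n + l / 2 ^+ n.
  case: (leqP m n) => [/mono h|/ltnW /anti h].
    by have := pos n; lra.
  by have := pos m; lra.
have hs : has_sup (range u).
  by split; [exists (u 0%N), 0%N|exists (u 0%N + l / 2 ^+ 0) => _ [m _ <-]].
exists (sup (range u)) => n; apply/andP; split.
  by apply: ub_le_sup; [case: hs|exists n].
by apply: ge_sup; [case: hs|move=> _ [m _ <-]].
Qed.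

(* [P x y s t] is a property of the rectangle [x, x + s] x [y, y + t]. *)
Lemma bisection (P : R -> R -> R -> R -> Prop) (x0 y0 s0 t0 : R) : 0 <= s0 -> 0 <= t0 ->
  (forall x y s t, 0 <= s -> 0 <= t ->
    P x y (s / 2) (t / 2) -> P (x + s / 2) y (s / 2) (t / 2) ->
    P x (y + t / 2) (s / 2) (t / 2) -> P (x + s / 2) (y + t / 2) (s / 2) (t / 2) ->
    P x y s t) ->
  (forall p q, x0 <= p <= x0 + s0 -> y0 <= q <= y0 + t0 -> exists2 e : R, 0 < e &
    forall x y s t, 0 <= s -> 0 <= t -> x <= p <= x + s -> y <= q <= y + t ->
      s + t < e -> x0 <= x -> x + s <= x0 + s0 -> y0 <= y -> y + t <= y0 + t0 ->
      P x y s t) ->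
  P x0 y0 s0 t0.
Proof.
move=> s00 t00 Hsplit Hloc; apply: contrapT => nP.
pose S n := s0 / 2 ^+ n; pose T n := t0 / 2 ^+ n.
have S0 n : 0 <= S n by rewrite divr_ge0// exprn_ge0.
have T0 n : 0 <= T n by rewrite divr_ge0// exprn_ge0.
have S2 n : S n / 2 = S n.+1 by rewrite /S exprSr invfM mulrA.
have T2 n : T n / 2 = T n.+1 by rewrite /T exprSr invfM mulrA.
(* A rectangle that fails [P] has a quarter that fails it too; the failing quarters shrink to a
   point, where the local hypothesis is contradicted. *)
pose C n (z w : R * R) := [/\ ~ P w.1 w.2 (S n.+1) (T n.+1),
  z.1 <= w.1 <= z.1 + S n.+1 & z.2 <= w.2 <= z.2 + T n.+1].
have step n (z : R * R) : ~ P z.1 z.2 (S n) (T n) -> exists w, C n z w.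
  move=> nPz; apply: contrapT => nC; apply: nPz; apply: Hsplit => //; rewrite S2 T2;
    apply: contrapT => nPw; apply: nC.
  - by exists z; split=> //; rewrite lexx lerDl ?S0 ?T0.
  - by exists (z.1 + S n.+1, z.2); split=> //=; rewrite lexx lerDl ?S0 ?T0.
  - by exists (z.1, z.2 + T n.+1); split=> //=; rewrite lexx lerDl ?S0 ?T0.
  - by exists (z.1 + S n.+1, z.2 + T n.+1); split=> //=; rewrite lexx lerDl ?S0 ?T0.
pose F := fix F n := if n is m.+1 then get (C m (F m)) else (x0, y0).
have PF n : ~ P (F n).1 (F n).2 (S n) (T n).
  elim: n => [|n IH]; first by rewrite /S /T expr0 !divr1.
  by have /getPex[] := step _ _ IH.
have CF n : C n (F n) (F n.+1) by have /getPex := step _ _ (PF n).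
have [p Hp] : exists p, forall n, (F n).1 <= p <= (F n).1 + S n.
  by apply: sup_of_nested => // n; case: (CF n).
have [q Hq] : exists p, forall n, (F n).2 <= p <= (F n).2 + T n.
  by apply: sup_of_nested => // n; case: (CF n).
have in1 n : x0 <= (F n).1 /\ (F n).1 + S n <= x0 + s0.
  elim: n => [|n [h1 h2]]; first by rewrite /S expr0 divr1 /=; split.
  have [_ + _] := CF n; move: h1 h2 (S2 n) => + + + /andP[].
  by move: (S n) (S n.+1) (F n).1 (F n.+1).1 => ? ? ? ? *; split; lra.
have in2 n : y0 <= (F n).2 /\ (F n).2 + T n <= y0 + t0.
  elim: n => [|n [h1 h2]]; first by rewrite /T expr0 divr1 /=; split.
  have [_ _] := CF n; move: h1 h2 (T2 n) => + + + /andP[].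
  by move: (T n) (T n.+1) (F n).2 (F n.+1).2 => ? ? ? ? *; split; lra.
have [||e e0 He] := Hloc p q.
- by have := Hp 0%N; rewrite /S expr0 divr1.
- by have := Hq 0%N; rewrite /T expr0 divr1.
have [n Hn] := half_pow_small (s0 + t0) e0.
apply: (PF n); apply: He => //; rewrite ?Hp ?Hq//; try by case: (in1 n). 
- by rewrite /S /T -mulrDl.
- by case: (in2 n).
- by case: (in2 n).
Qed.

End Bisection.

(** * Goursat's theorem and primitives *)

Section Goursat.
Variable R : realType.
Implicit Types (f F : R[i] -> R[i]) (z w : R[i]) (a b c d x y s t lo hi : R).

Lemma pcont_h f x y : ccont f (x +i* y)%C -> pcont (fun t => f (t +i* y)%C) x.
Proof.
have E t : (t +i* y)%C = (0 +i* y)%C + t%:C%C * 1.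
  by congr Complex; rewrite /=; ring.
by rewrite E => /ccont_pcont H; under eq_fun do rewrite E.
Qed.

Lemma pcont_v f x y : ccont f (x +i* y)%C -> pcont (fun t => f (x +i* t)%C) y.
Proof.
have E t : (x +i* t)%C = (x +i* 0)%C + t%:C%C * 'i%C.
  by congr Complex; rewrite /=; ring.
by rewrite E => /ccont_pcont H; under eq_fun do rewrite E.
Qed.

Definition hint f a b y := cint (fun x => f (x +i* y)%C) a b.
Definition vint f x c d := cint (fun y => f (x +i* y)%C) c d.

(* The integral over the boundary of [a, b] x [c, d], counterclockwise when
   a < b and c < d; the corners may come in any order. *)
Definition rectint f a b c d : R[i] :=
  hint f a b c - hint f a b d + 'i%C * (vint f b c d - vint f a c d).

Lemma rectintCx f a b c d : rectint f b a c d = - rectint f a b c d.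
Proof. by rewrite /rectint /hint !(cintC _ a b); ring. Qed.

Lemma rectintCy f a b c d : rectint f a b d c = - rectint f a b c d.
Proof. by rewrite /rectint /vint !(cintC _ c d); ring. Qed.

Lemma rectint_chaslesx lo hi lo' hi' f a b e c d :
  lo <= a <= hi -> lo <= b <= hi -> lo <= e <= hi -> lo' <= c <= hi' -> lo' <= d <= hi' ->
  (forall z, lo <= complex.Re z <= hi -> lo' <= complex.Im z <= hi' -> ccont f z) ->
  rectint f a b c d + rectint f b e c d = rectint f a e c d.
Proof.
move=> la lb le lc ld hf; rewrite /rectint.
have H y : lo' <= y <= hi' -> hint f a b y + hint f b e y = hint f a e y.
  move=> ly; apply: (cint_chasles la lb le) => x lx; apply: pcont_h; exact: hf.
rewrite -(H _ lc) -(H _ ld); ring.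
Qed.

Lemma rectint_chaslesy lo hi lo' hi' f a b c d e :
  lo <= a <= hi -> lo <= b <= hi -> lo' <= c <= hi' -> lo' <= d <= hi' -> lo' <= e <= hi' ->
  (forall z, lo <= complex.Re z <= hi -> lo' <= complex.Im z <= hi' -> ccont f z) ->
  rectint f a b c d + rectint f a b d e = rectint f a b c e.
Proof.
move=> la lb lc ld le hf; rewrite /rectint.
have H x : lo <= x <= hi -> vint f x c d + vint f x d e = vint f x c e.
  move=> lx; apply: (cint_chasles lc ld le) => y ly; apply: pcont_v; exact: hf.
rewrite -(H _ la) -(H _ lb); ring.
Qed.

Definition bdry a b c d z :=
  (btw a b (complex.Re z) && ((complex.Im z == c) || (complex.Im z == d))) ||
  (btw c d (complex.Im z) && ((complex.Re z == a) || (complex.Re z == b))).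

Lemma bdry_rect a b c d z : bdry a b c d z -> btw a b (complex.Re z) /\ btw c d (complex.Im z).
Proof.
by move=> /orP[] /andP[h /orP[] /eqP k]; split=> //; rewrite k /btw lexx /= ?orbT ?andbT;
  case: leP => //= /ltW.
Qed.

Lemma bdry_h a b c d x y : btw a b x -> (y == c) || (y == d) -> bdry a b c d (x +i* y)%C.
Proof. by move=> h1 h2; rewrite /bdry /= h1 h2. Qed.

Lemma bdry_v a b c d x y : btw c d y -> (x == a) || (x == b) -> bdry a b c d (x +i* y)%C.
Proof. by move=> h1 h2; rewrite /bdry /= h1 h2 orbT. Qed.

Lemma rectint_le M f a b c d :
  (forall z, bdry a b c d z -> ccont f z) ->
  (forall z, bdry a b c d z -> normc (f z) <= M) ->
  normc (rectint f a b c d) <= 4 * (M * (`|b - a| + `|d - c|)).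
Proof.
move=> hf HM.
have H y : (y == c) || (y == d) -> normc (hint f a b y) <= 2 * (M * `|b - a|).
  by move=> yc; apply: cint_le => x xab; [apply/pcont_h/hf|apply: HM]; exact: bdry_h.
have V x : (x == a) || (x == b) -> normc (vint f x c d) <= 2 * (M * `|d - c|).
  by move=> xc; apply: cint_le => y yab; [apply/pcont_v/hf|apply: HM]; exact: bdry_v.
rewrite /rectint (le_trans (le_normcD _ _))// normcM normc_i mul1r.
have := ler_normcB (hint f a b c) (hint f a b d).
have := ler_normcB (vint f b c d) (vint f a c d).
have := H c; have := H d; have := V a; have := V b; rewrite !eqxx ?orbT.
move=> /(_ isT) ? /(_ isT) ? /(_ isT) ? /(_ isT) ?; lra.
Qed.

Lemma rectintD f g a b c d :
  (forall z, bdry a b c d z -> ccont f z) -> (forall z, bdry a b c d z -> ccont g z) ->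
  rectint (fun z => f z + g z) a b c d = rectint f a b c d + rectint g a b c d.
Proof.
move=> hf hg.
have H y : (y == c) || (y == d) ->
    hint (fun z => f z + g z) a b y = hint f a b y + hint g a b y.
  by move=> yc; apply: cintD => x xab; apply: pcont_h; [apply: hf|apply: hg]; exact: bdry_h.
have V x : (x == a) || (x == b) ->
    vint (fun z => f z + g z) x c d = vint f x c d + vint g x c d.
  by move=> yc; apply: cintD => y xab; apply: pcont_v; [apply: hf|apply: hg]; exact: bdry_v.
by rewrite /rectint !H ?V ?eqxx ?orbT//; ring.
Qed.

Lemma rectintZ k f a b c d : (forall z, bdry a b c d z -> ccont f z) ->
  rectint (fun z => k * f z) a b c d = k * rectint f a b c d.
Proof.
move=> hf.
have H y : (y == c) || (y == d) -> hint (fun z => k * f z) a b y = k * hint f a b y.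
  by move=> yc; apply: cintZ => x xab; apply/pcont_h/hf/bdry_h.
have V x : (x == a) || (x == b) -> vint (fun z => k * f z) x c d = k * vint f x c d.
  by move=> yc; apply: cintZ => y xab; apply/pcont_v/hf/bdry_v.
by rewrite /rectint !H ?V ?eqxx ?orbT//; ring.
Qed.

Lemma eq_rectint f g a b c d : (forall z, bdry a b c d z -> f z = g z) ->
  rectint f a b c d = rectint g a b c d.
Proof.
move=> fg.
have H y : (y == c) || (y == d) -> hint f a b y = hint g a b y.
  by move=> yc; apply: eq_cint => x xab; apply/fg/bdry_h.
have V x : (x == a) || (x == b) -> vint f x c d = vint g x c d.
  by move=> yc; apply: eq_cint => y xab; apply/fg/bdry_v.
by rewrite /rectint !H ?V ?eqxx ?orbT.
Qed.

Lemma hint_prim F f a b y : (forall x, btw a b x -> cder F (x +i* y)%C (f (x +i* y)%C)) ->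
  hint f a b y = F (b +i* y)%C - F (a +i* y)%C.
Proof.
have E t : (t +i* y)%C = (0 +i* y)%C + t%:C%C * 1.
  by congr Complex; rewrite /=; ring.
move=> H; rewrite (E a) (E b) -(@cint_path R F f).
  by apply: eq_cint => t _; rewrite E mul1r.
by move=> t /H; rewrite E.
Qed.

Lemma vint_prim F f x c d : (forall y, btw c d y -> cder F (x +i* y)%C (f (x +i* y)%C)) ->
  (forall y, btw c d y -> ccont f (x +i* y)%C) ->
  'i%C * vint f x c d = F (x +i* d)%C - F (x +i* c)%C.
Proof.
have E t : (x +i* t)%C = (x +i* 0)%C + t%:C%C * 'i%C.
  by congr Complex; rewrite /=; ring.
move=> H hf; rewrite -cintZ; last by move=> y /hf; exact: pcont_v.
rewrite (E c) (E d) -(@cint_path R F f).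
  by apply: eq_cint => t _; rewrite E.
by move=> t /H; rewrite E.
Qed.

Lemma rectint_prim F f a b c d :
  (forall z, btw a b (complex.Re z) -> btw c d (complex.Im z) -> cder F z (f z)) ->
  (forall z, btw a b (complex.Re z) -> btw c d (complex.Im z) -> ccont f z) ->
  rectint f a b c d = 0.
Proof.
have ba x : btw x b b by rewrite /btw; lra.
have aa x : btw a x a by rewrite /btw; lra.
have cc x : btw c x c by rewrite /btw; lra.
have dd x : btw x d d by rewrite /btw; lra.
move=> HF Hf; rewrite /rectint mulrBr !(@vint_prim F f) ?(@hint_prim F f); first by ring.
all: by move=> x xab; (apply: HF || apply: Hf).
Qed.

(** A bound of the form e * (half-perimeter) ^ 2 passes from the four quarters to the whole. It
    holds on small rectangles around any point, since the affine part of f there has a primitive and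
    only the remainder counts. Bisection gives it for the whole rectangle, and e is arbitrary. *)
Lemma goursat f a b c d : a <= b -> c <= d ->
  (forall z, a <= complex.Re z <= b -> c <= complex.Im z <= d -> exists l, cder f z l) ->
  rectint f a b c d = 0.
Proof.
move=> ab cd hf.
have hc z : a <= complex.Re z <= b -> c <= complex.Im z <= d -> ccont f z.
  by move=> h1 /(hf _ h1)[l /cder_cont].
suff H e : 0 < e -> normc (rectint f a b c d) <= e * ((b - a) + (d - c)) ^+ 2.
  apply/eqP; rewrite -normc_eq0 eq_le normc_ge0 andbT.
  apply/ler_addgt0Pl => e e0; rewrite addr0.
  set k := (b - a + (d - c)) ^+ 2 in H; have k0 : 0 <= k by rewrite sqr_ge0.
  have k1 : 0 < k + 1 by lra.
  rewrite (le_trans (H _ (divr_gt0 e0 k1)))// mulrAC ler_pdivrMr// ler_wpM2l//; lra.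
move=> e0.
pose P x y s t := a <= x -> x + s <= b -> c <= y -> y + t <= d ->
  normc (rectint f x (x + s) y (y + t)) <= e * (s + t) ^+ 2.
have : P a c (b - a) (d - c).
  apply: (@bisection R P); rewrite ?subr_ge0//.
    move=> x y s t s0 t0 P1 P2 P3 P4 ax xb cy yd.
    have {}P1 := P1 ax ltac:(lra) cy ltac:(lra).
    have {}P2 := P2 ltac:(lra) ltac:(lra) cy ltac:(lra).
    have {}P3 := P3 ax ltac:(lra) ltac:(lra) ltac:(lra).
    have {}P4 := P4 ltac:(lra) ltac:(lra) ltac:(lra) ltac:(lra).
    rewrite -!addrA -!splitr in P1 P2 P3 P4.
    rewrite -(@rectint_chaslesx a b c d f x (x + s / 2) (x + s)) //; try lra.
    rewrite -(@rectint_chaslesy a b c d f x (x + s / 2) y (y + t / 2) (y + t)) //; try lra.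
    rewrite -(@rectint_chaslesy a b c d f (x + s / 2) (x + s) y (y + t / 2) (y + t)) //; try lra.
    rewrite (le_trans (le_normcD _ _))//; apply: (le_trans (lerD (le_normcD _ _) (le_normcD _ _))).
    have -> : e * (s + t) ^+ 2 = 4 * (e * (s / 2 + t / 2) ^+ 2) by field.
    lra.
  move=> p q hp hq; rewrite !(addrC _ (_ - _)) !subrK in hp hq *.
  have [l Hl] := hf (p +i* q)%C hp hq.
  (* [rectint_le] loses a factor 4, so e / 8 leaves e / 2 in the end. *)
  have [r r0 Hr] := Hl _ (divr_gt0 e0 (ltr0n R 8)).
  exists r => // x y s t s0 t0 px qy str _ _ _ _ ax xb cy yd.
  set g := fun z => f z - f (p +i* q)%C - (z - (p +i* q)%C) * l.
  have box z : x <= complex.Re z <= x + s -> y <= complex.Im z <= y + t ->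
      a <= complex.Re z <= b /\ c <= complex.Im z <= d by move=> h1 h2; split; lra.
  have bx u : btw x (x + s) u = (x <= u <= x + s) by rewrite btw_le; lra.
  have by_ u : btw y (y + t) u = (y <= u <= y + t) by rewrite btw_le; lra.
  pose A z := f (p +i* q)%C + (z - (p +i* q)%C) * l.
  have cA z : cder A z l.
    rewrite -[X in cder _ _ X]add0r; apply: cderD; first exact: cder_cst.
    apply: cder_eq (cderM (cderB (cder_id z) (cder_cst _ z)) (cder_cst l z)) _.
    by ring.
  have fg : f = (fun z => g z + A z) by apply/funext => z; rewrite /g /A; ring.
  have cg z : a <= complex.Re z <= b -> c <= complex.Im z <= d -> ccont g z.
    move=> h1 h2; have [m Hm] := hf z h1 h2.
    apply: cder_cont (_ : cder g z (m - l)).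
    rewrite (_ : g = fun z => f z - A z); first exact: cderB.
    by apply/funext => w; rewrite /g /A; ring.
  (* A primitive of the affine part [A]. *)
  pose B z := f (p +i* q)%C * z + (z - (p +i* q)%C) ^+ 2 * (l / 2).
  have cB z : cder B z (A z).
    have HB := cderD (cderZ (f (p +i* q)%C) (cder_id z))
      (cderM (cderM (cderB (cder_id z) (cder_cst (p +i* q)%C z))
                    (cderB (cder_id z) (cder_cst (p +i* q)%C z))) (cder_cst (l / 2) z)).
    apply: cder_eq HB _; rewrite /A; by field.
  rewrite fg rectintD; last 2 first.
  - by move=> z /bdry_rect[]; rewrite bx by_ => h1 h2; have [h3 h4] := box _ h1 h2; exact: cg.
  - by move=> z _; exact: cder_cont (cA z).
  rewrite (@rectint_prim B A) ?addr0; last 2 first.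
  - by move=> z _ _; exact: cB.
  - by move=> z _ _; exact: cder_cont (cA z).
  have gM z : bdry x (x + s) y (y + t) z ->
      normc (g z) <= e / 8 * (s + t) .
    move=> /bdry_rect[]; rewrite bx by_ => h1 h2.
    have h3 : normc (z - (p +i* q)%C) <= s + t.
      rewrite (le_trans (normc_le_ReIm _))// !raddfB/= lerD// ler_norml; lra.
    rewrite (le_trans (Hr _ _)) ?(le_lt_trans h3)//.
    by rewrite ler_wpM2l// divr_ge0// ltW.
  apply: (le_trans (rectint_le _ gM)).
    by move=> z /bdry_rect[]; rewrite bx by_ => h1 h2; have [h3 h4] := box _ h1 h2; exact: cg.
  rewrite !(addrC _ (- _)) !addKr !ger0_norm// mulrA.
  have -> : 4 * (e / 8 * (s + t)) * (s + t) = e / 2 * (s + t) ^+ 2 by field.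
  by rewrite ler_wpM2r ?sqr_ge0//; lra.
move=> /(_ (lexx _) _ (lexx _)).
have -> : a + (b - a) = b by ring.
have -> : c + (d - c) = d by ring.
by move=> /(_ (lexx _) (lexx _)).
Qed.

End Goursat.

Lemma xy_eta (R : realType) (z : R[i]) : (complex.Re z +i* complex.Im z)%C = z.
Proof. by case: z. Qed.

Lemma btw_dist (R : realType) (x u t : R) : btw x u t -> `|t - x| <= `|u - x|.
Proof.
have := ler_norm (u - x); have := ler_norm (x - u); rewrite distrC ler_norml /btw; lra.
Qed.

(** * Primitives on box-like open sets, and isolated singularities *)

Section Primitive.
Variable R : realType.
Implicit Types (f F : R[i] -> R[i]) (U : set R[i]) (z w u : R[i]) (a b c d x y s t : R).

Definition copen U := forall z, U z -> exists2 r : R, 0 < r & forall w, normc (w - z) < r -> U w.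

(* Stands in for simple connectedness: primitives are built along axis-parallel paths. *)
Definition boxlike U := forall z w u, U z -> U w ->
  btw (complex.Re z) (complex.Re w) (complex.Re u) ->
  btw (complex.Im z) (complex.Im w) (complex.Im u) -> U u.

Definition hol U f := forall z, U z -> exists l, cder f z l.

Lemma hol_cont U f z : hol U f -> U z -> ccont f z.
Proof. by move=> hf /hf[l /cder_cont]. Qed.

Lemma rectint_splitx f a e b c d : btw a b e ->
  (forall z, btw a b (complex.Re z) -> btw c d (complex.Im z) -> ccont f z) ->
  rectint f a b c d = rectint f a e c d + rectint f e b c d.
Proof.
move=> aeb hf; rewrite /rectint.
have H y : btw c d y -> hint f a b y = hint f a e y + hint f e b y.
  move=> cy; rewrite /hint cint_chasles_btw// => x h; apply/pcont_h/hf => //=.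
  by move: h aeb; rewrite /btw; lra.
by rewrite (H c) ?(H d); [ring| |]; rewrite /btw; lra.
Qed.

Lemma rectint_splity f a b c e d : btw c d e ->
  (forall z, btw a b (complex.Re z) -> btw c d (complex.Im z) -> ccont f z) ->
  rectint f a b c d = rectint f a b c e + rectint f a b e d.
Proof.
move=> aeb hf; rewrite /rectint.
have H x : btw a b x -> vint f x c d = vint f x c e + vint f x e d.
  move=> cy; rewrite /vint cint_chasles_btw// => y h; apply/pcont_v/hf => //=.
  by move: h aeb; rewrite /btw; lra.
by rewrite (H a) ?(H b); [ring| |]; rewrite /btw; lra.
Qed.

Lemma goursat_btw f a b c d :
  (forall z, btw a b (complex.Re z) -> btw c d (complex.Im z) -> exists l, cder f z l) ->
  rectint f a b c d = 0.
Proof.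
wlog ab : a b / a <= b => [H|].
  case: (leP a b) => [|/ltW] ab hf; first exact: H.
  by rewrite rectintCx H ?oppr0// => z; rewrite btwC; exact: hf.
wlog cd : c d / c <= d => [H|].
  case: (leP c d) => [|/ltW] cd hf; first exact: H.
  by rewrite rectintCy H ?oppr0// => z h; rewrite btwC; exact: hf.
by move=> hf; apply: goursat => // z h1 h2; apply: hf; rewrite btw_le.
Qed.

(** [F] integrates f from a base point, along a horizontal and then a vertical segment. As rectangle
    integrals vanish, the order of the two may be exchanged, so F w - F z is the integral along the
    short path from z to w, horizontal and then vertical, where f is close to f z. *)
Lemma prim_of_rectint U f : copen U -> boxlike U -> (forall z, U z -> ccont f z) ->
  (forall z w, U z -> U w ->
     rectint f (complex.Re z) (complex.Re w) (complex.Im z) (complex.Im w) = 0) ->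
  exists F, forall z, U z -> cder F z (f z).
Proof.
move=> oU bU hc hr.
have [[z0 Uz0]|nU] := pselect (exists z, U z); last first.
  by exists f => z Uz; case: nU; exists z.
pose x0 := complex.Re z0; pose y0 := complex.Im z0.
pose F z := hint f x0 (complex.Re z) y0 + 'i%C * vint f (complex.Re z) y0 (complex.Im z).
exists F => z Uz e e0.
have [r r0 Ur] := oU _ Uz.
have [d d0 Hd] := hc _ Uz _ (divr_gt0 e0 (ltr0n R 4)).
exists (Num.min d r); first by rewrite lt_min d0.
move=> w; rewrite lt_min => /andP[wd wr].
set x := complex.Re z; set y := complex.Im z; set u := complex.Re w; set v := complex.Im w.
have nx : `|u - x| <= normc (w - z) by rewrite -raddfB Re_le_normc.
have ny : `|v - y| <= normc (w - z) by rewrite -raddfB Im_le_normc.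
have near1 t : btw x u t -> normc ((t +i* y)%C - z) <= normc (w - z).
  move=> xt; apply: le_trans nx; rewrite -(xy_eta z) -/x -/y.
  have -> : (t +i* y)%C - (x +i* y)%C = ((t - x)%:C)%C by congr Complex; rewrite /=; ring.
  by rewrite normc_real; exact: btw_dist.
have near2 t : btw y v t -> normc ((u +i* t)%C - z) <= normc (w - z).
  move=> /btw_dist yt; rewrite -(ler_pXn2r (n := 2)) ?nnegrE ?normc_ge0// !normc_sqr.
  rewrite !raddfB /= lerD2l -(real_normK (num_real (t - _))).
  by rewrite -(real_normK (num_real (_ - complex.Im z))) lerXn2r ?nnegrE.
have U1 t : btw x u t -> U (t +i* y)%C by move=> /near1 h; apply: Ur; exact: le_lt_trans h wr.
have U2 t : btw y v t -> U (u +i* t)%C by move=> /near2 h; apply: Ur; exact: le_lt_trans h wr.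
have Uuy : U (u +i* y)%C by apply: U1; rewrite /btw; case: leP => //= h; lra.
have := hr _ _ Uz0 Uuy; have := hr _ _ Uz0 Uz.
rewrite /rectint -/x0 -/y0 -/x -/y /= => R1 R2.
have H1 : hint f x0 x y + hint f x u y = hint f x0 u y.
  apply: cint_chasles_btw => t /or3P[] h; apply/pcont_h/hc.
  - by apply: bU Uz0 Uz _ _ => //=; rewrite /btw -/y; case: (leP y0 y) => //= ?; lra.
  - exact: U1.
  - by apply: bU Uz0 Uuy _ _ => //=; rewrite /btw -/y; case: (leP y0 y) => //= ?; lra.
have H2 : vint f u y0 y + vint f u y v = vint f u y0 v.
  apply: cint_chasles_btw => t /or3P[] h; apply/pcont_v/hc.
  - by apply: bU Uz0 Uuy _ _ => //=; rewrite /btw; case: (leP x0 u) => //= ?; lra.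
  - exact: U2.
  - by apply: bU Uz0 (Ur _ wr) _ _ => //=; rewrite /btw -/u; case: (leP x0 u) => //= ?; lra.
have H3 : hint f x u y - (u - x)%:C%C * f z = cint (fun t => f (t +i* y)%C + - f z) x u.
  rewrite cintD; last 2 first.
  - by move=> t /U1 /hc; exact: pcont_h.
  - by move=> t _ k k0; exists 1 => // ? _; rewrite subrr normc0 ltW.
  by rewrite cint_cst mulrN.
have H4 : vint f u y v - (v - y)%:C%C * f z = cint (fun t => f (u +i* t)%C + - f z) y v.
  rewrite cintD; last 2 first.
  - by move=> t /U2 /hc; exact: pcont_v.
  - by move=> t _ k k0; exists 1 => // ? _; rewrite subrr normc0 ltW.
  by rewrite cint_cst mulrN.
have pB h : pcont h u -> pcont (fun t => h t + - f z) u.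
  move=> H k /H[k' k'0 {}H]; exists k' => // ? /H.
  by rewrite opprD addrACA subrr addr0.
have B3 : normc (hint f x u y - (u - x)%:C%C * f z) <= 2 * (e / 4 * `|u - x|).
  rewrite H3; apply: cint_le => t xt.
    move=> k k0; have [k' k'0 H] := pcont_h (hc _ (U1 _ xt)) k0; exists k' => // ? /H.
    by rewrite opprD addrACA subrr addr0.
  by apply: Hd; exact: le_lt_trans (near1 _ xt) wd.
have B4 : normc (vint f u y v - (v - y)%:C%C * f z) <= 2 * (e / 4 * `|v - y|).
  rewrite H4; apply: cint_le => t xt.
    move=> k k0; have [k' k'0 H] := pcont_v (hc _ (U2 _ xt)) k0; exists k' => // ? /H.
    by rewrite opprD addrACA subrr addr0.
  by apply: Hd; exact: le_lt_trans (near2 _ xt) wd.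
have -> : F w - F z - (w - z) * f z = (hint f x u y - (u - x)%:C%C * f z) +
    'i%C * (vint f u y v - (v - y)%:C%C * f z).
  have -> : w - z = (u - x)%:C%C + 'i%C * (v - y)%:C%C.
    by rewrite -(xy_eta w) -(xy_eta z) -/x -/y -/u -/v; congr Complex; rewrite /=; ring.
  rewrite /F -/x -/y -/u -/v -H2.
  rewrite (_ : hint f x u y = hint f x0 u y - hint f x0 x y); last by rewrite -H1; ring.
  have E1 : hint f x0 u y0 = hint f x0 u y - 'i%C * (vint f u y0 y - vint f x0 y0 y).
    by apply/eqP; rewrite -subr_eq0 -[X in _ == X]R2; apply/eqP; ring.
  have E2 : hint f x0 x y0 = hint f x0 x y - 'i%C * (vint f x y0 y - vint f x0 y0 y).
    by apply/eqP; rewrite -subr_eq0 -[X in _ == X]R1; apply/eqP; ring.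
  by rewrite E1 E2; ring.
rewrite (le_trans (le_normcD _ _))// normcM normc_i mul1r.
have := ler_wpM2l (ltW e0) nx; have := ler_wpM2l (ltW e0) ny; lra.
Qed.

Lemma hol_prim U f : copen U -> boxlike U -> hol U f ->
  exists F, forall z, U z -> cder F z (f z).
Proof.
move=> oU bU hf; apply: prim_of_rectint => // [z Uz|z w Uz Uw]; first exact: hol_cont hf Uz.
by apply: goursat_btw => u h1 h2; apply: hf; exact: bU Uz Uw h1 h2.
Qed.

Lemma btw_first x y : btw x y x.
Proof. by rewrite /btw; case: (leP x y) => //= ?; lra. Qed.

Lemma btw_last x y : btw x y y.
Proof. by rewrite /btw; case: (leP x y) => //= ?; lra. Qed.

Lemma btw_cut (p b x u : R) : btw p b x -> x != p -> btw x b u -> u != p /\ btw p b u.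
Proof.
move=> h1 /eqP h2 h3; split; last by move: h1 h3; rewrite /btw; lra.
apply/eqP => up; apply: h2; move: h1 h3; rewrite up /btw; lra.
Qed.

(** With the singularity at a corner, Goursat's theorem on the rest of the rectangle leaves only a
    copy shrunk by t at that corner. There f is bounded by continuity, so the integral is O(t). *)
Lemma rectint_corner0 U f z w : boxlike U -> (forall z, U z -> ccont f z) ->
  (forall u, U u -> u != z -> exists l, cder f u l) -> U z -> U w ->
  rectint f (complex.Re z) (complex.Re w) (complex.Im z) (complex.Im w) = 0.
Proof.
move=> bU hc hf Uz Uw.
set p := complex.Re z; set q := complex.Im z; set b := complex.Re w; set d := complex.Im w.
have [->|bp] := eqVneq b p; first by rewrite /rectint /hint !cint_refl; ring.
have [->|dq] := eqVneq d q; first by rewrite /rectint /vint !cint_refl; ring.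
have UU u : btw p b (complex.Re u) -> btw q d (complex.Im u) -> U u by exact: bU.
have H t : 0 < t < 1 ->
    rectint f p b q d = rectint f p (p + t * (b - p)) q (q + t * (d - q)).
  move=> t01; set x := p + _; set y := q + _.
  have px : btw p b x.
    rewrite /btw /x; case: (leP p b) => /= ?; last apply/orP; first (apply/orP; left); last right; nra.
  have qy : btw q d y.
    rewrite /btw /y; case: (leP q d) => /= ?; last apply/orP; first (apply/orP; left); last right; nra.
  have xp : x != p by rewrite /x -subr_eq0 addrC addKr mulf_neq0 ?subr_eq0//; lra.
  have yq : y != q by rewrite /y -subr_eq0 addrC addKr mulf_neq0 ?subr_eq0//; lra.
  have cR u : btw p b (complex.Re u) -> btw q d (complex.Im u) -> ccont f u.
    by move=> h1 h2; apply/hc/UU.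
  rewrite (rectint_splitx px cR) (@rectint_splity f p x q y d) //; last first.
    by move=> u h1 h2; apply: cR => //; move: h1 px; rewrite /btw; lra.
  rewrite (@goursat_btw f x b q d) ?(@goursat_btw f p x y d) ?addr0// => u h1 h2; apply: hf.
  - have [_ h3] := btw_cut qy yq h2.
    by apply: UU => //; move: h1 px; rewrite /btw; lra.
  - by apply: contra_neq (proj1 (btw_cut qy yq h2)) => ->.
  - by apply: UU => //; have [] := btw_cut px xp h1.
  - by apply: contra_neq (proj1 (btw_cut px xp h1)) => ->.
apply/eqP; rewrite -normc_eq0 eq_le normc_ge0 andbT.
apply/ler_addgt0Pl => e e0; rewrite addr0.
pose S := `|b - p| + `|d - q|; pose K := normc (f z) + 1.
have S0 : 0 <= S by rewrite addr_ge0.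
have K0 : 0 < K by rewrite ltr_wpDl// normc_ge0.
have [r r0 Hr] := hc _ Uz _ ltr01.
(* The three bounds keep t < 1, the shrunk rectangle where |f| <= [K], and the bound 4 K t S on its
   integral below e. *)
pose t := Num.min (1 / 2) (Num.min (r / (S + 1)) (e / (4 * K * S + 1))).
have D0 : 0 < 4 * K * S + 1 by rewrite ltr_wpDl// !mulr_ge0// ltW.
have t0 : 0 < t by rewrite !lt_min !divr_gt0//; lra.
have [t1 t2 t3] : [/\ t <= 1 / 2, t <= r / (S + 1) & t <= e / (4 * K * S + 1)].
  by split; rewrite /t !ge_min lexx ?orbT.
have tS : t * S < r.
  rewrite ler_pdivlMr in t2; last lra; apply: lt_le_trans t2.
  by rewrite ltr_pM2l//; lra.
rewrite (H t); last lra.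
have eR u : bdry p (p + t * (b - p)) q (q + t * (d - q)) u -> normc (u - z) < r /\ U u.
  move=> /bdry_rect[h1 h2]; split; last first.
    apply: UU; [have := h1|have := h2]; rewrite /btw; move=> /orP[|] /andP[? ?]; apply/orP.
    - by left; nra.
    - by right; nra.
    - by left; nra.
    - by right; nra.
  apply: le_lt_trans tS; rewrite (le_trans (normc_le_ReIm _))// !raddfB /= /S mulrDr.
  have := btw_dist h1; have := btw_dist h2.
  rewrite (_ : p + _ - p = t * (b - p)); last by ring.
  rewrite (_ : q + _ - q = t * (d - q)); last by ring.
  by rewrite !normrM (gtr0_norm t0) => h3 h4; exact: lerD.
have := @rectint_le R K f p (p + t * (b - p)) q (q + t * (d - q)).
have h1 : forall u, bdry p (p + t * (b - p)) q (q + t * (d - q)) u -> ccont f u.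
  by move=> u /eR[_ ?]; exact: hc.
have h2 : forall u, bdry p (p + t * (b - p)) q (q + t * (d - q)) u -> normc (f u) <= K.
  move=> u /eR[/Hr h _]; rewrite -(subrK (f z) (f u)) (le_trans (le_normcD _ _))//.
  by rewrite addrC /K; lra.
move=> /(_ h1 h2) h3; apply: le_trans h3 _.
rewrite (_ : p + _ - p = t * (b - p)); last by ring.
rewrite (_ : q + _ - q = t * (d - q)); last by ring.
rewrite !normrM (gtr0_norm t0) -mulrDr -/S.
rewrite ler_pdivlMr// in t3; nra.
Qed.

(** A rectangle containing the singularity is cut at that point into four rectangles that have it as
    a corner. *)
Lemma rectint_punctured U f z0 : boxlike U -> (forall z, U z -> ccont f z) ->
  (forall u, U u -> u != z0 -> exists l, cder f u l) -> U z0 -> forall z w, U z -> U w ->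
  rectint f (complex.Re z) (complex.Re w) (complex.Im z) (complex.Im w) = 0.
Proof.
move=> bU hc hf U0 z w Uz Uw.
have UU u : btw (complex.Re z) (complex.Re w) (complex.Re u) ->
  btw (complex.Im z) (complex.Im w) (complex.Im u) -> U u by exact: bU.
have [in0|nin0] := boolP (btw (complex.Re z) (complex.Re w) (complex.Re z0) &&
   btw (complex.Im z) (complex.Im w) (complex.Im z0)); last first.
  apply: goursat_btw => u h1 h2; apply: hf; first exact: UU.
  by apply: contraNneq nin0 => <-; rewrite h1 h2.
have /andP[in1 in2] := in0.
have cR u : btw (complex.Re z) (complex.Re w) (complex.Re u) ->
  btw (complex.Im z) (complex.Im w) (complex.Im u) -> ccont f u by move=> h1 h2; apply/hc/UU.
have C0 v : U v -> rectint f (complex.Re z0) (complex.Re v) (complex.Im z0) (complex.Im v) = 0.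
  exact: rectint_corner0.
have Uzw : U (complex.Re z +i* complex.Im w)%C.
  by apply: UU; [exact: btw_first|exact: btw_last].
have Uwz : U (complex.Re w +i* complex.Im z)%C.
  by apply: UU; [exact: btw_last|exact: btw_first].
rewrite (rectint_splitx in1 cR) !(rectint_splity in2).
- rewrite 2!(rectintCx _ (complex.Re z0) (complex.Re z)).
  rewrite (rectintCy _ _ _ (complex.Im z0)) (rectintCy _ (complex.Re z0) (complex.Re w) (complex.Im z0) (complex.Im z)).
  by rewrite (C0 _ Uz) (C0 _ Uw) (C0 _ Uzw) (C0 _ Uwz); ring.
- by move=> u h1 h2; apply: cR => //; move: h1 in1; rewrite /btw; lra.
- by move=> u h1 h2; apply: cR => //; move: h1 in1; rewrite /btw; lra.
Qed.

(** Bisection stands in for compactness: the bounds on the four quarters are added, and continuity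
    at a point bounds f on the small rectangles around it. *)
Lemma cont_bounded f a b c d : a <= b -> c <= d ->
  (forall z, a <= complex.Re z <= b -> c <= complex.Im z <= d -> ccont f z) ->
  exists2 M : R, 0 <= M & forall z, a <= complex.Re z <= b -> c <= complex.Im z <= d ->
    normc (f z) <= M.
Proof.
move=> ab cd hc.
pose P x y s t := exists2 M : R, 0 <= M &
  forall z, x <= complex.Re z <= x + s -> y <= complex.Im z <= y + t -> normc (f z) <= M.
suff : P a c (b - a) (d - c) by rewrite /P !(addrC _ (_ - _)) !subrK.
apply: (@bisection R P); rewrite ?subr_ge0//.
  move=> x y s t s0 t0 [M1 M10 H1] [M2 M20 H2] [M3 M30 H3] [M4 M40 H4].
  exists (M1 + M2 + M3 + M4); first lra.
  move=> z hx hy; case: (leP (complex.Re z) (x + s / 2)) => h1;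
    case: (leP (complex.Im z) (y + t / 2)) => h2.
  - by have := H1 z ltac:(lra) ltac:(lra); lra.
  - by have := H3 z ltac:(lra) ltac:(lra); lra.
  - by have := H2 z ltac:(lra) ltac:(lra); lra.
  - by have := H4 z ltac:(lra) ltac:(lra); lra.
move=> p q hp hq.
have [||r r0 Hr] := hc (p +i* q)%C _ _ _ ltr01.
- by move: hp => /=; lra.
- by move: hq => /=; lra.
exists r => // x y s t s0 t0 px qy str _ _ _ _.
exists (normc (f (p +i* q)%C) + 1); first by rewrite addr_ge0// normc_ge0.
move=> z hx hy.
have h : normc (z - (p +i* q)%C) < r.
  apply: le_lt_trans str; rewrite (le_trans (normc_le_ReIm _))// !raddfB/= lerD// ler_norml; lra.
rewrite -(subrK (f (p +i* q)%C) (f z)) (le_trans (le_normcD _ _))//.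
by have := Hr _ h; lra.
Qed.

End Primitive.

(** * Cauchy's formula *)

Section Cauchy.
Variable R : realType.
Implicit Types (f g h F : R[i] -> R[i]) (U : set R[i]) (z w u : R[i]) (a b c d x y s t r : R).

Lemma ccontM f g z : ccont f z -> ccont g z -> ccont (fun w => f w * g w) z.
Proof.
move=> Hf Hg e e0.
have f0 : 0 < normc (f z) + 1 by rewrite ltr_wpDl// normc_ge0.
have g0 : 0 < normc (g z) + 1 by rewrite ltr_wpDl// normc_ge0.
have [d1 d10 H1] := Hf _ ltr01.
have [d2 d20 H2] := Hg _ (divr_gt0 (divr_gt0 e0 (ltr0n R 2)) f0).
have [d3 d30 H3] := Hf _ (divr_gt0 (divr_gt0 e0 (ltr0n R 2)) g0).
exists (Num.min d1 (Num.min d2 d3)); first by rewrite !lt_min d10 d20.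
move=> w; rewrite !lt_min => /and3P[/H1 h1 /H2 h2 /H3 h3].
have -> : f w * g w - f z * g z = f w * (g w - g z) + g z * (f w - f z) by ring.
rewrite (le_trans (le_normcD _ _))// !normcM.
have h4 : normc (f w) <= normc (f z) + 1.
  by rewrite -(subrK (f z) (f w)) (le_trans (le_normcD _ _))// addrC lerD2l.
have h5 : normc (f w) * normc (g w - g z) <= e / 2.
  rewrite (le_trans (ler_wpM2r (normc_ge0 _) h4))// mulrC -ler_pdivlMr//.
have h6 : normc (g z) * normc (f w - f z) <= e / 2 * 1.
  by apply: ler_mul_small; rewrite ?normc_ge0 ?mulr1//; lra.
lra.
Qed.

Lemma ccont_inv_sub z w : w != z -> ccont (fun u => (u - z)^-1) w.
Proof.
move=> wz; apply: cder_cont (cderV (cderB (cder_id w) (cder_cst z w)) _).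
by rewrite subr_eq0.
Qed.

(** Differentiation under the integral sign: a quadratic bound on the remainder of the kernel,
    uniform over the boundary, integrates to a quadratic bound on the remainder of the integral. *)
Lemma rectint_param_der (k : R[i] -> R[i] -> R[i]) (k' : R[i] -> R[i]) a b c d z0 (rho M : R) :
  0 < rho -> 0 <= M ->
  (forall z w, normc (z - z0) < rho -> bdry a b c d w -> ccont (k z) w) ->
  (forall w, bdry a b c d w -> ccont k' w) ->
  (forall z w, normc (z - z0) < rho -> bdry a b c d w ->
     normc (k z w - k z0 w - (z - z0) * k' w) <= M * normc (z - z0) ^+ 2) ->
  cder (fun z => rectint (k z) a b c d) z0 (rectint k' a b c d).
Proof.
move=> rho0 M0 kc k'c kM e e0.
pose S := 4 * (M * (`|b - a| + `|d - c|)).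
have S0 : 0 <= S by rewrite !mulr_ge0// addr_ge0.
have S1 : 0 < S + 1 by lra.
exists (Num.min rho (e / (S + 1))); first by rewrite lt_min rho0 divr_gt0.
move=> z; rewrite lt_min => /andP[zr ze].
have z0r : normc (z0 - z0) < rho by rewrite subrr normc0.
have cN h w : ccont h w -> ccont (fun u => - 1 * h u) w.
  by apply: ccontM; exact: cder_cont (cder_cst _ _).
have cZ h k0 w : ccont h w -> ccont (fun u => k0 * h u) w.
  by apply: ccontM; exact: cder_cont (cder_cst _ _).
have cD h1 h2 w : ccont h1 w -> ccont h2 w -> ccont (fun u => h1 u + h2 u) w.
  move=> H1 H2 e' e'0; have e'2 : 0 < e' / 2 by lra.
  have [d1 d10 {}H1] := H1 _ e'2; have [d2 d20 {}H2] := H2 _ e'2.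
  exists (Num.min d1 d2); first by rewrite lt_min d10.
  move=> v; rewrite lt_min => /andP[/H1 h3 /H2 h4].
  have -> : h1 v + h2 v - (h1 w + h2 w) = (h1 v - h1 w) + (h2 v - h2 w) by ring.
  rewrite (le_trans (le_normcD _ _))//; lra.
have -> : rectint (k z) a b c d - rectint (k z0) a b c d - (z - z0) * rectint k' a b c d =
    rectint (fun w => k z w + ((- 1) * k z0 w + (- (z - z0)) * k' w)) a b c d.
  rewrite rectintD; last 2 first.
  - by move=> w; exact: kc.
  - by move=> w hw; apply: cD; apply: cZ; [exact: kc|exact: k'c].
  rewrite rectintD; last 2 first.
  - by move=> w hw; apply: cZ; exact: kc.
  - by move=> w hw; apply: cZ; exact: k'c.
  rewrite !rectintZ; first ring.
  - exact: k'c.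
  - by move=> w; exact: kc.
rewrite (le_trans (@rectint_le R (M * normc (z - z0) ^+ 2) _ _ _ _ _ _ _))//.
- by move=> w hw; apply: (cD); [exact: kc|apply: cD; apply: cZ; [exact: kc|exact: k'c]].
- move=> w hw.
  by rewrite mulN1r mulNr addrA; exact: kM.
rewrite (_ : 4 * _ = (S * normc (z - z0)) * normc (z - z0)); last by rewrite /S; ring.
rewrite ler_wpM2r ?normc_ge0//; rewrite ltr_pdivlMr// in ze.
rewrite mulrC; have := normc_ge0 (z - z0); nra.
Qed.

Lemma normcX z n : normc (z ^+ n) = normc z ^+ n.
Proof. by elim: n => [|n IH]; rewrite ?normc1// !exprS normcM IH. Qed.

Section Kernel.
Variables (g : R[i] -> R[i]) (a b c d rho B : R) (z0 : R[i]).
Hypotheses (rho0 : 0 < rho) (B0 : 0 <= B).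
Hypothesis gc : forall w, bdry a b c d w -> ccont g w.
Hypothesis gB : forall w, bdry a b c d w -> normc (g w) <= B.
Hypothesis far : forall w, bdry a b c d w -> 2 * rho <= normc (w - z0).

Let far1 z w : normc (z - z0) < rho -> bdry a b c d w -> rho <= normc (w - z).
Proof.
move=> h /far h2; have := lerB_normc (w - z0) (z0 - z).
by rewrite (normcB z0) (_ : w - z0 + (z0 - z) = w - z); [lra|ring].
Qed.

Let far0 z w : normc (z - z0) < rho -> bdry a b c d w -> w - z != 0.
Proof. by move=> h1 h2; rewrite -normc_gt0 (lt_le_trans rho0)// far1. Qed.

Let cK z w n : normc (z - z0) < rho -> bdry a b c d w ->
  ccont (fun w => g w * (w - z)^-1 ^+ n) w.
Proof.
move=> h1 h2; apply: ccontM; first exact: gc.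
elim: n => [|n IH]; first exact: cder_cont (cder_cst 1 w).
under eq_fun do rewrite exprS.
by apply: ccontM IH; apply: ccont_inv_sub; rewrite -subr_eq0; exact: far0.
Qed.

(** The remainder equals g w (z - z0) ^ 2 / ((w - z) (w - z0) ^ 2), and both distances to w are at
    least [rho]. *)
Lemma cauchy_kernel_der1 :
  cder (fun z => rectint (fun w => g w * (w - z)^-1 ^+ 1) a b c d) z0
       (rectint (fun w => g w * (w - z0)^-1 ^+ 2) a b c d).
Proof.
have z00 : normc (z0 - z0) < rho by rewrite subrr normc0.
apply: (@rectint_param_der _ _ a b c d z0 rho (B / rho ^+ 3)) => //.
- by rewrite divr_ge0// exprn_ge0// ltW.
- by move=> z w; exact: cK.
- by move=> w; exact: cK.
move=> z w h1 h2.
have w0 := far0 z00 h2; have w1 := far0 h1 h2.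
have -> : g w * (w - z)^-1 ^+ 1 - g w * (w - z0)^-1 ^+ 1 - (z - z0) * (g w * (w - z0)^-1 ^+ 2) =
   g w * ((z - z0) ^+ 2 * ((w - z)^-1 * (w - z0)^-1 ^+ 2)) by field; rewrite w0 w1.
rewrite !(normcX, normcV, normcM) (mulrC (normc (z - z0) ^+ 2)) mulrA ler_wpM2r ?sqr_ge0//.
apply: ler_pM; rewrite ?normc_ge0 ?gB//.
  by rewrite mulr_ge0 ?exprn_ge0// invr_ge0 normc_ge0.
have r1 := far1 h1 h2; have r2 := far1 z00 h2.
have p1 : 0 < normc (w - z) by rewrite normc_gt0.
have p2 : 0 < normc (w - z0) by rewrite normc_gt0.
have -> : rho ^- 3 = rho^-1 * rho^-1 ^+ 2 by field; rewrite gt_eqF.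
by rewrite ler_pM ?exprn_ge0 ?lerXn2r ?nnegrE ?lef_pV2 ?posrE// invr_ge0 ltW.
Qed.

Lemma cauchy_kernel_der2 :
  cder (fun z => rectint (fun w => g w * (w - z)^-1 ^+ 2) a b c d) z0
       (rectint (fun w => 2 * (g w * (w - z0)^-1 ^+ 3)) a b c d).
Proof.
have z00 : normc (z0 - z0) < rho by rewrite subrr normc0.
apply: (@rectint_param_der _ _ a b c d z0 rho (B * 5 / rho ^+ 4)) => //.
- by rewrite divr_ge0 ?exprn_ge0// ?mulr_ge0// ltW.
- by move=> z w; exact: cK.
- by move=> w h; apply: ccontM; [exact: cder_cont (cder_cst _ _)|exact: cK].
move=> z w h1 h2.
have w0 := far0 z00 h2; have w1 := far0 h1 h2.
have r1 := far1 h1 h2; have r2 := far h2.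
have -> : g w * (w - z)^-1 ^+ 2 - g w * (w - z0)^-1 ^+ 2 - (z - z0) * (2 * (g w * (w - z0)^-1 ^+ 3)) =
   g w * (3 * (w - z0) - 2 * (z - z0)) * (w - z0)^-1 ^+ 3 * (w - z)^-1 ^+ 2 * (z - z0) ^+ 2.
  by field; rewrite w0 w1.
rewrite normcM [normc (_ ^+ 2)]normcX ler_wpM2r ?sqr_ge0//.
have p1 : 0 < normc (w - z) by rewrite normc_gt0.
have p2 : 0 < normc (w - z0) by rewrite normc_gt0.
(* Here |z - z0| < |w - z0|. The factor |w - z0| gained cancels one power of the cube, and four
   inverse distances remain. *)
have n1 : normc (3 * (w - z0) - 2 * (z - z0)) <= 5 * normc (w - z0).
  have n3 : normc (3 : R[i]) = 3 by rewrite (_ : 3 = 3%:C%C) ?normc_real ?ger0_norm// rmorph_nat.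
  have n2 : normc (2 : R[i]) = 2 by rewrite (_ : 2 = 2%:C%C) ?normc_real ?ger0_norm// rmorph_nat.
  by rewrite (le_trans (ler_normcB _ _))// !normcM n3 n2; lra.
rewrite !(normcX, normcV, normcM).
have -> : B * 5 / rho ^+ 4 = B * (5 * (rho ^-1 ^+ 2 * rho^-1 ^+ 2)) by field; rewrite gt_eqF.
have -> : normc (g w) * normc (3 * (w - z0) - 2 * (z - z0)) * (normc (w - z0))^-1 ^+ 3 * (normc (w - z))^-1 ^+ 2
  = normc (g w) * ((normc (3 * (w - z0) - 2 * (z - z0)) / normc (w - z0)) *
     ((normc (w - z0))^-1 ^+ 2 * (normc (w - z))^-1 ^+ 2)) by ring.
have i1 : (normc (w - z0))^-1 <= rho^-1 by rewrite lef_pV2 ?posrE//; lra.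
have i2 : (normc (w - z))^-1 <= rho^-1 by rewrite lef_pV2 ?posrE//; lra.
have j1 : 0 <= (normc (w - z0))^-1 by rewrite invr_ge0 normc_ge0.
have j2 : 0 <= (normc (w - z))^-1 by rewrite invr_ge0 normc_ge0.
have j3 : 0 <= rho^-1 by rewrite invr_ge0 ltW.
have k1 : (normc (w - z0))^-1 ^+ 2 <= rho^-1 ^+ 2 by rewrite lerXn2r.
have k2 : (normc (w - z))^-1 ^+ 2 <= rho^-1 ^+ 2 by rewrite lerXn2r.
have k3 : normc (3 * (w - z0) - 2 * (z - z0)) / normc (w - z0) <= 5 by rewrite ler_pdivrMr.
apply: ler_pM; rewrite ?normc_ge0 ?gB// ?mulr_ge0 ?exprn_ge0 ?normc_ge0//.
apply: ler_pM; rewrite ?mulr_ge0 ?exprn_ge0 ?normc_ge0//.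
by apply: ler_pM; rewrite ?exprn_ge0.
Qed.

End Kernel.

End Cauchy.

(** * The sup norm, its squares and the winding integral *)

Section SupNorm.
Variable R : realType.
Implicit Types (z w c : R[i]) (r : R).

(** The sup norm. Its balls are squares with axis-parallel sides, the shape on which rectangle
    integrals are available; it agrees with the modulus up to a factor 2. *)
Definition mn z : R := Num.max `|complex.Re z| `|complex.Im z|.

Lemma mn_ge0 z : 0 <= mn z.
Proof. by rewrite /mn le_max normr_ge0. Qed.

Lemma mn0 : mn 0 = 0.
Proof. by rewrite /mn /= normr0 maxxx. Qed.

Lemma mn_leE z r : (mn z <= r) = (`|complex.Re z| <= r) && (`|complex.Im z| <= r).
Proof. by rewrite /mn ge_max. Qed.

Lemma mn_ltE z r : (mn z < r) = (`|complex.Re z| < r) && (`|complex.Im z| < r).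
Proof. by rewrite /mn gt_max. Qed.

Lemma mnN z : mn (- z) = mn z.
Proof. by case: z => x y; rewrite /mn /= !normrN. Qed.

Lemma mnC z w : mn (z - w) = mn (w - z).
Proof. by rewrite -mnN opprB. Qed.

Lemma mnD z w : mn (z + w) <= mn z + mn w.
Proof.
rewrite mn_leE !raddfD /=.
have := lexx (mn z); have := lexx (mn w); rewrite !{1}mn_leE => /andP[? ?] /andP[? ?].
by apply/andP; split; rewrite (le_trans (ler_normD _ _))// lerD.
Qed.

Lemma mn_le_normc z : mn z <= normc z.
Proof. by rewrite mn_leE Re_le_normc Im_le_normc. Qed.

Lemma normc_le_mn z : normc z <= 2 * mn z.
Proof.
by have := lexx (mn z); rewrite {1}mn_leE => /andP[? ?]; exact: normc_le2.
Qed.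

Lemma mn_eq0 z : (mn z == 0) = (z == 0).
Proof.
apply/eqP/eqP => [h|->]; last exact: mn0.
apply/eqP; rewrite -normc_eq0 eq_le normc_ge0 andbT.
by rewrite (le_trans (normc_le_mn z))// h mulr0.
Qed.

Definition osq c r : set R[i] := [set z | mn (z - c) < r].

Lemma osq_open c r : copen (osq c r).
Proof.
move=> z zc; exists (r - mn (z - c)); first by rewrite subr_gt0.
move=> w wz; rewrite /osq /=.
have := mnD (w - z) (z - c); rewrite (_ : w - z + (z - c) = w - c); last by ring.
by have := mn_le_normc (w - z); lra.
Qed.

Lemma osq_boxlike c r : boxlike (osq c r).
Proof.
move=> z w u; rewrite /osq /= !mn_ltE !raddfB /= !ltr_norml /btw; lra.
Qed.

Definition sqint f c r := rectint f (complex.Re c - r) (complex.Re c + r)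
  (complex.Im c - r) (complex.Im c + r).

Definition sqb c r z := bdry (complex.Re c - r) (complex.Re c + r)
  (complex.Im c - r) (complex.Im c + r) z.

Lemma sqbE c r z : 0 < r -> sqb c r z -> mn (z - c) = r.
Proof.
move=> r0; rewrite /sqb /bdry !btw_le; try lra.
have h1 := ler_norm (complex.Re z - complex.Re c); have h2 := ler_norm (complex.Re c - complex.Re z).
have h3 := ler_norm (complex.Im z - complex.Im c); have h4 := ler_norm (complex.Im c - complex.Im z).
rewrite distrC in h2; rewrite distrC in h4.
move=> H; apply/eqP; rewrite eq_le; apply/andP; split.
  rewrite mn_leE !raddfB /= !ler_norml.
  by move: H => /orP[] /andP[/andP[? ?] /orP[] /eqP ?]; lra.
rewrite /mn le_max !raddfB /=.
by move: H => /orP[] /andP[/andP[? ?] /orP[] /eqP ?]; apply/orP; [right|right|left|left]; lra.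
Qed.

Lemma sqint_le M f c r : 0 < r -> (forall z, mn (z - c) = r -> ccont f z) ->
  (forall z, mn (z - c) = r -> normc (f z) <= M) -> normc (sqint f c r) <= 16 * (M * r).
Proof.
move=> r0 hf HM.
rewrite (le_trans (@rectint_le _ M _ _ _ _ _ _ _))//.
- by move=> z /(sqbE r0); exact: hf.
- by move=> z /(sqbE r0); exact: HM.
have E x : x + r - (x - r) = 2 * r by ring.
by rewrite !E gtr0_norm ?mulr_gt0//; lra.
Qed.

(** Each side contributes at least 1 to the imaginary part: on its length 2 r the integrand is, up
    to sign, r / (t ^ 2 + r ^ 2) >= 1 / (2 r). This lower bound serves wherever the exact value 2 pi
    i usually does. *)
Lemma winding_ge c r : 0 < r -> 4 <= normc (sqint (fun w => (w - c)^-1) c r).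
Proof.
move=> r0; apply: le_trans (Im_le_normc _).
set a := complex.Re c; set b := complex.Im c.
have inv x y : ((x +i* y)%C : R[i])^-1 = ((x / (x ^+ 2 + y ^+ 2)) -i* (y / (x ^+ 2 + y ^+ 2)))%C by [].
have sub x y : ((x +i* y)%C : R[i]) - c = ((x - a) +i* (y - b))%C.
  by rewrite -[X in _ - X](xy_eta c); congr Complex; rewrite /=; ring.
have nz x y : (x != a) || (y != b) -> ((x +i* y)%C : R[i]) != c.
  by rewrite -(xy_eta c) eq_complex /= negb_and.
have cH y x : y != b -> pcont (fun t => ((t +i* y)%C - c)^-1) x.
  by move=> h; apply: (@pcont_h _ (fun w => (w - c)^-1)); apply: ccont_inv_sub; rewrite nz// h orbT.
have cV x y : x != a -> pcont (fun t => ((x +i* t)%C - c)^-1) y.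
  by move=> h; apply: (@pcont_v _ (fun w => (w - c)^-1)); apply: ccont_inv_sub; rewrite nz// h.
have n1 : b - r != b by rewrite -subr_eq0 addrAC subrr add0r oppr_eq0 gt_eqF.
have n2 : b + r != b by rewrite -subr_eq0 addrAC subrr add0r gt_eqF.
have n3 : a - r != a by rewrite -subr_eq0 addrAC subrr add0r oppr_eq0 gt_eqF.
have n4 : a + r != a by rewrite -subr_eq0 addrAC subrr add0r gt_eqF.
have bd t : `|t| <= r -> (1 / (2 * r) <= r / (t ^+ 2 + r ^+ 2)).
  move=> ht; have h : t ^+ 2 <= r ^+ 2 by rewrite -(real_normK (num_real t)) lerXn2r// nnegrE ltW.
  have h2 := sqr_ge0 t; have h3 : 0 < r ^+ 2 by rewrite exprn_gt0.
  rewrite ler_pdivrMr ?mulr_gt0// mulrAC ler_pdivlMr; last lra.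
  by rewrite mul1r mulrCA -expr2; lra.
have ln : 1 / (2 * r) * (2 * r) = 1 by rewrite mul1r mulVf// mulf_neq0 ?gt_eqF// pnatr_eq0.
have E x : x + r - (x - r) = 2 * r by ring.
have H1 : 1 <= complex.Im (hint (fun w => (w - c)^-1) (a - r) (a + r) (b - r)).
  rewrite /hint /cint /= -ln -(E a); apply: rint_ge => [|x _|x xa]; first lra.
    by apply: (@pcont_Im R (fun x => ((x +i* (b - r))%C - c)^-1)); exact: cH.
  rewrite /= sub inv /= (_ : b - r - b = - r); last ring.
  by rewrite mulNr opprK sqrrN E; apply: bd; rewrite ler_norml; lra.
have H2 : complex.Im (hint (fun w => (w - c)^-1) (a - r) (a + r) (b + r)) <= - 1.
  rewrite /hint /cint /= -ln -mulNr -(E a); apply: rint_leM => [|x _|x xa]; first lra.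
    by apply: (@pcont_Im R (fun x => ((x +i* (b + r))%C - c)^-1)); exact: cH.
  rewrite /= sub inv /= (_ : b + r - b = r); last ring.
  by rewrite lerN2 E; apply: bd; rewrite ler_norml; lra.
have H3 : 1 <= complex.Re (vint (fun w => (w - c)^-1) (a + r) (b - r) (b + r)).
  rewrite /vint /cint /= -ln -(E b); apply: rint_ge => [|x _|x xa]; first lra.
    by apply: (@pcont_Re R (fun x => (((a + r) +i* x)%C - c)^-1)); exact: cV.
  rewrite /= sub inv /= (_ : a + r - a = r); last ring.
  by rewrite E (addrC (r ^+ 2)); apply: bd; rewrite ler_norml; lra.
have H4 : complex.Re (vint (fun w => (w - c)^-1) (a - r) (b - r) (b + r)) <= - 1.
  rewrite /vint /cint /= -ln -mulNr -(E b); apply: rint_leM => [|x _|x xa]; first lra.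
    by apply: (@pcont_Re R (fun x => (((a - r) +i* x)%C - c)^-1)); exact: cV.
  rewrite /= sub inv /= (_ : a - r - a = - r); last ring.
  by rewrite mulNr lerN2 sqrrN E (addrC (r ^+ 2)); apply: bd; rewrite ler_norml; lra.
rewrite (le_trans _ (ler_norm _))// /sqint /rectint -/a -/b.
move: H1 H2 H3 H4; move: (hint _ _ _ _) (hint _ _ _ _) (vint _ _ _ _) (vint _ _ _ _).
by move=> [? ?] [? ?] [? ?] [? ?] /=; lra.
Qed.

End SupNorm.

(** * Cauchy's formula and Cauchy's estimates on squares *)

Section CauchySquare.
Variable R : realType.
Implicit Types (f g h F : R[i] -> R[i]) (U : set R[i]) (z w u c l : R[i]) (r s : R).

(* [l] is meant to be the derivative of [f] at [z], which makes the singularity removable. *)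
Definition divdiff f z l w := if w == z then l else (f w - f z) / (w - z).

Lemma divdiffM f z l w : w != z -> divdiff f z l w * (w - z) = f w - f z.
Proof. by rewrite /divdiff => /[dup] wz /negbTE ->; rewrite divfK// subr_eq0. Qed.

Lemma divdiff_cont f z l : cder f z l -> ccont (divdiff f z l) z.
Proof.
move=> H e e0; have [d d0 {}H] := H e e0; exists d => // w /H; rewrite /divdiff eqxx.
have [-> _|wz] := eqVneq w z; first by rewrite subrr normc0 ltW.
have wz0 : w - z != 0 by rewrite subr_eq0.
have -> : (f w - f z) / (w - z) - l = (f w - f z - (w - z) * l) / (w - z) by field.
by rewrite normcM normcV ler_pdivrMr// normc_gt0.
Qed.

Lemma divdiff_cder f z l w : w != z -> (exists m, cder f w m) -> exists m, cder (divdiff f z l) w m.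
Proof.
move=> wz [m Hm]; have wz0 : w - z != 0 by rewrite subr_eq0.
exists (((m - 0) * (w - z) - (f w - f z) * (1 - 0)) / (w - z) ^+ 2).
have := cder_div (cderB Hm (cder_cst (f z) w)) (cderB (cder_id w) (cder_cst z w)) wz0.
apply: (@cder_ext _ _ _ _ _ (normc (w - z))); first by rewrite normc_gt0.
move=> u uw; rewrite /divdiff ifN//; apply: contraTneq uw => ->.
by rewrite normcB ltxx.
Qed.

(** The divided difference of f at z is continuous at z and holomorphic elsewhere, so its integral
    over the square vanishes. The winding integral is left unevaluated. *)
Lemma cauchy_formula U f c r z : copen U -> boxlike U -> hol U f -> 0 < r ->
  (forall w, mn (w - c) <= r -> U w) -> mn (z - c) < r ->
  sqint (fun w => f w * (w - z)^-1) c r = f z * sqint (fun w => (w - z)^-1) c r.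
Proof.
move=> oU bU hf r0 sU zr.
have Uz : U z by apply: sU; exact: ltW.
have [l Hl] := hf z Uz.
have bz w : sqb c r w -> w != z.
  by move=> /(sqbE r0) h; apply: contraTneq zr => <-; rewrite h ltxx.
have corner x y : `|x| <= r -> `|y| <= r -> U ((complex.Re c + x) +i* (complex.Im c + y))%C.
  move=> hx hy; apply: sU; rewrite mn_leE !raddfB /=.
  by rewrite !(addrC (complex.Re c)) !(addrC (complex.Im c)) !addrK hx hy.
have nr : `|r| <= r by rewrite gtr0_norm.
have nNr : `|- r| <= r by rewrite normrN.
have dc w : U w -> ccont (divdiff f z l) w.
  move=> Uw; have [->|wz] := eqVneq w z; first exact: divdiff_cont.
  by have [m /cder_cont] := @divdiff_cder f z l w wz (hf w Uw).
have := rectint_punctured bU dc (fun u Uu uz => @divdiff_cder f z l u uz (hf u Uu)) Uz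
  (corner _ _ nNr nNr) (corner _ _ nr nr).
rewrite /= -/(sqint _ c r) => I0.
have sc w : sqb c r w -> ccont (fun w => (w - z)^-1) w.
  by move=> /bz; exact: ccont_inv_sub.
have fc w : sqb c r w -> ccont f w.
  by move=> /(sqbE r0) h; apply: (hol_cont hf); apply: sU; rewrite h.
apply/eqP; rewrite -subr_eq0 -[X in _ == X]I0; apply/eqP.
rewrite -mulNr /sqint -rectintZ; last exact: sc.
rewrite -rectintD; last 2 first.
- by move=> w hw; apply: ccontM; [exact: fc|exact: sc].
- by move=> w hw; apply: ccontM; [exact: cder_cont (cder_cst _ _)|exact: sc].
apply: eq_rectint => w /bz wz; rewrite /divdiff (negbTE wz).
by ring.
Qed.

(** By Cauchy's formula f is the quotient of the Cauchy integrals [K] of f and of 1. Each of them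
    can be differentiated twice under the integral sign, so the derivative [D] of the quotient is
    again differentiable, and it equals f' near z0. *)
Lemma hol_deriv U f f' : copen U -> (forall z, U z -> cder f z (f' z)) -> hol U f'.
Proof.
move=> oU hf' z0 Uz0; have [r0 r00 Ur] := oU _ Uz0.
pose V := osq z0 (r0 / 2).
have VU z : V z -> U z.
  by move=> Vz; apply: Ur; have := normc_le_mn (z - z0); move: Vz; rewrite /V /osq /=; lra.
have hV : hol V f by move=> z /VU/hf'; exists (f' z).
pose s := r0 / 4; have s0 : 0 < s by rewrite /s; lra.
have sV z : mn (z - z0) <= s -> V z by rewrite /V /osq /s /=; lra.
have [B B0 HB] : exists2 B : R, 0 <= B & forall z, mn (z - z0) <= s -> normc (f z) <= B.
  have [||z h1 h2|B B0 HB] := @cont_bounded R f (complex.Re z0 - s) (complex.Re z0 + s)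
    (complex.Im z0 - s) (complex.Im z0 + s).
  - lra.
  - lra.
  - apply: (hol_cont hV); apply: sV; rewrite mn_leE !raddfB /= !ler_norml.
    by move: h1 h2; lra.
  exists B => // z; rewrite mn_leE !raddfB /= !ler_norml => h; apply: HB; lra.
pose K g n z := rectint (fun w => g w * (w - z)^-1 ^+ n) (complex.Re z0 - s) (complex.Re z0 + s)
    (complex.Im z0 - s) (complex.Im z0 + s).
have far z w : normc (z - z0) < s / 2 -> sqb z0 s w -> 2 * (s / 4) <= normc (w - z).
  move=> h /(sqbE s0) hw; apply: le_trans (mn_le_normc _).
  have := mnD (w - z) (z - z0); rewrite (_ : w - z + (z - z0) = w - z0); last by ring.
  by have := mn_le_normc (z - z0); lra.
have K1 g (B' : R) z : 0 <= B' -> (forall w, sqb z0 s w -> ccont g w) ->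
    (forall w, sqb z0 s w -> normc (g w) <= B') ->
    normc (z - z0) < s / 2 -> cder (K g 1%N) z (K g 2%N z) /\ exists l, cder (K g 2%N) z l.
  move=> B'0 gc gB zs; have s4 : 0 < s / 4 by lra.
  have fz w : sqb z0 s w -> 2 * (s / 4) <= normc (w - z) by exact: far.
  split; first exact: cauchy_kernel_der1 s4 B'0 gc gB fz.
  by eexists; exact: cauchy_kernel_der2 s4 B'0 gc gB fz.
have fc w : sqb z0 s w -> ccont f w.
  by move=> /(sqbE s0) h; apply: (hol_cont hV); apply: sV; rewrite h.
have fB w : sqb z0 s w -> normc (f w) <= B by move=> /(sqbE s0) h; apply: HB; rewrite h.
have oc w : sqb z0 s w -> ccont (fun=> 1) w by move=> _; exact: cder_cont (cder_cst _ _).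
have o1 w : sqb z0 s w -> normc (1 : R[i]) <= 1 by rewrite normc1.
have KN z zs := K1 f B z B0 fc fB zs.
have KW z zs := K1 (fun=> 1) 1 z ler01 oc o1 zs.
have kf z : normc (z - z0) < s / 2 -> K f 1%N z = f z * K (fun=> 1) 1%N z.
  move=> zs; have zs1 : mn (z - z0) < s by have := mn_le_normc (z - z0); lra.
  have := cauchy_formula (@osq_open R _ _) (@osq_boxlike R _ _) hV s0 sV zs1.
  rewrite /sqint /K => H; etransitivity; last (etransitivity; first exact: H).
  - by apply: eq_rectint => w _; rewrite expr1.
  - by congr (_ * _); apply: eq_rectint => w _; rewrite expr1 mul1r.
have z00 : normc (z0 - z0) < s / 2 by rewrite subrr normc0; lra.
have W0 : K (fun=> 1) 1%N z0 != 0.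
  rewrite -normc_gt0; apply: (@lt_le_trans _ _ 4) => //.
  have := @winding_ge R z0 s s0; rewrite /sqint /K => /le_trans; apply.
  rewrite le_eqVlt; apply/orP; left; apply/eqP; congr normc.
  by apply: eq_rectint => w _; rewrite expr1 mul1r.
(* The denominator is nonzero at z0 by [winding_ge], and around z0 by continuity. *)
have [d d0 Wd] : exists2 d : R, 0 < d & forall z, normc (z - z0) < d -> K (fun=> 1) 1%N z != 0.
  have [+ _] := KW _ z00; move=> /cder_cont.
  have W1 : 0 < normc (K (fun=> 1) 1%N z0) / 2 by rewrite divr_gt0// normc_gt0.
  move=> /(_ _ W1)[d d0 Hd]; exists d => // z /Hd h; apply/eqP => K0.
  by move: h; rewrite K0 sub0r normcN; have := normc_gt0 (K (fun=> 1) 1%N z0); rewrite W0; lra.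
pose rho := Num.min d (s / 2 / 2).
have rho0 : 0 < rho by rewrite lt_min d0; lra.
have rd z : normc (z - z0) < rho -> normc (z - z0) < d /\ normc (z - z0) < s / 4.
  by rewrite lt_min => /andP[? ?]; split => //; lra.
pose D z := (K f 2%N z * K (fun=> 1) 1%N z - K f 1%N z * K (fun=> 1) 2%N z) / K (fun=> 1) 1%N z ^+ 2.
have fD z : normc (z - z0) < rho -> D z = f' z.
  move=> /rd[zd zs]; have zs2 : normc (z - z0) < s / 2 by lra.
  have [N1 _] := KN z zs2; have [W1 _] := KW z zs2.
  apply: (@cder_unique _ f z); last first.
    by apply/hf'/VU; rewrite /V /osq /=; have := mn_le_normc (z - z0); rewrite /s in zs; lra.
  apply: (@cder_ext _ _ _ _ _ (Num.min (s / 4) (d - normc (z - z0)))) (cder_div N1 W1 (Wd z zd)).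
    by rewrite lt_min subr_gt0 zd; lra.
  move=> w; rewrite lt_min => /andP[h1 h2].
  have h3 : normc (w - z0) <= normc (w - z) + normc (z - z0).
    by rewrite (_ : w - z0 = (w - z) + (z - z0)) ?le_normcD//; ring.
  rewrite kf; last lra.
  by rewrite mulfK// Wd//; lra.
have [[N1 [N2 HN2]] [W1 [W2 HW2]]] := (KN z0 z00, KW z0 z00).
have K20 : K (fun=> 1) 1%N z0 ^+ 2 != 0 by rewrite expf_neq0.
eexists; apply: (@cder_ext _ D _ _ _ rho) => //.
apply: cder_div (cderB (cderM HN2 W1) (cderM N1 HW2)) (cderM W1 W1) K20.
Qed.

(** Morera's argument: the punctured form of Goursat's theorem yields a primitive on all of U, and
    f, being its derivative, is holomorphic. *)
Lemma removable U f z0 : copen U -> boxlike U -> (forall z, U z -> ccont f z) ->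
  (forall z, U z -> z != z0 -> exists l, cder f z l) -> U z0 -> hol U f.
Proof.
move=> oU bU fc hf U0.
have [F HF] := prim_of_rectint oU bU fc (rectint_punctured bU fc hf U0).
exact: hol_deriv oU HF.
Qed.

(** 4 = 16 / 4: the integral of f / (w - c) is at most 16 M in modulus, and the winding integral at
    least 4. *)
Lemma cauchy_bound U f c r M : copen U -> boxlike U -> hol U f -> 0 < r ->
  (forall w, mn (w - c) <= r -> U w) -> (forall w, mn (w - c) = r -> normc (f w) <= M) ->
  normc (f c) <= 4 * M.
Proof.
move=> oU bU hf r0 sU HM.
have c0 : mn (c - c) < r by rewrite subrr mn0.
have := cauchy_formula oU bU hf r0 sU c0; move=> /(congr1 (@normc R)); rewrite normcM.
have h1 := winding_ge c r0.
have bc w : mn (w - c) = r -> w != c.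
  by move=> h; apply/eqP => wc; move: h r0; rewrite wc subrr mn0 => <-; rewrite ltxx.
have : normc (sqint (fun w => f w * (w - c)^-1) c r) <= 16 * (M / r * r).
  apply: sqint_le => // w hw.
    apply: ccontM; last by apply/ccont_inv_sub/bc.
    by apply: (hol_cont hf); apply: sU; rewrite hw.
  have w1 : r <= normc (w - c) by rewrite -hw mn_le_normc.
  rewrite normcM normcV ler_pM ?normc_ge0 ?invr_ge0 ?normc_ge0 ?HM// lef_pV2// posrE//.
  exact: lt_le_trans w1.
rewrite divfK ?gt_eqF// => h2 h3.
have := normc_ge0 (f c); nra.
Qed.

(** This is [cauchy_bound] for the divided difference, whose value at c is l. On the boundary its
    numerator is at most M + 4 M, whence 20 = 4 * 5. *)
Lemma cauchy_bound1 U f c r M l : copen U -> boxlike U -> hol U f -> 0 < r ->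
  (forall w, mn (w - c) <= r -> U w) -> (forall w, mn (w - c) = r -> normc (f w) <= M) ->
  cder f c l -> normc l <= 20 * M / r.
Proof.
move=> oU bU hf r0 sU HM Hl.
have Uc : U c by apply: sU; rewrite subrr mn0 ltW.
have fc := cauchy_bound oU bU hf r0 sU HM.
have dh : hol U (divdiff f c l).
  apply: (@removable _ _ c) => // [z Uz|z Uz zc].
    have [->|wz] := eqVneq z c; first exact: divdiff_cont.
    by have [m /cder_cont] := @divdiff_cder f c l z wz (hf z Uz).
  exact: divdiff_cder (hf z Uz).
have : normc (divdiff f c l c) <= 4 * (5 * M / r).
  apply: (cauchy_bound oU bU dh r0 sU) => w hw.
  have wc : w != c.
    by apply/eqP => wc; move: hw r0; rewrite wc subrr mn0 => <-; rewrite ltxx.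
  have w1 : r <= normc (w - c) by rewrite -hw mn_le_normc.
  have w0 : 0 < normc (w - c) by exact: lt_le_trans w1.
  rewrite /divdiff (negbTE wc) normcM normcV ler_pM ?normc_ge0 ?invr_ge0 ?normc_ge0//.
    by rewrite (le_trans (ler_normcB _ _))//; have := HM _ hw; lra.
  by rewrite lef_pV2// posrE.
by rewrite /divdiff eqxx => /le_trans; apply; lra.
Qed.

End CauchySquare.

(** * Holomorphic logarithms *)

Section ComplexExp.
Variable R : realType.
Implicit Types (f F L : R[i] -> R[i]) (z w c : R[i]) (r : R).

Lemma is_derive_eps (h : R -> R) (x l : R) : is_derive x 1 h l ->
  forall e : R, 0 < e -> exists2 d : R, 0 < d & forall y, `|y - x| < d ->
     `|h y - h x - (y - x) * l| <= e * `|y - x|.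
Proof.
move=> [dh hl] e e0.
have : (fun t => t^-1 *: (h (t *: 1 + x) - h x)) @ 0^' --> l.
  by rewrite -hl; exact: dh.
move=> /cvgrPdist_le /(_ _ e0); rewrite /dnbhs/= near_withinE => /nbhs_norm0P[d /= d0 H].
exists d => // y yx.
have [->|nyx] := eqVneq y x; first by rewrite !subrr mul0r subr0 normr0 mulr0.
have yx0 : y - x != 0 by rewrite subr_eq0.
have := H (y - x) yx yx0; rewrite scaler1 subrK => h1.
have -> : h y - h x - (y - x) * l = (- (l - (y - x)^-1 *: (h y - h x))) * (y - x).
  by rewrite /GRing.scale/=; field.
by rewrite normrM normrN ler_wpM2r.
Qed.

Definition cexp z : R[i] := Complex (expR (complex.Re z) * cos (complex.Im z))
                             (expR (complex.Re z) * sin (complex.Im z)).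

Lemma cexpD z w : cexp (z + w) = cexp z * cexp w.
Proof.
case: z w => a b [x y]; rewrite /cexp /= expRD cosD sinD.
by congr Complex; ring.
Qed.

Lemma cexp0 : cexp 0 = 1.
Proof. by rewrite /cexp /= expR0 cos0 sin0 mulr0 mulr1. Qed.

Lemma normc_cexp z : normc (cexp z) = expR (complex.Re z).
Proof.
rewrite /cexp /normc !exprMn -mulrDr cos2Dsin2 mulr1 sqrtr_sqr ger0_norm// expR_ge0.
Qed.

Lemma cexp_neq0 z : cexp z != 0.
Proof. by rewrite -normc_gt0 normc_cexp expR_gt0. Qed.

Lemma cexp_period z : cexp (z + (0 +i* (2 * pi))%C) = cexp z.
Proof.
by rewrite cexpD /cexp /= expR0 !mul1r (mulrC 2) mulr_natr cos2pi sin2pi mulr1.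
Qed.

(** The derivatives of the real exponential, cosine and sine at 0 suffice; the addition formula
    carries the result to every other point. *)
Lemma cder_cexp0 : cder cexp 0 1.
Proof.
move=> e e0.
(* Each component is within 5 k |w| of its linear part, which makes 10 k |w| for the modulus. *)
pose k := Num.min 1 (e / 20); have k0 : 0 < k by rewrite lt_min ltr01 divr_gt0.
have [k1 ke] : k <= 1 /\ k <= e / 20 by rewrite /k !ge_min !lexx orbT.
clearbody k.
have D1 : is_derive (0 : R) 1 expR 1 by rewrite -[X in is_derive _ _ _ X]expR0; exact: is_derive_expR.
have D2 : is_derive (0 : R) 1 (@cos R) 0.
  by have := @is_derive_cos R 0; rewrite sin0 oppr0.
have D3 : is_derive (0 : R) 1 (@sin R) 1 by rewrite -[X in is_derive _ _ _ X]cos0; exact: is_derive_sin.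
have [d1 d10 H1] := is_derive_eps D1 k0.
have [d2 d20 H2] := is_derive_eps D2 k0.
have [d3 d30 H3] := is_derive_eps D3 k0.
exists (Num.min (Num.min d1 d2) (Num.min d3 k)); first by rewrite !lt_min d10 d20 d30 k0.
move=> w; rewrite subr0 !lt_min cexp0 mulr1 => /andP[/andP[w1 w2] /andP[w3 w4]].
pose x := complex.Re w; pose y := complex.Im w; set n := normc w in w1 w2 w3 w4 *.
have rw : `|x| <= n := Re_le_normc w; have iw : `|y| <= n := Im_le_normc w.
have := H1 x; have := H2 y; have := H3 y.
rewrite !subr0 expR0 cos0 sin0 !subr0 mulr0 !mulr1 subr0.
move=> /(_ (le_lt_trans iw w3)) h3 /(_ (le_lt_trans iw w2)) h2 /(_ (le_lt_trans rw w1)) h1.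
have n0 : 0 <= n by exact: normc_ge0.
have kx : k * `|x| <= k * n by rewrite ler_wpM2l// ltW.
have ky : k * `|y| <= k * n by rewrite ler_wpM2l// ltW.
have kn : k * n <= n by rewrite ler_piMl.
have ex1 : `|expR x - 1| <= 2 * n.
  by rewrite (_ : expR x - 1 = (expR x - 1 - x) + x) ?(le_trans (ler_normD _ _))//; [lra|ring].
have ex : `|expR x| <= 3.
  rewrite (_ : expR x = (expR x - 1) + 1) ?(le_trans (ler_normD _ _))//; last by ring.
  by rewrite normr1; lra.
have sy : `|sin y| <= 2 * n.
  by rewrite (_ : sin y = (sin y - y) + y) ?(le_trans (ler_normD _ _))//; [lra|ring].
have B1 : `|expR x * cos y - 1 - x| <= 4 * k * n.
  rewrite (_ : _ - x = (expR x - 1 - x) + expR x * (cos y - 1)); last by ring.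
  rewrite (le_trans (ler_normD _ _))// normrM.
  have : `|expR x| * `|cos y - 1| <= 3 * (k * n) by rewrite ler_pM// (le_trans h2).
  lra.
have B2 : `|expR x * sin y - y| <= 5 * k * n.
  rewrite (_ : _ - y = (expR x - 1) * sin y + (sin y - y)); last by ring.
  rewrite (le_trans (ler_normD _ _))// normrM.
  have : `|expR x - 1| * `|sin y| <= 2 * n * (2 * n) by rewrite ler_pM.
  have : n * n <= k * n by rewrite ler_wpM2r// ltW.
  lra.
rewrite (le_trans (normc_le2 (M := 5 * k * n) _ _))//.
- by rewrite !raddfB /= -/x -/y (le_trans B1)//; have := mulr_ge0 (ltW k0) n0; lra.
- by rewrite !raddfB /= -/x -/y subr0.
- have : k * n <= e / 20 * n by rewrite ler_wpM2r.
  by have := mulr_ge0 (ltW e0) n0; lra.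
Qed.

Lemma cder_cexp z : cder cexp z (cexp z).
Proof.
move=> e e0.
have c0 : 0 < normc (cexp z) by rewrite normc_gt0 cexp_neq0.
have [d d0 H] := cder_cexp0 (divr_gt0 e0 c0); exists d => // w wz.
have := H (w - z); rewrite subr0 => /(_ wz); rewrite cexp0 mulr1 => h.
have -> : cexp w - cexp z - (w - z) * cexp z = cexp z * (cexp (w - z) - 1 - (w - z)).
  by rewrite (_ : cexp w = cexp z * cexp (w - z)); [ring|rewrite -cexpD; congr cexp; ring].
rewrite normcM (le_trans (ler_wpM2l (normc_ge0 _) h))//.
by rewrite mulrA mulrCA divff ?gt_eqF// mulr1.
Qed.

Lemma boxlike_segment (U : set R[i]) z w (t : R) : boxlike U -> U z -> U w -> 0 <= t <= 1 ->
  U (z + t%:C%C * (w - z)).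
Proof.
move=> bU Uz Uw t01; apply: (bU z w) => //; case: z w {Uz Uw} => a b [x y] /=; rewrite /btw.
  rewrite mul0r subr0; case: (leP a x) => ?; apply/orP; [left|right]; nra.
rewrite mul0r addr0; case: (leP b y) => ?; apply/orP; [left|right]; nra.
Qed.

Lemma hol_choice (U : set R[i]) f : hol U f -> exists f', forall z, U z -> cder f z (f' z).
Proof.
move=> hf; have /choice[f' Hf'] : forall z, exists l, U z -> cder f z l.
  move=> z; have [Uz|nUz] := pselect (U z); last by exists 0.
  by have [l Hl] := hf z Uz; exists l.
by exists f'.
Qed.

(** [L] is a primitive of f' / f, and f exp(- L) has zero derivative, hence is a constant [k].
    Keeping [k] as a factor spares choosing a logarithm of it. *)
Lemma hol_log (U : set R[i]) f f' : copen U -> boxlike U ->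
  (forall z, U z -> cder f z (f' z)) -> (forall z, U z -> f z != 0) ->
  exists k L, k != 0 /\ forall z, U z -> cder L z (f' z / f z) /\ f z = k * cexp (L z).
Proof.
move=> oU bU hf f0.
have [[z0 Uz0]|nU] := pselect (exists z, U z); last first.
  by exists 1, id; split=> [|z Uz]; [exact: oner_neq0|case: nU; exists z].
have hf' := hol_deriv oU hf.
have hq : hol U (fun z => f' z / f z).
  move=> z Uz; have [l Hl] := hf' z Uz.
  by eexists; exact: cder_div Hl (hf z Uz) (f0 z Uz).
have [L HL] := hol_prim oU bU hq.
pose q z := f z * cexp (- L z).
have Hq z : U z -> cder q z 0.
  move=> Uz; apply: cder_eq (cderM (hf z Uz) (cder_comp (cderN (HL z Uz)) (cder_cexp _))) _.
  by field; exact: f0.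
have qc z : U z -> q z = q z0.
  move=> Uz; apply/eqP; rewrite -subr_eq0 -normc_eq0 eq_le normc_ge0 andbT.
  have := @cder_segment R q (fun=> 0) z0 z 0; rewrite mul0r mulr0; apply=> t t01.
    by apply: Hq; exact: boxlike_segment.
  by rewrite normc0.
exists (q z0), L; split; first by rewrite mulf_neq0 ?f0// cexp_neq0.
move=> z Uz; split; first exact: HL.
by rewrite -(qc z Uz) /q -mulrA -cexpD addrC subrr cexp0 mulr1.
Qed.

End ComplexExp.

(** * Distortion of univalent maps *)

Section Bloch.
Variable R : realType.
Implicit Types (f F L : R[i] -> R[i]) (z w c : R[i]) (r : R).

(** Twice 64 * 640 * 10 pi. The latter bounds the supremum [m] in [bloch], because m / (64 * 640) -
    2 pi cannot exceed 8 pi; the factor 2 comes from working on the square of radius r / 2. *)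
Definition bloch_const : R := (64 * 64 * 200) * pi.

(* Choosing [a] to nearly maximise (distance to the boundary) * |L'| makes [L]
   close to an affine map around [a], so that it takes the value [L a + 2 pi i]
   when that maximum is large. *)
Lemma bloch L L' c r : 0 < r -> (forall z, osq c r z -> cder L z (L' z)) ->
  (forall z w, osq c r z -> osq c r w -> L z != L w + (0 +i* (2 * pi))%C) ->
  normc (L' c) * r <= bloch_const.
Proof.
move=> r0 HL Hpi; set U := osq c r in HL Hpi.
have oU : copen U := @osq_open R c r; have bU : boxlike U := @osq_boxlike R c r.
have hL : hol U L by move=> z /HL; exists (L' z).
have hL' : hol U L' := hol_deriv oU HL.
have [L2 HL2] := hol_choice hL'.
pose s := r / 2; have s0 : 0 < s by rewrite /s; lra.
have sU z : mn (z - c) <= s -> U z by rewrite /U /osq /s /=; lra.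
have [B B0 HB] : exists2 B : R, 0 <= B & forall z, mn (z - c) <= s -> normc (L' z) <= B.
  have [||z h1 h2|B B0 HB] := @cont_bounded R L' (complex.Re c - s) (complex.Re c + s)
    (complex.Im c - s) (complex.Im c + s).
  - lra.
  - lra.
  - apply: (hol_cont hL'); apply: sU; rewrite mn_leE !raddfB /= !ler_norml.
    by move: h1 h2; lra.
  exists B => // z; rewrite mn_leE !raddfB /= !ler_norml => h; apply: HB; lra.
(* On the closed square of radius s = r / 2 the derivative is bounded, so the supremum is finite. *)
pose A := [set (s - mn (z - c)) * normc (L' z) | z in [set z | mn (z - c) <= s]].
have hsA : has_sup A.
  split; first by exists ((s - mn (c - c)) * normc (L' c)), c => //=; rewrite subrr mn0 ltW.
  exists (s * B) => _ [z /= zs <-]; apply: ler_pM; rewrite ?subr_ge0 ?normc_ge0 ?HB//.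
  by rewrite lerBlDr lerDl mn_ge0.
pose m := sup A.
have mA z : mn (z - c) <= s -> (s - mn (z - c)) * normc (L' z) <= m.
  by move=> zs; apply: ub_le_sup; [case: hsA|exists z].
have mc : s * normc (L' c) <= m by have := mA c; rewrite subrr mn0 subr0; apply; rewrite ltW.
suff Hm : m <= (64 * 64 * 100) * pi by rewrite /bloch_const; move: mc; rewrite /s; lra.
have [m0|m0] := leP m 0; first by have := @pi_gt0 R; lra.
have [_ [a /= as_ <-] ma] := sup_adherent (divr_gt0 m0 (ltr0n R 2)) hsA.
rewrite -/m in ma.
have {}ma : m / 2 < (s - mn (a - c)) * normc (L' a) by lra.
have sa : 0 < s - mn (a - c).
  rewrite lt_def subr_ge0 as_ andbT; apply: contraTneq ma => ->.
  by rewrite mul0r -leNgt ltW// divr_gt0.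
(* Within [rho] of a the distance to the boundary is still at least [rho], which gives |L'| <= m /
   rho there. *)
pose rho := (s - mn (a - c)) / 2; have rho0 : 0 < rho by rewrite /rho; lra.
have La : m / (4 * rho) <= normc (L' a).
  rewrite ler_pdivrMr ?mulr_gt0//; rewrite /rho; lra.
have acz z : mn (z - c) <= mn (z - a) + mn (a - c).
  by have := mnD (z - a) (a - c); rewrite (_ : z - a + (a - c) = z - c); [|ring].
have near_s z : mn (z - a) <= rho -> mn (z - c) <= s by have := acz z; rewrite /rho; lra.
have L1 z : mn (z - a) <= rho -> normc (L' z) <= m / rho.
  move=> za; have := mA z (near_s z za); rewrite ler_pdivlMr// => h; apply: le_trans h.
  rewrite mulrC ler_wpM2r ?normc_ge0//; have := acz z; rewrite /rho in za *; lra.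
have L2b z : mn (z - a) <= rho / 2 -> normc (L2 z) <= 40 * m / rho ^+ 2.
  move=> za.
  have za2 w : mn (w - z) <= rho / 2 -> mn (w - a) <= rho.
    by have := mnD (w - z) (z - a); rewrite (_ : w - z + (z - a) = w - a); [lra|ring].
  have rho2 : 0 < rho / 2 by lra.
  have := @cauchy_bound1 R U L' z (rho / 2) (m / rho) (L2 z) oU bU hL' rho2.
  have -> : 20 * (m / rho) / (rho / 2) = 40 * m / rho ^+ 2 by field; rewrite gt_eqF.
  apply.
  - by move=> w /za2/near_s/sU.
  - by move=> w hw; apply/L1/za2; rewrite hw.
  - by apply/HL2/sU/near_s; lra.
have seg_mn z (t : R) : 0 <= t <= 1 -> mn (a + t%:C%C * (z - a) - a) <= mn (z - a).
  move=> t01; rewrite (_ : a + _ - a = t%:C%C * (z - a)); last by ring.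
  have [h1 h2] : `|complex.Re (z - a)| <= mn (z - a) /\ `|complex.Im (z - a)| <= mn (z - a).
    by have := lexx (mn (z - a)); rewrite {1}mn_leE => /andP[].
  rewrite mn_leE; case: (z - a) h1 h2 => x y /= h1 h2.
  rewrite !mul0r subr0 addr0 !normrM (ger0_norm (_ : 0 <= t)); last lra.
  by apply/andP; split; rewrite -[leRHS]mul1r ler_pM//; lra.
have L1d z : mn (z - a) <= rho / 2 -> normc (L' z - L' a) <= 80 * m / rho ^+ 2 * normc (z - a).
  move=> za; have := @cder_segment R L' L2 a z (40 * m / rho ^+ 2).
  have -> : 2 * (40 * m / rho ^+ 2 * normc (z - a)) = 80 * m / rho ^+ 2 * normc (z - a) by ring.
  apply=> t /seg_mn ht.
    by apply/HL2/sU/near_s; apply: le_trans (ht z) _; lra.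
  by apply: L2b; apply: le_trans (ht z) za.
have m80 : 0 <= 80 * m / rho ^+ 2 by rewrite divr_ge0 ?sqr_ge0// mulr_ge0// ltW.
have m160 : 0 <= 160 * m / rho ^+ 2 by rewrite divr_ge0 ?sqr_ge0// mulr_ge0// ltW.
have Lq z : mn (z - a) <= rho / 2 ->
    normc (L z - L a - (z - a) * L' a) <= 160 * m / rho ^+ 2 * normc (z - a) ^+ 2.
  move=> za.
  have := @cder_segment R (fun w => L w - w * L' a) (fun w => L' w - L' a) a z
    (80 * m / rho ^+ 2 * normc (z - a)).
  have -> : L z - z * L' a - (L a - a * L' a) = L z - L a - (z - a) * L' a by ring.
  have -> : 2 * (80 * m / rho ^+ 2 * normc (z - a) * normc (z - a)) =
    160 * m / rho ^+ 2 * normc (z - a) ^+ 2 by ring.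
  apply=> t t01; have ht := seg_mn z t t01.
    apply: cderB; first by apply/HL/sU/near_s; lra.
    by apply: cder_eq (cderM (cder_id _) (cder_cst (L' a) _)) _; rewrite mul1r mulr0 addr0.
  apply: le_trans (L1d _ (le_trans ht za)) _.
  rewrite ler_wpM2l//.
  rewrite (_ : a + _ - a = t%:C%C * (z - a)); last by ring.
  rewrite normcM normc_real ger0_norm; last lra.
  by rewrite ler_piMl ?normc_ge0//; lra.
(* At this distance the linear term, at least m / (64 * 320), is twice the bound m / (64 * 640) on
   the quadratic error. *)
pose d := rho / (64 * 80); have d0 : 0 < d by rewrite /d; lra.
have Lfar z : mn (z - a) = d -> m / (64 * 640) <= normc (L z - L a).
  move=> zd.
  have h1 : normc (L z - L a - (z - a) * L' a) <= 640 * m / rho ^+ 2 * d ^+ 2.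
    have -> : 640 * m / rho ^+ 2 * d ^+ 2 = 160 * m / rho ^+ 2 * (2 * d) ^+ 2 by ring.
    apply: le_trans (Lq z _) _; first by rewrite zd /d; lra.
    rewrite ler_wpM2l//.
    by rewrite lerXn2r ?nnegrE ?normc_ge0// -?zd ?normc_le_mn// mulr_ge0// mn_ge0.
  have h2 : m / (4 * rho) * d <= normc ((z - a) * L' a).
    rewrite normcM mulrC; apply: ler_pM => //; [exact: ltW| |by rewrite -zd mn_le_normc].
    by rewrite divr_ge0 ?mulr_ge0// ltW.
  have e1 : 640 * m / rho ^+ 2 * d ^+ 2 = m / (64 * 640) by rewrite /d; field; rewrite gt_eqF.
  have e2 : m / (4 * rho) * d = m / (64 * 320) by rewrite /d; field; rewrite gt_eqF.
  have := lerB_normc ((z - a) * L' a) (L z - L a - (z - a) * L' a).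
  rewrite (_ : (z - a) * L' a + _ = L z - L a); last by ring.
  rewrite e1 in h1; rewrite e2 in h2; lra.
have p0 := @pi_gt0 R.
rewrite leNgt; apply/negP => mbig.
(* L omits [v], so 1 / (L - v) is holomorphic. It has modulus 1 / (2 pi) at a and at most 1 / N on
   the square of radius [d], with N > 8 pi, against the factor 4 of [cauchy_bound]. *)
pose v := L a + (0 +i* (2 * pi))%C.
have Ua : U a by apply: sU.
have gv z : U z -> L z - v != 0 by move=> Uz; rewrite subr_eq0; exact: Hpi.
have hg : hol U (fun z => (L z - v)^-1).
  move=> z Uz; eexists; exact: cderV (cderB (HL z Uz) (cder_cst v z)) (gv z Uz).
have nv : normc (L a - v) = 2 * pi.
  rewrite (_ : L a - v = (0 +i* (2 * pi))%C * - 1); last by rewrite /v; ring.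
  rewrite normcM normcN normc1 mulr1 /= expr0n /= add0r sqrtr_sqr ger0_norm//.
  by rewrite mulr_ge0// ltW.
pose N := m / (64 * 640) - 2 * pi; have N0 : 8 * pi < N by rewrite /N; lra.
have Npos : 0 < N by lra.
have := @cauchy_bound R U (fun z => (L z - v)^-1) a d N^-1 oU bU hg d0.
rewrite /= normcV nv => H.
have {H} : (2 * pi)^-1 <= 4 * N^-1.
  apply: H => w wd; first by apply/sU/near_s; rewrite /d in wd; lra.
  rewrite normcV lef_pV2 ?posrE//; last first.
    by rewrite normc_gt0; apply/gv/sU/near_s; rewrite wd /d; lra.
  have := lerB_normc (L w - L a) (L a - v); rewrite nv.
  rewrite (_ : L w - L a + _ = L w - v); last by ring.
  by have := Lfar w wd; rewrite /N; lra.
rewrite ler_pdivlMr// mulrC ler_pdivrMr ?mulr_gt0//; lra.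
Qed.

(* Injectivity of [f = k exp L] prevents [L] from taking two values that differ
   by 2 pi i. *)
Lemma univalent_logderiv f f' c r : 0 < r -> (forall z, osq c r z -> cder f z (f' z)) ->
  (forall z w, osq c r z -> osq c r w -> f z = f w -> z = w) ->
  (forall z, osq c r z -> f z != 0) -> normc (f' c) * r <= bloch_const * normc (f c).
Proof.
move=> r0 hf finj f0; have Uc : osq c r c by rewrite /osq /= subrr mn0.
have [k [L [k0 HL]]] := hol_log (@osq_open R c r) (@osq_boxlike R c r) hf f0.
have := @bloch L (fun z => f' z / f z) c r r0.
have h1 : forall z, osq c r z -> cder L z (f' z / f z) by move=> z /HL[].
have h2 : forall z w, osq c r z -> osq c r w -> L z != L w + (0 +i* (2 * pi))%C.
  move=> z w Uz Uw; apply/eqP => Lzw.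
  have zw : z = w.
    apply: finj => //; have [_ ->] := HL z Uz; have [_ ->] := HL w Uw.
    by rewrite Lzw cexp_period.
  move: Lzw; rewrite zw => /(congr1 (fun u => complex.Im (u - L w))).
  rewrite addrAC subrr add0r /= => /eqP; rewrite eq_sym mulf_eq0 pnatr_eq0 /=.
  by have := @pi_gt0 R; case: eqP => // ->; rewrite ltxx.
move=> /(_ h1 h2); rewrite normcM normcV mulrAC ler_pdivrMr// normc_gt0; exact: f0.
Qed.

Lemma gronwall (h dh : R -> R) (k : R) : (forall t : R, 0 <= t <= 1 -> is_derive t 1 h (dh t)) ->
  (forall t : R, 0 <= t <= 1 -> dh t <= k * h t) -> h 1 <= expR k * h 0.
Proof.
move=> Hh Hk.
pose g t := h t * expR (- k * t).
have Hg (t : R) : 0 <= t <= 1 -> is_derive t 1 g (dh t * expR (- k * t) + h t * (expR (- k * t) * - k)).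
  move=> t01; have D1 : is_derive t 1 (fun t => - k * t) (- k).
    have -> : (fun t : R => - k * t) = (- k) \*: id by apply/funext.
    by apply: is_derive_eq; rewrite /GRing.scale/= mulr1.
  have D2 : is_derive t 1 (fun t => expR (- k * t)) (expR (- k * t) * - k).
    have := @is_derive1_comp R expR (fun t => - k * t) t _ _ (is_derive_expR _) D1.
    by rewrite mulrC.
  have := @is_deriveM _ _ _ _ _ _ _ _ (Hh t t01) D2.
  move=> H; apply: is_derive_eq H _; rewrite /GRing.scale /=; ring.
have := @mvt_le R g _ 0 1 0 ler01 Hg.
have H0 : forall t, 0 <= t <= 1 -> dh t * expR (- k * t) + h t * (expR (- k * t) * - k) <= 0.
  move=> t t01; have := Hk t t01; have := expR_gt0 (- k * t); nra.
move=> /(_ H0); rewrite /g mulr0 expR0 !mulr1 mul0r subr_le0 expRN.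
by rewrite ler_pdivrMr ?expR_gt0// mulrC.
Qed.

(** Gronwall's inequality is applied to |F| ^ 2, which is differentiable even at zeros of F. Its
    exponent is 2 k by the Cauchy-Schwarz inequality, and k is left after the square root. *)
Lemma gronwall_segment F F' z w (k : R) :
  (forall t : R, 0 <= t <= 1 -> cder F (z + t%:C%C * (w - z)) (F' (z + t%:C%C * (w - z)))) ->
  (forall t : R, 0 <= t <= 1 -> normc (F' (z + t%:C%C * (w - z))) * normc (w - z) <=
     k * normc (F (z + t%:C%C * (w - z)))) ->
  normc (F w) <= expR k * normc (F z).
Proof.
move=> HF Hk.
pose p t := z + t%:C%C * (w - z).
pose h t := normc (F (p t)) ^+ 2.
pose u t := complex.Re (F (p t)); pose v t := complex.Im (F (p t)).
pose du t := complex.Re ((w - z) * F' (p t)); pose dv t := complex.Im ((w - z) * F' (p t)).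
have p0 : p 0 = z by rewrite /p mul0r addr0.
have p1 : p 1 = w by rewrite /p mul1r addrC subrK.
have : h 1 <= expR (2 * k) * h 0.
  apply: (@gronwall h (fun t => 2 * (u t * du t + v t * dv t))) => t t01.
    have -> : h = u * u + v * v.
      by apply/funext => s; rewrite /h normc_sqr !expr2.
    have Du : is_derive t 1 u (du t) by exact: cder_path_Re (HF t t01).
    have Dv : is_derive t 1 v (dv t) by exact: cder_path_Im (HF t t01).
    have := is_deriveD (is_deriveM Du Du) (is_deriveM Dv Dv).
    by move=> H; apply: is_derive_eq H _; rewrite /GRing.scale /=; ring.
  have hk := Hk t t01; rewrite -/(p t) in hk.
  have CS : u t * du t + v t * dv t <= normc (F (p t)) * normc ((w - z) * F' (p t)).
    apply: (le_trans (ler_norm _)).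
    rewrite -(ler_pXn2r (n := 2)) ?nnegrE ?mulr_ge0 ?normc_ge0// real_normK ?num_real//.
    rewrite exprMn !normc_sqr -/(u t) -/(v t) -/(du t) -/(dv t).
    rewrite -subr_ge0 (_ : _ - _ = (u t * dv t - v t * du t) ^+ 2) ?sqr_ge0//; ring.
  rewrite normcM (mulrC (normc (w - z))) in CS.
  have := ler_wpM2l (normc_ge0 (F (p t))) hk; rewrite /h expr2; lra.
rewrite /h p0 p1 expRM_natl -exprMn.
by rewrite ler_pXn2r// ?nnegrE ?mulr_ge0 ?normc_ge0 ?expR_ge0.
Qed.

(** 640 = 2 * 2 * 20 * 8: the factors come from f'' c = 2 q' c, from r = 2 s, from Cauchy's estimate
    and from the bound on |q|. The exponential is the comparison factor between a boundary point and
    a corner, taken twice. *)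
Definition distortion_const : R := 640 * expR (8 * bloch_const).

Lemma bloch_const_gt0 : 0 < bloch_const.
Proof. by rewrite /bloch_const !mulr_gt0// pi_gt0. Qed.

Lemma distortion_const_gt0 : 0 < distortion_const.
Proof. by apply: mulr_gt0; [rewrite ltr0n|exact: expR_gt0]. Qed.

(* [F = f - f c] has no zero near the square of radius [r / 2] around [c], so
   [univalent_logderiv] bounds F' / F there and |F| is comparable at any two
   points of that square. Cauchy's estimates, applied to q = F / (z - c) and to
   1 / q, whose values at [c] are [f' c] and its inverse, then bound f'' c = 2 q' c. *)
Lemma distortion f f' l2 c r : 0 < r -> (forall z, osq c r z -> cder f z (f' z)) ->
  (forall z w, osq c r z -> osq c r w -> f z = f w -> z = w) ->
  f' c != 0 -> cder f' c l2 -> normc l2 * r <= distortion_const * normc (f' c).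
Proof.
move=> r0 hf finj fc0 hl2; set U := osq c r in hf finj.
have oU : copen U := @osq_open R c r; have bU : boxlike U := @osq_boxlike R c r.
have hU : hol U f by move=> z /hf; exists (f' z).
have Uc : U c by rewrite /U /osq /= subrr mn0.
pose s := r / 2; have s0 : 0 < s by rewrite /s; lra.
have sU z : mn (z - c) <= s -> U z by rewrite /U /osq /s /=; lra.
pose F z := f z - f c.
have HF z : U z -> cder F z (f' z).
  by move=> Uz; apply: cder_eq (cderB (hf z Uz) (cder_cst (f c) z)) _; rewrite subr0.
have F0 z : U z -> z != c -> F z != 0.
  by move=> Uz zc; rewrite subr_eq0; apply: contra_neq zc; exact: finj.
(* Centred on the boundary of the square of radius s, a square of radius s stays inside [U] and just
   misses c, the only zero of [F]. *)
have logF z : mn (z - c) = s -> normc (f' z) * s <= bloch_const * normc (F z).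
  move=> zs.
  have sub w : osq z s w -> U w.
    rewrite /osq /U /= /osq /= => ws; have := mnD (w - z) (z - c).
    by rewrite (_ : w - z + (z - c) = w - c) ?zs; [rewrite /s in ws *; lra|ring].
  apply: univalent_logderiv => //.
  - by move=> w /sub; exact: HF.
  - by move=> u w /sub hu /sub hw /addIr; exact: finj.
  - move=> w hw; apply: F0; first exact: sub.
    by apply: contraTneq hw => ->; rewrite /osq /= mnC zs ltxx.
(* On a side, of length at most 2 s, |F'| / |F| <= bloch_const / s; hence |F| varies by a factor of
   at most exp k. *)
pose k := 2 * bloch_const.
have side z w : (forall t : R, 0 <= t <= 1 -> mn (z + t%:C%C * (w - z) - c) = s) ->
    normc (w - z) <= 2 * s -> normc (F w) <= expR k * normc (F z).
  move=> hs zw; apply: (@gronwall_segment F f') => t t01.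
    by apply/HF/sU; rewrite hs.
  have := logF _ (hs t t01); move: (normc_ge0 (f' (z + t%:C%C * (w - z)))).
  rewrite /k; have := bloch_const_gt0; nra.
pose P x y := c + (x +i* y)%C.
have Pm x y : mn (P x y - c) = Num.max `|x| `|y|.
  by rewrite /P (_ : c + _ - c = (x +i* y)%C); last by ring.
have side_v x y y' : `|x| = s -> `|y| <= s -> `|y'| <= s ->
    normc (F (P x y')) <= expR k * normc (F (P x y)).
  move=> xs ys ys'.
  have E : P x y' - P x y = 'i%C * (y' - y)%:C%C.
    by rewrite /P (_ : c + _ - _ = (x +i* y')%C - (x +i* y)%C); [congr Complex; rewrite /=|]; ring.
  apply: side => [t t01|].
    rewrite E (_ : P x y + _ = P x (y + t * (y' - y))).
      rewrite Pm xs; apply/max_idPl; move: ys ys'; rewrite !ler_norml => ? ?; nra.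
    by rewrite /P -addrA; congr (_ + _); congr Complex; rewrite /=; ring.
  rewrite E normcM normc_i mul1r normc_real.
  by rewrite (le_trans (ler_normB _ _))//; lra.
have side_h x x' y : `|y| = s -> `|x| <= s -> `|x'| <= s ->
    normc (F (P x' y)) <= expR k * normc (F (P x y)).
  move=> xs ys ys'.
  have E : P x' y - P x y = (x' - x)%:C%C.
    by rewrite /P (_ : c + _ - _ = (x' +i* y)%C - (x +i* y)%C); [congr Complex; rewrite /=|]; ring.
  apply: side => [t t01|].
    rewrite E (_ : P x y + _ = P (x + t * (x' - x)) y).
      rewrite Pm xs; apply/max_idPr; move: ys ys'; rewrite !ler_norml => ? ?; nra.
    by rewrite /P -addrA; congr (_ + _); congr Complex; rewrite /=; ring.
  rewrite E normc_real.
  by rewrite (le_trans (ler_normB _ _))//; lra.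
have ns : `|s| = s by rewrite gtr0_norm.
(* A boundary point is joined to the corner along two segments of the boundary, each costing a
   factor exp k. *)
have comp z : mn (z - c) = s -> normc (F z) <= expR k * (expR k * normc (F (P s s))) /\
    normc (F (P s s)) <= expR k * (expR k * normc (F z)).
  pose x := complex.Re (z - c); pose y := complex.Im (z - c).
  have -> : z = P x y by rewrite /P /x /y xy_eta; ring.
  rewrite Pm => xys; have [xs ys] : `|x| <= s /\ `|y| <= s.
    by rewrite -xys !le_max !lexx orbT.
  have ek := expR_ge0 k.
  move: xys; rewrite /Num.max; case: ifP => _ es; split.
  - by apply: (le_trans (side_h s x y _ _ _)); rewrite ?ns// ler_wpM2l// side_v// ns.
  - by apply: (le_trans (side_v s y s _ _ _)); rewrite ?ns// ler_wpM2l// side_h// ns.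
  - by apply: (le_trans (side_v x s y _ _ _)); rewrite ?ns// ler_wpM2l// side_h// ns.
  - by apply: (le_trans (side_h x s s _ _ _)); rewrite ?ns// ler_wpM2l// side_v// ns.
have Ps : mn (P s s - c) = s by rewrite Pm ns maxxx.
have UPs : U (P s s) by apply: sU; rewrite Ps.
have PF0 : 0 < normc (F (P s s)).
  by rewrite normc_gt0 F0// -subr_eq0 -mn_eq0 Ps gt_eqF.
pose q := divdiff f c (f' c).
have qc : q c = f' c by rewrite /q /divdiff eqxx.
have qE z : z != c -> q z = F z / (z - c) by rewrite /q /divdiff => /negbTE ->.
have hq : hol U q.
  apply: (@removable _ _ _ c) => // [z Uz|z Uz zc]; last exact: divdiff_cder (hU z Uz).
  have [->|wz] := eqVneq z c; first by apply: divdiff_cont; exact: hf.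
  by have [m /cder_cont] := @divdiff_cder _ f c (f' c) z wz (hU z Uz).
have q0 z : U z -> q z != 0.
  move=> Uz; have [->|wz] := eqVneq z c; first by rewrite qc.
  by rewrite qE// mulf_neq0 ?F0// invr_eq0 subr_eq0.
have sc z : mn (z - c) = s -> z != c by move=> h; rewrite -subr_eq0 -mn_eq0 h gt_eqF.
set A := expR k * expR k.
have A0 : 0 < A by rewrite mulr_gt0 ?expR_gt0.
have lc0 : 0 < normc (f' c) by rewrite normc_gt0.
(* Cauchy's bound for 1 / q turns the size of F at the corner into a lower bound on |f' c|. *)
have B1 : normc (F (P s s)) <= 8 * s * A * normc (f' c).
  have hqi : hol U (fun z => (q z)^-1).
    by move=> z Uz; have [m Hm] := hq z Uz; eexists; exact: cderV Hm (q0 z Uz).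
  have := @cauchy_bound _ U (fun z => (q z)^-1) c s (2 * s * A / normc (F (P s s))) oU bU hqi s0 sU.
  rewrite qc normcV => H.
  have {H} : (normc (f' c))^-1 <= 4 * (2 * s * A / normc (F (P s s))).
    apply: H => z zs; rewrite (qE _ (sc z zs)) invf_div normcM normcV.
    have [_ h] := comp z zs; rewrite mulrA -/A in h.
    have Uz : U z by apply: sU; rewrite zs.
    have Fz : 0 < normc (F z) by rewrite normc_gt0 F0 ?sc.
    rewrite ler_pdivrMr// (_ : _ * normc (F z) = 2 * s * (A * normc (F z) / normc (F (P s s)))); last by ring.
    apply: (le_trans (normc_le_mn _)); rewrite zs ler_peMr//; first by rewrite mulr_ge0// ltW.
    by rewrite ler_pdivlMr// mul1r.
  rewrite mulrA ler_pdivlMr// mulrC ler_pdivrMr//; lra.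
have B2 z : mn (z - c) = s -> normc (q z) <= 8 * A ^+ 2 * normc (f' c).
  move=> zs; have [h _] := comp z zs; rewrite mulrA -/A in h.
  have zc : s <= normc (z - c) by rewrite -{1}zs mn_le_normc.
  rewrite (qE _ (sc z zs)) normcM normcV ler_pdivrMr; last exact: lt_le_trans zc.
  apply: (le_trans h); apply: (le_trans (ler_wpM2l (ltW A0) B1)).
  rewrite (_ : A * _ = 8 * A ^+ 2 * normc (f' c) * s); last by ring.
  by rewrite ler_wpM2l// !mulr_ge0 ?normc_ge0 ?sqr_ge0.
have [q' Hq'] := hol_choice hq.
have [q2 Hq2] := hol_choice (hol_deriv oU Hq').
have B3 := cauchy_bound1 oU bU hq s0 sU B2 (Hq' c Uc).
have f'E z : U z -> f' z = q z + (z - c) * q' z.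
  move=> Uz; apply: (cder_unique (HF z Uz)).
  have H := cderM (cderB (cder_id z) (cder_cst c z)) (Hq' z Uz).
  apply: (@cder_ext _ (fun w => (w - c) * q w) _ _ _ 1) => //.
    move=> w _; have [->|wc] := eqVneq w c; first by rewrite subrr mul0r /F subrr.
    by rewrite mulrC divdiffM.
  by apply: cder_eq H _; ring.
(* Differentiating F = (z - c) q twice at c. *)
have l2E : l2 = 2 * q' c.
  apply: (cder_unique hl2); have [d d0 Hd] := oU c Uc.
  apply: (@cder_ext _ (fun z => q z + (z - c) * q' z) _ _ _ d) => // [w /Hd/f'E->//|].
  have := cderD (Hq' c Uc) (cderM (cderB (cder_id c) (cder_cst c c)) (Hq2 c Uc)).
  by move=> H; apply: cder_eq H _; ring.
have n2 : normc (2 : R[i]) = 2 by rewrite (_ : 2 = 2%:C%C) ?normc_real ?ger0_norm// rmorph_nat.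
rewrite l2E normcM n2.
have -> : distortion_const = 640 * A ^+ 2.
  by rewrite /distortion_const /A -!expRD -expRM_natl /k; congr (_ * expR _); ring.
rewrite ler_pdivlMr// in B3; rewrite /s in B3; lra.
Qed.

(** Where f' does not vanish, [distortion] bounds |f''| by a multiple of |f'|. The bound extends to
    the zeros of f': a simple zero would violate it at neighbouring points. Gronwall's inequality
    then spreads a zero of f' to a whole square, where f would be constant. *)
Lemma univalent_deriv_neq0 (U : set R[i]) f f' : copen U -> (forall z, U z -> cder f z (f' z)) ->
  (forall z w, U z -> U w -> f z = f w -> z = w) -> forall z, U z -> f' z != 0.
Proof.
move=> oU hf finj z0 Uz0; apply/eqP => fz0.
have hf' : hol U f' := hol_deriv oU hf.
have [f2 hf2] := hol_choice hf'.
have [f3 hf3] := hol_choice (hol_deriv oU hf2).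
have [d d0 Hd] := oU z0 Uz0.
pose r := d / 4; have r0 : 0 < r by rewrite /r; lra.
have sub z w : osq z0 r z -> osq z r w -> U w.
  rewrite /osq /= => h1 h2; apply: Hd; apply: le_lt_trans (normc_le_mn _) _.
  have := mnD (w - z) (z - z0); rewrite (_ : w - z + (z - z0) = w - z0); last by ring.
  by rewrite /r in h1 h2; lra.
have subz z : osq z0 r z -> U z by move=> h; apply: (sub z z h); rewrite /osq /= subrr mn0.
have D0 := distortion_const_gt0.
have bnd z : osq z0 r z -> f' z != 0 -> normc (f2 z) * r <= distortion_const * normc (f' z).
  move=> hz fz; apply: (@distortion f f' (f2 z) z r r0) => //.
  - by move=> w /(sub z w hz)/hf.
  - by move=> u w /(sub z u hz) hu /(sub z w hz) hw; exact: finj.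
  - exact/hf2/subz.
have bnd0 z : osq z0 r z -> f' z = 0 -> f2 z = 0.
  move=> hz fz; apply/eqP; rewrite -normc_eq0 eq_le normc_ge0 andbT leNgt; apply/negP => n0.
  set n := normc (f2 z) in n0.
  have n20 : 0 < n / 2 by lra.
  have [d1 d10 H1] := hf2 z (subz z hz) _ n20.
  have [d2 d20 H2] := cder_cont (hf3 z (subz z hz)) n20.
  have [d3 d30 H3] := @osq_open R z0 r z hz.
  (* The first three bounds give |f' w| <= 2 t n, |f2 w| >= n / 2 and w in the square; the last
     makes t too small for [bnd] to hold at w. *)
  pose t := Num.min (Num.min (d1 / 2) (d2 / 2)) (Num.min (d3 / 2) (r / (8 * distortion_const))).
  have t0 : 0 < t by rewrite !lt_min !divr_gt0// mulr_gt0.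
  have [t1 t2 t3 t4] : [/\ t <= d1 / 2, t <= d2 / 2, t <= d3 / 2 & t <= r / (8 * distortion_const)].
    by split; rewrite /t !ge_min lexx ?orbT.
  clearbody t; pose w := z + t%:C%C.
  have wz : w - z = t%:C%C by rewrite /w addrC addKr.
  have nt : normc (w - z) = t by rewrite wz normc_real gtr0_norm.
  have h1 := H1 w; have h2 := H2 w; have h3 := H3 w; rewrite nt in h1 h2 h3.
  have {}h1 := h1 ltac:(lra); have {}h2 := h2 ltac:(lra); have {}h3 := h3 ltac:(lra).
  rewrite fz subr0 in h1.
  have ntf : normc ((w - z) * f2 z) = t * n by rewrite normcM nt.
  have a1 : t * n / 2 <= normc (f' w).
    have := lerB_normc ((w - z) * f2 z) (f' w - (w - z) * f2 z).
    by rewrite (_ : (w - z) * f2 z + _ = f' w) ?ntf; [lra|ring].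
  have a2 : normc (f' w) <= 2 * t * n.
    by rewrite -(subrK ((w - z) * f2 z) (f' w)) (le_trans (le_normcD _ _))// ntf; nra.
  have a3 : n / 2 <= normc (f2 w).
    by have := lerB_normc (f2 z) (f2 w - f2 z); rewrite (_ : f2 z + _ = f2 w) -/n; [lra|ring].
  have fw : f' w != 0.
    by rewrite -normc_gt0 (lt_le_trans _ a1)// divr_gt0// mulr_gt0.
  have a4 := bnd w h3 fw.
  have a5 : t * (8 * distortion_const) <= r by rewrite -ler_pdivlMr// mulr_gt0.
  have : distortion_const * normc (f' w) <= distortion_const * (2 * t * n) by rewrite ler_pM2l.
  have : n / 2 * r <= normc (f2 w) * r by rewrite ler_pM2r.
  have : t * (8 * distortion_const) * n <= r * n by rewrite ler_pM2r.
  by have := mulr_gt0 r0 n0; lra.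
have bnd2 z : osq z0 r z -> normc (f2 z) <= distortion_const / r * normc (f' z).
  move=> hz; have [fz|fz] := eqVneq (f' z) 0; first by rewrite bnd0// fz !normc0 mulr0.
  by rewrite mulrAC ler_pdivlMr// bnd.
have seg w (t : R) : osq z0 r w -> 0 <= t <= 1 -> osq z0 r (z0 + t%:C%C * (w - z0)).
  move=> hw t01; apply: boxlike_segment => //; first exact: osq_boxlike.
  by rewrite /osq /= subrr mn0.
have f'0 w : osq z0 r w -> f' w = 0.
  move=> hw; apply/eqP; rewrite -normc_eq0 eq_le normc_ge0 andbT.
  have := @gronwall_segment f' f2 z0 w (distortion_const / r * normc (w - z0)).
  rewrite fz0 normc0 mulr0; apply=> t t01.
    exact/hf2/subz/seg.
  rewrite mulrAC ler_wpM2r ?normc_ge0//; exact/bnd2/seg.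
have r2 : r / 2 < r by lra.
have r20 : 0 < r / 2 by lra.
pose w := z0 + (r / 2)%:C%C.
have wz : w - z0 = (r / 2)%:C%C by rewrite /w addrC addKr.
have hw : osq z0 r w.
  by rewrite /osq /= wz mn_ltE /= normr0 gtr0_norm ?r20// r2 r0.
have fw : f w = f z0.
  apply/eqP; rewrite -subr_eq0 -normc_eq0 eq_le normc_ge0 andbT.
  have := @cder_segment R f f' z0 w 0; rewrite mul0r mulr0; apply=> t t01.
    exact/hf/subz/seg.
  by rewrite f'0 ?normc0//; exact: seg.
have : w = z0 by apply: finj => //; exact: subz.
move=> /eqP; rewrite -subr_eq0 wz -normc_eq0 normc_real normr_eq0.
by rewrite gt_eqF// divr_gt0.
Qed.

End Bloch.

(** * Boundary values of the primitive of a Bloch function *)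

Section BlochFunction.
Variable R : realType.
Variables (g g' G : R[i] -> R[i]) (K : R).
Hypothesis K0 : 0 <= K.
Hypothesis hg : forall z, 0 < complex.Im z -> cder g z (g' z).
Hypothesis hG : forall z, 0 < complex.Im z -> cder G z (g z).
Hypothesis gK : forall z, 0 < complex.Im z -> normc (g' z) * complex.Im z <= K.
Implicit Types (z w : R[i]) (a b x y l m t : R).

Let Im_seg z w m t : m <= complex.Im z -> m <= complex.Im w -> 0 <= t <= 1 ->
  m <= complex.Im (z + t%:C%C * (w - z)).
Proof. by case: z w => a b [c d] /=; rewrite mul0r addr0 => ? ? ?; nra. Qed.

Lemma bloch_lip m z w : 0 < m -> m <= complex.Im z -> m <= complex.Im w ->
  normc (g w - g z) <= 2 * (K / m * normc (w - z)).
Proof.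
move=> m0 mz mw; apply: (@cder_segment _ g g') => t t01; have h := Im_seg mz mw t01.
  by apply: hg; exact: lt_le_trans h.
have := gK (lt_le_trans m0 h) => h2; rewrite ler_pdivlMr//; apply: le_trans h2.
by rewrite ler_wpM2l// normc_ge0.
Qed.

Lemma prim_taylor m z w : 0 < m -> m <= complex.Im z -> m <= complex.Im w ->
  normc (G w - G z - (w - z) * g z) <= 4 * (K / m * normc (w - z) ^+ 2).
Proof.
move=> m0 mz mw.
have := @cder_segment _ (fun w => G w - w * g z) (fun w => g w - g z) z w
  (2 * (K / m * normc (w - z))).
rewrite (_ : G w - w * g z - _ = G w - G z - (w - z) * g z); last by ring.
rewrite (_ : 2 * (2 * (K / m * normc (w - z)) * normc (w - z)) = 4 * (K / m * normc (w - z) ^+ 2)); last by ring.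
apply=> t t01; have h := Im_seg mz mw t01.
  have h0 := lt_le_trans m0 h.
  apply: cder_eq (cderB (hG h0) (cderM (cder_id _) (cder_cst (g z) _))) _.
  by rewrite mul1r mulr0 addr0.
apply: (le_trans (bloch_lip m0 mz h)); rewrite ler_wpM2l// ler_wpM2l ?divr_ge0 ?(ltW m0)//.
rewrite (_ : z + _ - z = t%:C%C * (w - z)); last by ring.
by rewrite normcM normc_real ger0_norm ?ler_piMl ?normc_ge0//; lra.
Qed.

(* [G] minus its first-order variation down to the real line; it has a limit as
   [l] tends to 0 because [G] is Zygmund-smooth up to the boundary. *)
Definition descent x l : R := complex.Re (G (x +i* l)%C - (0 +i* l)%C * g (x +i* l)%C).

Lemma descent_half x l t : 0 < l -> l / 2 <= t <= l ->
  `|descent x t - descent x l| <= 4 * (K * l).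
Proof.
move=> l0 tl; set z := (x +i* l)%C; set w := (x +i* t)%C.
have m0 : 0 < l / 2 by lra.
have wz : w - z = 'i%C * (t - l)%:C%C by congr Complex; rewrite /=; ring.
have nwz : normc (w - z) <= l / 2.
  by rewrite wz normcM normc_i mul1r normc_real ler_norml; lra.
have h1 := @prim_taylor (l / 2) z w m0 ltac:(rewrite /z /=; lra) ltac:(rewrite /w /=; lra).
have h2 := @bloch_lip (l / 2) z w m0 ltac:(rewrite /z /=; lra) ltac:(rewrite /w /=; lra).
have -> : descent x t - descent x l =
  complex.Re (G w - G z - (w - z) * g z - ('i%C * t%:C%C) * (g w - g z)).
  rewrite /descent -raddfB; congr complex.Re; rewrite wz.
  have -> : ((0 +i* t)%C : R[i]) = 'i%C * t%:C%C by congr Complex; rewrite /=; ring.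
  have -> : ((0 +i* l)%C : R[i]) = 'i%C * l%:C%C by congr Complex; rewrite /=; ring.
  by rewrite rmorphB; ring.
apply: (le_trans (Re_le_normc _)); apply: (le_trans (ler_normcB _ _)).
rewrite !normcM normc_i mul1r normc_real ger0_norm; last lra.
have E : K / (l / 2) * (l / 2) = K by field; rewrite gt_eqF.
have kl : 0 <= K / (l / 2) by rewrite divr_ge0// ltW.
have h3 : K / (l / 2) * normc (w - z) <= K by rewrite -[leRHS]E ler_wpM2l.
have h4 : K / (l / 2) * normc (w - z) ^+ 2 <= K * (l / 2).
  rewrite (_ : K / (l / 2) * normc (w - z) ^+ 2 = K / (l / 2) * normc (w - z) * normc (w - z)); last by ring.
  by apply: ler_pM; rewrite ?normc_ge0// mulr_ge0 ?normc_ge0.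
have h5 : t * normc (g w - g z) <= l * (2 * K).
  by apply: ler_pM; rewrite ?normc_ge0//; lra.
lra.
Qed.

(** Successive halvings cost 4 K l, 2 K l, K l and so on, which add up to 8 K l. The induction is on
    the number of halvings needed to pass below t. *)
Lemma descent_le x l t : 0 < t <= l -> `|descent x t - descent x l| <= 8 * (K * l).
Proof.
move=> tl.
suff H n : forall l, 0 < l -> l / 2 ^+ n <= t <= l -> `|descent x t - descent x l| <= 8 * (K * l).
  have [n Hn] := half_pow_small l (proj1 (andP tl)).
  by apply: (H n); lra.
elim: n => [|n IH] l' l0.
  rewrite expr0 divr1 => h; have -> : t = l' by lra.
  by rewrite subrr normr0 !mulr_ge0// ltW.
move=> h; case: (leP (l' / 2) t) => ht.
  have := @descent_half x l' t l0 ltac:(lra).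
  have : 0 <= K * l' by rewrite mulr_ge0// ltW.
  lra.
have h1 := IH (l' / 2) ltac:(lra).
have E : l' / 2 / 2 ^+ n = l' / 2 ^+ n.+1 by rewrite exprS invfM mulrA.
rewrite E in h1; have {}h1 := h1 ltac:(lra).
have h2 := @descent_half x l' (l' / 2) l0 ltac:(lra).
rewrite (_ : _ - _ = (descent x t - descent x (l' / 2)) + (descent x (l' / 2) - descent x l')).
  by rewrite (le_trans (ler_normD _ _))//; lra.
by ring.
Qed.

(** By [descent_le] the intervals of radius 8 K l around [descent x l] meet pairwise, so the
    supremum of their left ends lies in all of them and no limit has to be taken. *)
Lemma boundary_value : exists Gam : R -> R, forall x l, 0 < l ->
  `|Gam x - descent x l| <= 8 * (K * l).
Proof.
pose A x := [set descent x l - 8 * (K * l) | l in [set l | 0 < l]].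
have AB x l l' : 0 < l -> 0 < l' -> descent x l - 8 * (K * l) <= descent x l' + 8 * (K * l').
  move=> l0 l'0; case: (leP l l') => ll.
    have := @descent_le x l' l ltac:(lra); rewrite ler_norml.
    have : 0 <= K * l by rewrite mulr_ge0// ltW.
    lra.
  have := @descent_le x l l' ltac:(lra); rewrite ler_norml.
  have : 0 <= K * l' by rewrite mulr_ge0// ltW.
  lra.
exists (fun x => sup (A x)) => x l l0.
have hA : has_sup (A x).
  split; first by exists (descent x 1 - 8 * (K * 1)), 1 => //=; exact: ltr01.
  by exists (descent x 1 + 8 * (K * 1)) => _ [l' l'0 <-]; exact: AB.
have h1 : descent x l - 8 * (K * l) <= sup (A x) by apply: ub_le_sup; [case: hA|exists l].
have h2 : sup (A x) <= descent x l + 8 * (K * l).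
  by apply: ge_sup; [case: hA|move=> _ [l' l'0 <-]; exact: AB].
rewrite ler_norml; lra.
Qed.

(** 22 = 8 + 8 + 6 at the height l = b - a: the descents at the two ends, and the increment of
    [descent] between them, where Taylor's bound on G costs 4 and the Lipschitz bound on g costs
    2. *)
Lemma boundary_slope : exists Gam : R -> R, forall a b, a < b ->
  `|(Gam b - Gam a) / (b - a) - complex.Re (g (a +i* (b - a))%C)| <= 22 * K.
Proof.
have [Gam HG] := boundary_value; exists Gam => a b ab.
set l := b - a; have l0 : 0 < l by rewrite /l; lra.
set z := (a +i* l)%C; set w := (b +i* l)%C.
have wz : w - z = l%:C%C by congr Complex; rewrite /= /l; ring.
have nwz : normc (w - z) = l by rewrite wz normc_real gtr0_norm.
have h1 := @prim_taylor l z w l0 (lexx _) (lexx _).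
have h2 := @bloch_lip l z w l0 (lexx _) (lexx _).
rewrite nwz in h1 h2.
have E1 : 4 * (K / l * l ^+ 2) = 4 * (K * l) by field; rewrite gt_eqF.
have E2 : 2 * (K / l * l) = 2 * K by field; rewrite gt_eqF.
rewrite E1 in h1; rewrite E2 in h2.
have ha := HG a l l0; have hb := HG b l l0.
have D : `|descent b l - descent a l - l * complex.Re (g z)| <= 6 * (K * l).
  have -> : descent b l - descent a l - l * complex.Re (g z) =
    complex.Re (G w - G z - (w - z) * g z - ('i%C * l%:C%C) * (g w - g z)).
    rewrite /descent -/z -/w wz.
    have -> : ((0 +i* l)%C : R[i]) = 'i%C * l%:C%C by congr Complex; rewrite /=; ring.
    by case: (g z) (g w) (G z) (G w) => ? ? [? ?] [? ?] [? ?] /=; ring.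
  apply: (le_trans (Re_le_normc _)); apply: (le_trans (ler_normcB _ _)).
  rewrite !normcM normc_i mul1r normc_real gtr0_norm//.
  have : l * normc (g w - g z) <= l * (2 * K) by rewrite ler_wpM2l// ltW.
  lra.
have -> : (Gam b - Gam a) / l - complex.Re (g z) =
  ((Gam b - descent b l) - (Gam a - descent a l) + (descent b l - descent a l - l * complex.Re (g z))) / l.
  by field; rewrite gt_eqF.
rewrite normrM normfV (gtr0_norm l0) ler_pdivrMr//.
apply: (le_trans (ler_normD _ _)); have := ler_normB (Gam b - descent b l) (Gam a - descent a l).
lra.
Qed.

End BlochFunction.

(** * The logarithm of the derivative of a univalent map of the half plane *)

Section UpperHalfPlane.
Variable R : realType.
Implicit Types (f : R[i] -> R[i]).

Let H : set R[i] := [set z | 0 < complex.Im z].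

Lemma uhp_open : copen H.
Proof.
move=> z z0; exists (complex.Im z) => // w wz; rewrite /H /=.
by have := Im_le_normc (w - z); rewrite raddfB /= ler_norml; move: z0; rewrite /H /=; lra.
Qed.

Lemma uhp_boxlike : boxlike H.
Proof. by move=> z w u; rewrite /H /= /btw; lra. Qed.

(* [u] is log|f'| up to a constant and [Gam] is the boundary value of the real
   part of a primitive of log f'. *)
Lemma log_deriv_boundary f f' : (forall z, H z -> cder f z (f' z)) ->
  (forall z w, H z -> H w -> f z = f w -> z = w) ->
  exists (u : R -> R -> R) (Gam : R -> R) (k : R), [/\ 0 < k,
    forall x y, 0 < y -> normc (f' (x +i* y)%C) = k * expR (u x y),
    forall m x y x' y', 0 < m -> m <= y -> m <= y' ->
      `|u x' y' - u x y| <= 2 * (distortion_const R / m * (`|x' - x| + `|y' - y|)) &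
    forall a b, a < b -> `|(Gam b - Gam a) / (b - a) - u a (b - a)| <= 22 * distortion_const R].
Proof.
move=> hf finj.
have f0 := univalent_deriv_neq0 uhp_open hf finj.
have hf' := hol_deriv uhp_open hf.
have [f2 hf2] := hol_choice hf'.
have [k [g [k0 Hg]]] := hol_log uhp_open uhp_boxlike hf2 f0.
have hg z : 0 < complex.Im z -> cder g z (f2 z / f' z) by move=> /Hg[].
have [G hG] : exists G, forall z, H z -> cder G z (g z).
  by apply: (hol_prim uhp_open uhp_boxlike) => z /hg h; eexists; exact: h.
have K0 : 0 <= distortion_const R by exact/ltW/distortion_const_gt0.
have gK z : 0 < complex.Im z -> normc (f2 z / f' z) * complex.Im z <= distortion_const R.
  move=> z0; have fz : 0 < normc (f' z) by rewrite normc_gt0 f0.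
  rewrite normcM normcV mulrAC ler_pdivrMr//.
  (* The square of radius Im z around z lies in the half plane, so [distortion] applies with r = Im
     z. *)
  have sub w : osq z (complex.Im z) w -> H w.
    by rewrite /osq /= mn_ltE !raddfB /= /H /= !ltr_norml; lra.
  exact: (@distortion _ f f' (f2 z) z _ z0 (fun w hw => hf w (sub w hw))
    (fun v w hv hw => finj v w (sub v hv) (sub w hw)) (f0 z z0) (hf2 z z0)).
have [Gam HGam] := boundary_slope K0 hg hG gK.
exists (fun x y => complex.Re (g (x +i* y)%C)), Gam, (normc k); split=> //.
- by rewrite normc_gt0.
- move=> x y y0; have [_ ->] := Hg (x +i* y)%C y0.
  by rewrite normcM normc_cexp.
move=> m x y x' y' m0 my my'.
have E : complex.Re (g (x' +i* y')%C) - complex.Re (g (x +i* y)%C) =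
  complex.Re (g (x' +i* y')%C - g (x +i* y)%C) by rewrite raddfB.
rewrite E; apply: (le_trans (Re_le_normc _)).
have h := @bloch_lip _ g _ _ hg gK m (x +i* y)%C (x' +i* y')%C m0 my my'.
apply: (le_trans h).
rewrite ler_wpM2l// ler_wpM2l ?divr_ge0// ?(ltW m0)//.
by apply: (le_trans (normc_le_ReIm _)); rewrite !raddfB.
Qed.

End UpperHalfPlane.

(** * Dyadic martingales and measures *)

Section DyadicMartingale.
Variable R : realType.
(* [X n k] is attached to the [k]-th dyadic interval of generation [n], whose
   children are [k.*2] and [k.*2.+1]. *)
Variables (X : nat -> nat -> R) (D lam : R).
Hypothesis X0 : X 0%N 0%N = 0.
Hypothesis Xmean : forall n k, X n.+1 k.*2 + X n.+1 k.*2.+1 = 2 * X n k.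
Hypothesis Xstep : forall n k, `|X n.+1 k.*2 - X n k| <= D.
Hypotheses (lam0 : 0 < lam) (lamD : lam * D < pi / 2).

Definition phi n k : R := if `|lam * X n k| < pi / 2 then cos (lam * X n k) else 0.

Lemma phi_ge0 n k : 0 <= phi n k.
Proof.
rewrite /phi; case: ifP => // h; apply/ltW/cos_gt0_pihalf.
by move: h; rewrite ltr_norml.
Qed.

Lemma phi_gt0 n k : (0 < phi n k) = (`|lam * X n k| < pi / 2).
Proof.
rewrite /phi; case: ifP => h; last by rewrite ltxx.
by apply/cos_gt0_pihalf; move: h; rewrite ltr_norml.
Qed.

Lemma phi_le1 n k : phi n k <= 1.
Proof. by rewrite /phi; case: ifP => // _; exact: cos_le1. Qed.

(** Between pi / 2 and pi the cosine is at most 0, so the killing only raises it. *)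
Lemma cos_le_phi n k : `|lam * X n k| <= pi -> cos (lam * X n k) <= phi n k.
Proof.
move=> hpi; rewrite /phi; case: ifP => // /negbT; rewrite -leNgt => h.
rewrite -cos_norm; set t := `|_| in hpi h *.
have -> : cos t = - sin (t - pi / 2) by rewrite sinB cos_pihalf sin_pihalf; ring.
rewrite oppr_le0; apply: sin_ge0_pi; lra.
Qed.

(** The mean property makes the steps to the two children opposite, say d and - d after scaling, and
    cos(x + d) + cos(x - d) = 2 cos x cos d. As |x| + |d| <= pi, the killing can only increase the
    left side. *)
Lemma phi_children n k : 0 < phi n k ->
  2 * cos (lam * D) * phi n k <= phi n.+1 k.*2 + phi n.+1 k.*2.+1.
Proof.
rewrite phi_gt0 => h; rewrite {1}/phi h.
set x := lam * X n k in h *; pose d := lam * (X n.+1 k.*2 - X n k).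
have d1 : `|d| <= lam * D by rewrite normrM gtr0_norm// ler_pM2l.
have E1 : lam * X n.+1 k.*2 = x + d by rewrite /x /d; ring.
have E2 : lam * X n.+1 k.*2.+1 = x - d.
  by rewrite /x /d (_ : X n.+1 k.*2.+1 = 2 * X n k - X n.+1 k.*2); [ring|rewrite -Xmean; ring].
have p0 := @pi_gt0 R.
have c1 := @cos_le_phi n.+1 k.*2; have c2 := @cos_le_phi n.+1 k.*2.+1.
rewrite E1 cosD in c1; rewrite E2 cosB in c2.
clearbody x d.
have pi2 : pi / 2 <= pi :> R by lra.
have lDpi : lam * D <= pi by exact: le_trans (ltW lamD) pi2.
have xd : `|x| + `|d| <= pi by rewrite [leRHS]splitr lerD// ltW// (le_lt_trans d1).
have {}c1 := c1 (le_trans (ler_normD x d) xd).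
have {}c2 := c2 (le_trans (ler_normB x d) xd).
have cd : cos (lam * D) <= cos d.
  rewrite -(cos_norm d) leNgt; apply/negP => hc.
  have : `|d| < lam * D -> cos (lam * D) < cos `|d|.
    have d0 := normr_ge0 d.
    have i1 : `|d| \in `[0, pi]%R by rewrite in_itv /= d0 (le_trans d1).
    have i2 : lam * D \in `[0, pi]%R by rewrite in_itv /= lDpi andbT (le_trans d0).
    by move=> hd; rewrite ltr_cos.
  by rewrite lt_neqAle d1 andbT; case: eqP hc => [->|_] hc; rewrite ?ltxx// in hc *; move=> /(_ isT); lra.
have cx : 0 < cos x by apply/cos_gt0_pihalf; move: h; rewrite ltr_norml.
have : cos x * cos (lam * D) <= cos x * cos d by rewrite ler_pM2l.
lra.
Qed.

(* The Doob transform of the uniform dyadic measure by the positive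
   supermartingale cos(lam * X), killed when |lam * X| reaches pi / 2. *)
Fixpoint nu n k : R := if n is m.+1 then
  nu m k./2 * phi m.+1 k / (phi m.+1 (k./2).*2 + phi m.+1 (k./2).*2.+1) else (k == 0%N)%:R.

Lemma nu_child n k (b : bool) : nu n.+1 (b + k.*2)%N =
  nu n k * phi n.+1 (b + k.*2)%N / (phi n.+1 k.*2 + phi n.+1 k.*2.+1).
Proof. by rewrite /= half_bit_double. Qed.

Lemma nu_ge0 n k : 0 <= nu n k.
Proof.
elim: n k => [|n IH] k /=; first exact: ler0n.
by rewrite divr_ge0 ?mulr_ge0 ?addr_ge0 ?phi_ge0.
Qed.

Let cD : 0 < cos (lam * D).
Proof.
apply/cos_gt0_pihalf; rewrite lamD andbT (@lt_le_trans _ _ 0)// ?oppr_lt0 ?divr_gt0 ?pi_gt0//.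
by rewrite mulr_ge0 ?(ltW lam0)// (le_trans (normr_ge0 _) (Xstep 0%N 0%N)).
Qed.

(** From a parent to a child, nu / phi is multiplied by phi of the parent over the sum of phi on its
    children, a ratio of at most 1 / (2 cos(lam D)). *)
Lemma nu_le_phi n k : nu n k <= phi n k * (2 * cos (lam * D))^-1 ^+ n.
Proof.
elim: n k => [|n IH] k.
  rewrite expr0 mulr1 /=; case: eqP => [->|_]; last exact: phi_ge0.
  by rewrite /phi X0 mulr0 normr0 divr_gt0 ?pi_gt0// cos0.
rewrite -{1}[k]odd_double_half nu_child odd_double_half.
set j := k./2; set c := 2 * cos (lam * D); set S := _ + phi _ j.*2.+1.
have c0 : 0 < c by rewrite mulr_gt0.
have S0 : 0 <= S by rewrite addr_ge0 ?phi_ge0.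
(* A parent with phi = 0 has no mass, which settles the case where the denominator may vanish. *)
have [ph0|ph0] := leP (phi n j) 0.
  have -> : nu n j = 0.
    apply/eqP; rewrite eq_le nu_ge0 andbT (le_trans (IH j))//.
    by rewrite (_ : phi n j = 0) ?mul0r//; apply/eqP; rewrite eq_le ph0 phi_ge0.
  by rewrite !mul0r mulr_ge0 ?phi_ge0 ?exprn_ge0 ?invr_ge0 ?(ltW c0).
have hS := phi_children ph0; rewrite -/S -/c in hS.
have Sp : 0 < S by rewrite (lt_le_trans _ hS)// mulr_gt0.
rewrite ler_pdivrMr//.
apply: (@le_trans _ _ (phi n j * c^-1 ^+ n * phi n.+1 k)).
  by rewrite ler_wpM2r ?phi_ge0.
rewrite (_ : phi n j * _ * _ = phi n.+1 k * c^-1 ^+ n.+1 * (c * phi n j)); last first.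
  by rewrite exprS; field; rewrite gt_eqF.
by rewrite ler_wpM2l// mulr_ge0 ?phi_ge0 ?exprn_ge0 ?invr_ge0 ?(ltW c0).
Qed.

Lemma nu_le n k : nu n k <= (2 * cos (lam * D))^-1 ^+ n.
Proof.
rewrite (le_trans (nu_le_phi n k))// ler_piMl ?phi_le1// exprn_ge0// invr_ge0 mulr_ge0//.
exact: ltW.
Qed.

Lemma nu_gt0_phi n k : 0 < nu n k -> 0 < phi n k.
Proof.
move=> h; rewrite lt_def phi_ge0 andbT; apply/eqP => p0.
by have := nu_le_phi n k; rewrite p0 mul0r leNgt h.
Qed.

Lemma nu_gt0_bound n k : 0 < nu n k -> `|X n k| <= pi / 2 / lam.
Proof.
move=> /nu_gt0_phi; rewrite phi_gt0 normrM gtr0_norm// => h.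
by rewrite ler_pdivlMr// mulrC ltW.
Qed.

Lemma nu_sum n k : nu n k = nu n.+1 k.*2 + nu n.+1 k.*2.+1.
Proof.
rewrite (nu_child n k false) (nu_child n k true).
(* Without mass at the parent both children get 0; with mass the denominator is positive. *)
have [h|h] := leP (nu n k) 0.
  by rewrite (_ : nu n k = 0) ?mul0r ?addr0//; apply/eqP; rewrite eq_le h nu_ge0.
have S0 : 0 < phi n.+1 k.*2 + phi n.+1 k.*2.+1.
  apply: lt_le_trans (phi_children (nu_gt0_phi h)).
  by rewrite !mulr_gt0// nu_gt0_phi.
by rewrite /=; field; rewrite gt_eqF.
Qed.

End DyadicMartingale.

(** * The mass met by a cover, and a path that escapes it *)

Section DyadicMass.
Variable R : realType.
Variable nu : nat -> nat -> R.
Hypothesis nu0 : forall n k, 0 <= nu n k.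
Hypothesis nuS : forall n k, nu n k = nu n.+1 k.*2 + nu n.+1 k.*2.+1.
Hypothesis nu00 : nu 0%N 0%N = 1.

(* Mass of the descendants of generation [N] of the interval (n, k) that
   satisfy [p]; junk 0 when [N < n]. *)
Definition hitmass (N : nat) (p : pred nat) n k : R :=
  if (n <= N)%N then \sum_(k * 2 ^ (N - n) <= i < k.+1 * 2 ^ (N - n) | p i) nu N i else 0.

Lemma hitmass_ge0 N p n k : 0 <= hitmass N p n k.
Proof. by rewrite /hitmass; case: ifP => // _; apply: sumr_ge0. Qed.

Lemma hitmass_children N p n k :
  hitmass N p n.+1 k.*2 + hitmass N p n.+1 k.*2.+1 <= hitmass N p n k.
Proof.
rewrite /hitmass; case: (ltnP n N) => nN; last first.
  by rewrite addr0; case: ifP => // _; apply: sumr_ge0.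
rewrite (ltnW nN) subnS; have : (0 < N - n)%N by rewrite subn_gt0.
case: (N - n)%N => // m _ /=.
rewrite (_ : k.*2 * 2 ^ m = k * 2 ^ m.+1)%N; last by rewrite expnS -mul2n; lia.
rewrite (_ : k.*2.+2 * 2 ^ m = k.+1 * 2 ^ m.+1)%N; last by rewrite expnS -mul2n; lia.
rewrite -big_cat_nat//; first by rewrite expnS -mul2n; nia.
by rewrite expnS -mul2n; nia.
Qed.

Lemma hitmass_self N (p : pred nat) k : p k -> hitmass N p N k = nu N k.
Proof. by move=> pk; rewrite /hitmass leqnn subnn expn0 !muln1 big_mkcond big_nat1 pk. Qed.

(** The second hypothesis holds when [p] selects the intervals of generation N that meet a set no
    longer than one of them; it leaves at most three indices. *)
Lemma hitmass_le N (p : pred nat) (c : R) : (forall i, nu N i <= c) ->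
  (forall i j, p i -> p j -> (i <= j + 2)%N) -> hitmass N p 0%N 0%N <= 3 * c.
Proof.
move=> hc hp; have c0 : 0 <= c by exact: le_trans (nu0 N 0) (hc _).
rewrite /hitmass leq0n mul0n -big_filter; set s := [seq _ <- _ | _].
suff hs : (size s <= 3)%N.
  apply: (@le_trans _ _ (\sum_(i <- s) c)); first by apply: ler_sum => i _.
  by rewrite big_const_seq count_predT iter_addr_0 -[c *+ _]mulr_natl ler_wpM2r// ler_nat.
have us : uniq s by rewrite filter_uniq// iota_uniq.
case: (boolP (has p s)) => [/hasP[i0 _ pi0]|]; last first.
  have : all p s by exact: filter_all.
  by case: s us => //= i s' _ /andP[->].
have exp_ : exists i, p i by exists i0.
pose i1 := ex_minn exp_.
have [pi1 mi1] : p i1 /\ forall j, p j -> (i1 <= j)%N by rewrite /i1; case: ex_minnP.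
have : {subset s <= [:: i1; i1.+1; i1.+2]}.
  move=> j; rewrite mem_filter => /andP[pj _]; rewrite !inE.
  have := mi1 j pj; have := hp j i1 pj pi1; lia.
by move=> /(uniq_leq_size us).
Qed.

(* If the mass met by the cover is less than the total mass, descend to a child
   that keeps this strict inequality. *)
Lemma konig (Rm : nat -> nat -> \bar R) :
  (forall n k, (Rm n.+1 k.*2 + Rm n.+1 k.*2.+1 <= Rm n k)%E) ->
  (forall n k, (0 <= Rm n k)%E) -> (Rm 0%N 0%N < 1)%E ->
  exists kap : nat -> nat, (forall n, kap n.+1 = (kap n).*2 \/ kap n.+1 = (kap n).*2.+1) /\
    forall n, (Rm n (kap n) < (nu n (kap n))%:E)%E.
Proof.
move=> Rs R0 R1.
have step n k : (Rm n k < (nu n k)%:E)%E ->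
    (Rm n.+1 k.*2 < (nu n.+1 k.*2)%:E)%E \/ (Rm n.+1 k.*2.+1 < (nu n.+1 k.*2.+1)%:E)%E.
  move=> h; case: ltP => [_|h1]; [by left|right; rewrite ltNge; apply/negP => h2].
  have := leeD h1 h2; rewrite -EFinD -nuS => h3.
  by have := lt_le_trans h (le_trans h3 (Rs n k)); rewrite ltxx.
pose kap := fix kap n := if n is m.+1 then
  (if (Rm m.+1 (kap m).*2 < (nu m.+1 (kap m).*2)%:E)%E then (kap m).*2 else (kap m).*2.+1)
  else 0%N.
exists kap; split=> [n /=|]; first by case: ifP => _; [left|right].
elim=> [|n /step] /=; first by rewrite nu00.
by case: ifP => // hn [|//]; rewrite ?hn.
Qed.

End DyadicMass.

Lemma half_powR_lt1 (R : realType) (b : R) : 0 < b -> 2^-1 `^ b < 1 :> R.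
Proof.
move=> /gt0_ltr_powR h; have := h 2^-1 1; rewrite powR1; apply.
- by rewrite nnegrE invr_ge0.
- by rewrite nnegrE.
- by rewrite invf_lt1 ?ltr1n.
Qed.

Lemma half_lt_powR (R : realType) (b : R) : b < 1 -> 2^-1 < 2^-1 `^ b :> R.
Proof.
move=> b1.
have E : (2^-1 : R) = 2^-1 `^ b * 2^-1 `^ (1 - b).
  by rewrite -powRD ?subrKC ?powRr1 ?invr_ge0//; apply/implyP => _; rewrite invr_eq0 pnatr_eq0.
by rewrite [ltLHS]E gtr_pMr ?powR_gt0 ?invr_gt0//; apply: half_powR_lt1; rewrite subr_gt0.
Qed.

(** * Hausdorff content of the support *)

Section Content.
Variable R : realType.
Variable alpha : R.
Hypothesis halpha : 0 < alpha < 1.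

(** [c ^+ n] is the alpha-th power of the relative length of an interval of generation n, so that nu
    <= c ^+ n is the Frostman condition on dyadic intervals. *)
Let c : R := 2^-1 `^ alpha.

Let c0 : 0 < c.
Proof. by rewrite powR_gt0// invr_gt0. Qed.

Let c1 : c < 1.
Proof.
by apply: half_powR_lt1; case/andP: halpha.
Qed.

Let c2 : 1 <= 2 * c.
Proof.
by have := @half_lt_powR R alpha; rewrite -/c; case/andP: halpha => _ h /(_ h); lra.
Qed.

Let cX n : c ^+ n = (2^-1 ^+ n) `^ alpha.
Proof.
elim: n => [|n IH]; first by rewrite !expr0 powR1.
by rewrite !exprS IH powRM ?exprn_ge0 ?invr_ge0.
Qed.

(** N is the last generation whose intervals are at least r long. Then l / 2 ^ (N + 1) < r bounds c
    ^ (N + 1), and c >= 1 / 2 makes c ^ N at most twice that. For r = 0 no generation is last, and e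
    makes up for it. *)
Lemma covering_level (l r e : R) : 0 < l -> 0 <= r <= l -> 0 < e ->
  exists N, r <= l / 2 ^+ N /\ c ^+ N <= 2 * (r `^ alpha / l `^ alpha) + e.
Proof.
move=> l0 /andP[r0 rl] e0.
have la : 0 < l `^ alpha by rewrite powR_gt0.
move: r0; rewrite le_eqVlt => /orP[/eqP r0|r0].
  have nc : `|c| < 1 by rewrite gtr0_norm.
  have /cvgrPdist_le /(_ _ e0) [N _ HN] := cvg_geometric 1 nc.
  exists N; rewrite -r0; split; first by rewrite divr_ge0 ?exprn_ge0// ltW.
  rewrite powR0 ?mul0r ?mulr0 ?add0r; last by case/andP: halpha => h _; rewrite gt_eqF.
  have := HN N (leqnn N); rewrite /= sub0r normrN mul1r ger0_norm// exprn_ge0// ltW//.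
have exN : exists n, l / 2 ^+ n < r by exact: half_pow_small.
case: (ex_minnP exN) => -[|N] hN minN.
  by move: hN; rewrite expr0 divr1 ltNge rl.
exists N; split.
  by rewrite leNgt; apply/negP => /minN; rewrite ltnn.
have h : c ^+ N.+1 * l `^ alpha <= r `^ alpha.
  rewrite cX -powRM ?exprn_ge0 ?invr_ge0// ?(ltW l0)//.
  apply: ge0_ler_powR; rewrite ?nnegrE ?mulr_ge0 ?exprn_ge0 ?invr_ge0 ?(ltW l0) ?(ltW r0)//.
    by case/andP: halpha => /ltW.
  by rewrite mulrC exprVn ltW.
have h2 : c ^+ N <= 2 * c ^+ N.+1.
  by rewrite exprS mulrA ler_peMl// exprn_ge0// ltW.
have : c ^+ N.+1 <= r `^ alpha / l `^ alpha by rewrite ler_pdivlMr.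
lra.
Qed.

Variables (nu : nat -> nat -> R) (a l : R).
Hypothesis l0 : 0 < l.
Hypothesis nu0 : forall n k, 0 <= nu n k.
Hypothesis nuS : forall n k, nu n k = nu n.+1 k.*2 + nu n.+1 k.*2.+1.
Hypothesis nu00 : nu 0%N 0%N = 1.
Hypothesis nu_c : forall n k, nu n k <= c ^+ n.

(** The intervals are closed, so that the limit of a nested sequence of them lies in each. *)
Definition dyadic n k : set R :=
  [set x | a + k%:R * (l / 2 ^+ n) <= x <= a + k.+1%:R * (l / 2 ^+ n)].

Definition cantor_support : set R :=
  [set x | exists kap : nat -> nat, forall n, 0 < nu n (kap n) /\ dyadic n (kap n) x].

Lemma path_limit (kap : nat -> nat) :
  (forall n, kap n.+1 = (kap n).*2 \/ kap n.+1 = (kap n).*2.+1) ->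
  exists x, forall n, dyadic n (kap n) x.
Proof.
move=> hk.
have [n|x Hx] := @sup_of_nested R (fun n => a + (kap n)%:R * (l / 2 ^+ n)) l (ltW l0).
  have E : l / 2 ^+ n = 2 * (l / 2 ^+ n.+1) by rewrite exprS; field; rewrite expf_neq0.
  rewrite E; have h0 : 0 <= l / 2 ^+ n.+1 by rewrite divr_ge0 ?exprn_ge0// ltW.
  case: (hk n) => ->; rewrite -?[(_.*2.+1)%:R]natr1 -mul2n natrM; move: (_ / _) h0 => h h0; lra.
exists x => n; have := Hx n; rewrite /dyadic /= -natr1.
move: (_ / _) => h; lra.
Qed.

(** A mass distribution argument without a measure. A cover with a smaller sum would meet less than
    the total mass 1, so [konig] yields a path of intervals whose mass always exceeds what the cover
    meets. Its limit point lies in the support, hence in some [E j], which therefore meets the whole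
    mass of the path's interval at generation [N j]. *)
Lemma content_cantor :
  (((l `^ alpha) / 12)%:E <= hausdorff_content alpha [set (x%:C%C : CC R) | x in cantor_support])%E.
Proof.
apply: le_ereal_inf_tmp => _ [E cov <-].
have d0 j : (0 <= diam (E j))%E by apply: ereal_sup_ubound; left.
have t0 j : (0 <= diam (E j) `^ alpha)%E by exact: poweR_ge0.
have la : 0 < l `^ alpha by rewrite powR_gt0.
rewrite leNgt; apply/negP => hsum.
(* A longer set would alone exceed the sum; in particular all diameters are finite. *)
have small j : (diam (E j) <= l%:E)%E.
  rewrite leNgt; apply/negP => hj.
  have h1 : ((l `^ alpha)%:E <= diam (E j) `^ alpha)%E.
    rewrite -poweR_EFin; apply: gt0_ler_poweR; rewrite ?in_itv /= ?leey ?lee_fin ?(ltW l0) ?d0 ?(ltW hj)//.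
    by case/andP: halpha => /ltW.
  have h2 : (diam (E j) `^ alpha <= \sum_(j <oo) diam (E j) `^ alpha)%E.
    apply: le_trans (nneseries_lim_ge j.+1 _) => //.
    by rewrite big_nat_recr//= leeDr// sume_ge0.
  have := lt_le_trans (le_lt_trans (le_trans h1 h2) hsum) (_ : ((l `^ alpha / 12)%:E <= (l `^ alpha)%:E)%E).
  rewrite ltxx => H; suff : false by []; apply: H.
  by rewrite lee_fin ler_pdivrMr//; lra.
pose r j := fine (diam (E j)).
have rE j : diam (E j) = (r j)%:E.
  rewrite fineK// ge0_fin_numE//; exact: le_lt_trans (small j) (ltry _).
have rl j : 0 <= r j <= l by rewrite -!lee_fin -rE d0 small.
(* These errors sum to 1 / 2; each is divided by 3 because a set may meet three intervals. *)
pose e j : R := 2^-1 / (2 ^ j.+1)%:R.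
have e0 j : 0 < e j by rewrite divr_gt0 ?invr_gt0// ltr0n expn_gt0.
have /choice[N HN] : forall j, exists N, r j <= l / 2 ^+ N /\
    c ^+ N <= 2 * (r j `^ alpha / l `^ alpha) + e j / 3.
  by move=> j; apply: covering_level => //; rewrite divr_gt0.
pose hit j : pred nat := fun i => `[< exists2 x : R, E j (x%:C)%C & dyadic (N j) i x >].
have hclose j i i' : hit j i -> hit j i' -> (i <= i' + 2)%N.
  move=> /asboolP[x Ex /andP[x1 x2]] /asboolP[x' Ex' /andP[x1' x2']].
  have : `|x - x'| <= r j.
    rewrite -lee_fin -rE; apply: ereal_sup_ubound; right.
    exists (x%:C)%C => //; exists (x'%:C)%C => //; congr (_%:E).
    by rewrite -rmorphB; exact: normc_real.
  move=> /(le_trans (ler_norm _)) xx'.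
  have [h1 _] := HN j.
  have h0 : 0 < l / 2 ^+ N j by rewrite divr_gt0 ?exprn_gt0.
  rewrite -(ler_nat R) -(ler_pM2r h0) natrD; move: x1 x2 x1' x2'.
  rewrite -[i.+1%:R]natr1 -[i'.+1%:R]natr1; move: (l / 2 ^+ N j) h1 => h h1; lra.
(* [E j] counts only while n <= [N j]; dropping it afterwards keeps the sum over two children below
   the value at their parent. *)
pose Rm n k : \bar R := (\sum_(j <oo) (hitmass nu (N j) (hit j) n k)%:E)%E.
have [|n k||kap [hk hR]] := @konig R nu nuS nu00 Rm.
- move=> n k; rewrite /Rm -nneseriesD.
  + by apply: lee_nneseries => [j _ _|j _]; rewrite -EFinD lee_fin ?addr_ge0 ?hitmass_ge0// hitmass_children.
  + by move=> j _ _; rewrite lee_fin hitmass_ge0.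
  + by move=> j _ _; rewrite lee_fin hitmass_ge0.
- by apply: nneseries_ge0 => j _ _; rewrite lee_fin hitmass_ge0.
(* 6 = 3 * 2: three intervals, and the factor 2 of [covering_level]. The total stays below 6 / 12 +
   1 / 2 = 1. *)
- have k0 : 0 <= 6 / l `^ alpha by rewrite divr_ge0// ltW.
  apply: (@le_lt_trans _ _ (\sum_(j <oo) ((6 / l `^ alpha)%:E * diam (E j) `^ alpha + (2^-1 / (2 ^ j.+1)%:R)%:E))%E).
    apply: lee_nneseries => [j _ _|j _]; first by rewrite lee_fin hitmass_ge0.
    rewrite rE poweR_EFin -EFinM -EFinD lee_fin -/(e j).
    apply: (le_trans (hitmass_le nu0 (nu_c (N j)) (hclose j))).
    have [_ h] := HN j; have -> : 6 / l `^ alpha * r j `^ alpha = 6 * (r j `^ alpha / l `^ alpha) by ring.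
    lra.
  apply: (le_lt_trans (epsilon_trick _ _ _)).
  + by move=> j; rewrite mule_ge0// lee_fin.
  + by rewrite invr_ge0.
  rewrite nneseriesZl//.
  have -> : (1 = (6 / l `^ alpha)%:E * (l `^ alpha / 12)%:E + (2^-1)%:E :> \bar R)%E.
    by rewrite -EFinM -EFinD; congr EFin; field; rewrite gt_eqF.
  by rewrite lteD2rE// lte_pmul2l// lte_fin divr_gt0.
have [x Hx] := path_limit hk.
have [j _ Ej] : (\bigcup_j E j) ((x%:C)%C : CC R).
  apply: cov; exists x => //; exists kap => n; split=> //.
  rewrite -lte_fin; apply: le_lt_trans (hR n).
  by apply: nneseries_ge0 => j _ _; rewrite lee_fin hitmass_ge0.
have hj : hit j (kap (N j)) by apply/asboolP; exists x.
have := hR (N j); apply/negP; rewrite -leNgt.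
apply: le_trans (nneseries_lim_ge j.+1 _); last by move=> i _ _; rewrite lee_fin hitmass_ge0.
rewrite big_nat_recr//= hitmass_self// leeDr// sume_ge0// => i _.
by rewrite lee_fin hitmass_ge0.
Qed.

End Content.

(** * Sawtooth regions *)

Section Bridge.
Variable R : realType.

Lemma derivable_cder (f : CC R -> CC R) (z : CC R) : derivable f z 1 -> cder f z (derive1 f z).
Proof.
move=> df e e0.
have fd : (fun t : CC R => t^-1 *: (f (t *: 1 + z) - f z)) @ 0^' --> derive1 f z.
  by rewrite derive1E; exact: df.
have e0C : 0 < (e%:C)%C :> CC R by rewrite ltcR.
move: fd => /cvgrPdist_le /(_ _ e0C); rewrite /dnbhs/= near_withinE => /(@nbhs_norm0P _ (CC R))[d d0 H].
(* A positive element of R[i] is real, so [d] is a genuine radius. *)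
have dE : d = ((complex.Re d)%:C)%C.
  by rewrite -[LHS]xy_eta (ger0_Im (ltW d0)).
exists (complex.Re d); first by move: d0; rewrite /= dE ltcR.
move=> y yx.
have [->|nyx] := eqVneq y z; first by rewrite !subrr mul0r subr0 normc0 mulr0.
have yx0 : y - z != 0 by rewrite subr_eq0.
have yd : `|y - z : CC R| < d by rewrite dE; change ((normc (y - z))%:C%C < (complex.Re d)%:C%C); rewrite ltcR.
have := H (y - z) yd yx0; rewrite scaler1 subrK => h1.
have -> : f y - f z - (y - z) * derive1 f z =
    (- (derive1 f z - (y - z)^-1 * (f y - f z))) * (y - z).
  by field.
rewrite normcM normcN ler_wpM2r ?normc_ge0//.
by rewrite -lecR; exact: h1.
Qed.

(** As alpha < 1, 1 / (2 * 2 ^ (- alpha)) < 1, and cos psi exceeds it for small psi by continuity at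
    0. The angle is the total step [lam * D] allowed to the martingale. *)
Lemma exists_angle (alpha : R) : 0 < alpha < 1 -> exists psi : R,
  0 < psi < pi / 2 /\ (2 * cos psi)^-1 <= 2^-1 `^ alpha.
Proof.
move=> /andP[a0 a1]; set c := _ `^ _.
have p0 := @pi_gt0 R.
have c12 : 2^-1 < c by exact: half_lt_powR.
have c0 : 0 < c by rewrite (lt_trans _ c12)// invr_gt0.
pose e := 1 - (2 * c)^-1.
have e0 : 0 < e by rewrite subr_gt0 invf_lt1 ?mulr_gt0//; lra.
have := @continuous_cos R 0; rewrite /continuous_at cos0 => /cvgrPdist_le /(_ _ e0).
move=> /nbhs_norm0P[d /= d0 H].
pose psi := Num.min (d / 2) (pi / 4).
have [h1 h2] : psi <= d / 2 /\ psi <= pi / 4 by rewrite /psi !ge_min !lexx orbT.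
have h0 : 0 < psi by rewrite lt_min !divr_gt0.
clearbody psi.
exists psi; split; first by lra.
have hp : `|psi| < d by rewrite gtr0_norm//; lra.
have := H psi hp; rewrite ler_norml /e => h3.
have h4 : (2 * c)^-1 <= cos psi by lra.
have i0 : 0 < (2 * c)^-1 by rewrite invr_gt0 mulr_gt0.
have cp : 0 < cos psi by exact: lt_le_trans h4.
move: h4; rewrite -[leLHS]mulr1 ler_pdivrMl ?mulr_gt0// => h5.
rewrite -[leLHS]mulr1 ler_pdivrMl ?mulr_gt0//; lra.
Qed.

(** The first generation of length at most y works: its predecessor is longer than y, and for
    generation 0 the upper bound is the hypothesis. *)
Lemma dyadic_scale (l y : R) : 0 < y < 2 * l -> exists n, l / 2 ^+ n <= y < 2 * (l / 2 ^+ n).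
Proof.
move=> /andP[y0 yl]; have exN : exists n, l / 2 ^+ n <= y.
  by have [n /ltW Hn] := half_pow_small l y0; exists n.
case: (ex_minnP exN) => -[|n] hn minn.
  by exists 0%N; rewrite hn expr0 divr1.
exists n.+1; rewrite hn /=.
have -> : 2 * (l / 2 ^+ n.+1) = l / 2 ^+ n by rewrite exprS; field; rewrite expf_neq0.
by rewrite ltNge; apply/negP => /minn; rewrite ltnn.
Qed.

(** The distance to E may not be attained; doubling Im w > 0 leaves room for a point of E. An empty
    E is at infinite distance, so its region contains no such w. *)
Lemma sawtooth_witness (x0 y0 : R) (E : set R) (w : CC R) : 0 < complex.Im w ->
  sawtooth x0 y0 E w -> exists2 x, E x & `|complex.Re w - x| < 2 * complex.Im w.
Proof.
move=> y1 [_ h _].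
have : (edist_inf E (complex.Re w) < (2 * complex.Im w)%:E)%E.
  by apply: le_lt_trans h _; rewrite lte_fin; lra.
move=> /ereal_inf_lt[_ [x Ex <-]] /edist_lt_ball h2; exists x => //.
Qed.

End Bridge.

Theorem theorem1p3 (R : realType) (alpha : R) (halpha : 0 < alpha < 1) :
  exists2 C : R, 0 < C &
    forall (Omega : set (CC R)) (f : CC R -> CC R),
      domain Omega -> conformal_map (@upper_half_plane R) Omega f ->
    forall x0 y0 : R, 0 < y0 ->
    exists E : set R,
      [/\ E `<=` `]x0 - y0 / 2, x0 + y0 / 2[,
          ((y0 `^ alpha / C)%:E
             <= hausdorff_content alpha [set (x%:C%C : CC R) | x in E])%E &
          forall w : CC R, upper_half_plane w -> sawtooth x0 y0 E w ->
            C^-1 * normc (derive1 f (x0 +i* y0)%C) <= normc (derive1 f w)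
              <= C * normc (derive1 f (x0 +i* y0)%C)].
Proof.
pose K := distortion_const R; have K0 : 0 < K := distortion_const_gt0 R.
have [psi [psi2 psic]] := exists_angle halpha.
(* 46 = 22 + 22 + 2: the slope against [u] in two consecutive generations, and the change of [u]
   when the height is halved. *)
pose D := 46 * K; have D0 : 0 < D by rewrite mulr_gt0.
pose lam := psi / D; have lam0 : 0 < lam by rewrite divr_gt0//; case/andP: psi2.
have lamDE : lam * D = psi by rewrite /lam divfK// gt_eqF.
have lamD : lam * D < pi / 2 by rewrite lamDE; case/andP: psi2.
(* 59 = 12 + 22 + 22 + 3, the errors [E1] to [E4]; the last term bounds the martingale on intervals
   with mass. *)
pose B := 59 * K + pi / 2 / lam.
(* [expR B] serves (b). The 24 serves (a): the content is at least (y0 / 2) ^ alpha / 12, and 2 ^ (-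
   alpha) > 1 / 2. *)
exists (expR B + 24); first by rewrite addr_gt0 ?expR_gt0.
move=> Omega f _ [df [_ finj _]] x0 y0 y00.
have hf z : 0 < complex.Im z -> cder f z (derive1 f z) by move=> /df; exact: derivable_cder.
have fi z w : 0 < complex.Im z -> 0 < complex.Im w -> f z = f w -> z = w.
  by move=> z0 w0; apply: finj; rewrite inE.
have [u [Gam [k [k0 uk ulip uGam]]]] := log_deriv_boundary hf fi.
rewrite -/K in ulip uGam.
(* The root interval is the centred half of the given open interval, which therefore contains it
   with its end points. *)
pose l := y0 / 2; have l0 : 0 < l by rewrite divr_gt0.
pose a := x0 - l / 2.
pose h n : R := l / 2 ^+ n; have h0 n : 0 < h n by rewrite divr_gt0 ?exprn_gt0.
have h2 n : h n = 2 * h n.+1 by rewrite /h exprS; field; rewrite expf_neq0.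
pose p n i := a + i%:R * h n.
pose S n i := (Gam (p n i + h n) - Gam (p n i)) / h n.
have pS n i : p n i.+1 = p n i + h n by rewrite /p -natr1; ring.
have p2 n i : p n.+1 i.*2 = p n i by rewrite /p -mul2n natrM (h2 n); ring.
have p21 n i : p n.+1 i.*2.+1 = p n i + h n.+1 by rewrite pS p2.
have Su n i : `|S n i - u (p n i) (h n)| <= 22 * K.
  have pn : p n i < p n i + h n by rewrite ltrDl.
  by have := uGam _ _ pn; rewrite /S (_ : p n i + h n - p n i = h n); [|ring].
pose X n i := S n i - S 0%N 0%N.
have X0 : X 0%N 0%N = 0 by rewrite /X subrr.
(* The value of [Gam] at the midpoint cancels between the two halves. *)
have Xmean n i : X n.+1 i.*2 + X n.+1 i.*2.+1 = 2 * X n i.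
  rewrite /X /S p21 p2 (_ : p n i + h n.+1 + h n.+1 = p n i + h n); last by rewrite (h2 n); ring.
  by rewrite (h2 n); field; rewrite ?gt_eqF.
have Xstep n i : `|X n.+1 i.*2 - X n i| <= D.
  have s1 := Su n.+1 i.*2; have s2 := Su n i.
  have s3 := ulip (h n.+1) (p n i) (h n) (p n i) (h n.+1) (h0 _).
  rewrite p2 in s1; rewrite subrr normr0 add0r distrC (h2 n) in s3.
  have {}s3 := s3 ltac:(have := h0 n.+1; lra) (lexx _).
  have hE : `|h n.+1 - 2 * h n.+1| = h n.+1 by rewrite (_ : _ - _ = - h n.+1) ?normrN ?gtr0_norm//; ring.
  rewrite hE divfK ?gt_eqF// in s3.
  rewrite -(h2 n) [X in X <= _]distrC in s3.
  rewrite (_ : _ - _ = (S n.+1 i.*2 - u (p n i) (h n.+1)) +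
    ((u (p n i) (h n.+1) - u (p n i) (h n)) - (S n i - u (p n i) (h n)))); last by rewrite /X; ring.
  apply: (le_trans (ler_normD _ _)); apply: (le_trans (lerD (lexx _) (ler_normB _ _))).
  by rewrite /D; lra.
pose m := nu X lam.
have m0 n i : 0 <= m n i := nu_ge0 X lam n i.
have mS n i : m n i = m n.+1 i.*2 + m n.+1 i.*2.+1 by exact: nu_sum X0 Xmean Xstep lam0 lamD n i.
have mc n i : m n i <= (2^-1 `^ alpha) ^+ n.
  apply: le_trans (nu_le X0 Xmean Xstep lam0 lamD n i) _.
  have cp : 0 < cos psi by apply: cos_gt0_pihalf; case/andP: psi2 => ? ?; lra.
  by rewrite lamDE lerXn2r ?nnegrE ?powR_ge0 ?invr_ge0 ?mulr_ge0// ltW.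
exists (cantor_support m a l); split.
- move=> x [kap Hk]; have [mk] := Hk 0%N; rewrite /dyadic /= expr0 divr1.
  have -> : kap 0%N = 0%N by move: mk; rewrite /m /=; case: eqP => //; rewrite ltxx.
  by rewrite in_itv /= /a /l; lra.
- have := content_cantor halpha a l0 m0 mS erefl mc; apply: le_trans.
  have c12 : 2^-1 < 2^-1 `^ alpha :> R by apply: half_lt_powR; case/andP: halpha.
  have ya : 0 < y0 `^ alpha by rewrite powR_gt0.
  rewrite lee_fin /l powRM ?invr_ge0// ?(ltW y00)// -mulrA ler_pM2l//.
  have h24 : (expR B + 24)^-1 <= 24^-1.
    by rewrite lef_pV2 ?posrE ?addr_gt0 ?expR_gt0// lerDr expR_ge0.
  apply: (le_trans h24); rewrite ler_pdivlMr//.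
  have -> : 24^-1 * 12 = 2^-1 :> R by field.
  exact: ltW.
move=> w w0 sw; have [e [kap Hk] xe] := sawtooth_witness w0 sw.
have [_ _ yw] := sw.
set x := complex.Re w in xe *; set y := complex.Im w in xe yw *.
have y1 : 0 < y by [].
have [n hn] : exists n, h n <= y < 2 * h n.
  by apply: dyadic_scale; rewrite y1 /l; lra.
have [mk] := Hk n; set i := kap n in mk *; rewrite /dyadic /= -/(h n) -/(p n i) => de.
rewrite -/(p n i.+1) pS in de.
have Xb : `|X n i| <= pi / 2 / lam by exact: nu_gt0_bound X0 Xmean Xstep lam0 lamD n i mk.
have hn0 := h0 n.
(* |x - e| < 2 y < 4 h n and e is within h n of [p n i], so the horizontal distance is at most 5 h n
   and the vertical one at most h n; the Lipschitz bound doubles their sum. *)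
have E1 : `|u x y - u (p n i) (h n)| <= 12 * K.
  have := ulip (h n) (p n i) (h n) x y hn0 (lexx _) ltac:(lra).
  have : `|x - p n i| <= 5 * h n.
    rewrite (_ : x - p n i = (x - e) + (e - p n i)); last by ring.
    apply: (le_trans (ler_normD _ _)); rewrite [`|e - _|]ger0_norm; lra.
  have : `|y - h n| <= h n by rewrite ger0_norm; lra.
  move=> q1 q2 q3; apply: (le_trans q3).
  rewrite (_ : 12 * K = 2 * (K / h n * (6 * h n))); last by field; rewrite gt_eqF.
  by rewrite ler_wpM2l// ler_wpM2l ?divr_ge0 ?(ltW K0) ?(ltW hn0)//; lra.
have E2 := Su n i; have E3 := Su 0%N 0%N.
have h00 : h 0%N = l by rewrite /h expr0 divr1.
have p00 : p 0%N 0%N = a by rewrite /p mul0r addr0.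
rewrite h00 p00 in E3.
(* From z0 to the point above the root: l / 2 horizontally and l vertically, doubled by the
   Lipschitz bound. *)
have E4 : `|u a l - u x0 y0| <= 3 * K.
  have := ulip l x0 y0 a l l0 ltac:(rewrite /l; lra) (lexx _).
  have -> : a - x0 = - (l / 2) by rewrite /a; ring.
  have -> : l - y0 = - l by rewrite /l; field.
  rewrite !normrN (gtr0_norm l0) (@gtr0_norm _ (l / 2)) ?divr_gt0// => q; apply: (le_trans q).
  by rewrite (_ : 2 * _ = 3 * K) //; field; rewrite gt_eqF.
have EB : `|u x y - u x0 y0| <= B.
  rewrite (_ : _ - _ = (u x y - u (p n i) (h n)) + (- (S n i - u (p n i) (h n)) +
     (X n i + ((S 0%N 0%N - u a l) + (u a l - u x0 y0))))); last by rewrite /X; ring.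
  have n1 := ler_normD (u x y - u (p n i) (h n)) (- (S n i - u (p n i) (h n)) +
     (X n i + ((S 0%N 0%N - u a l) + (u a l - u x0 y0)))).
  have n2 := ler_normD (- (S n i - u (p n i) (h n))) (X n i + ((S 0%N 0%N - u a l) + (u a l - u x0 y0))).
  have n3 := ler_normD (X n i) ((S 0%N 0%N - u a l) + (u a l - u x0 y0)).
  have n4 := ler_normD (S 0%N 0%N - u a l) (u a l - u x0 y0).
  rewrite normrN in n2; rewrite /B; lra.
have fw : normc (derive1 f w) = k * expR (u x y).
  by have := uk x y y1; rewrite /x /y xy_eta => ->.
suff bnd d0 d1 : d0 = k * expR (u x0 y0) -> d1 = k * expR (u x y) ->
    (expR B + 24)^-1 * d0 <= d1 <= (expR B + 24) * d0 by exact: bnd (uk x0 y0 y00) fw.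
move=> -> ->.
have C0 : 0 < expR B + 24 by rewrite addr_gt0 ?expR_gt0.
have eB : expR B <= expR B + 24 by rewrite lerDl.
have B1 : expR (u x y) <= expR B * expR (u x0 y0).
  by rewrite -expRD ler_expR; move: EB; rewrite ler_norml; lra.
have B2 : expR (u x0 y0) <= expR B * expR (u x y).
  by rewrite -expRD ler_expR; move: EB; rewrite ler_norml; lra.
apply/andP; split.
  rewrite ler_pdivrMl// mulrCA ler_pM2l//; apply: (le_trans B2).
  by rewrite ler_wpM2r ?expR_ge0.
rewrite mulrCA ler_pM2l//; apply: (le_trans B1).
by rewrite ler_wpM2r ?expR_ge0.
Qed.
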